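(* Let $\Omega=B(0;1)=\{x\in\mathbb R^3:|x|<1\}$. There exists an initial datum $f_0(x,v)\in C^\infty$, compactly supported in $B(0;1)\times B(0;1)$, so that the solution $f$ to $$\partial_tf+v\cdot\nabla_xf=0,\qquad f|_{t=0}=f_0,\qquad f(t,x,v)|_{\gamma_-}=c_\mu\sqrt{\mu(v)}\int_{n(x)\cdot u>0}f(t,x,u)\sqrt{\mu(u)}\{n(x)\cdot u\}\,du,$$ satisfies $$\int_0^1\int_{\gamma_-}|\nabla_xf(s,x,v)|^2\,d\gamma\,ds=+\infty.$$ Consequently the estimate $$\|\nabla_xf(t)\|_p^p+\|\nabla_vf(t)\|_p^p+\int_0^t\big[|\nabla_xf(s)|_{\gamma,p}^p+|\nabla_vf(s)|_{\gamma,p}^p\big]ds\lesssim_t\|\nabla_xf_0\|_p^p+\|\nabla_vf_0\|_p^p+P(\|e^{\theta|v|^2}f_0\|_\infty)$$ ($P$ a polynomial, $0<\theta<\frac14$) fails for $p=2$.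
   Context: $n(x)$ is the outward unit normal at $x\in\partial\Omega$ (here $n(x)=x/|x|$), $\gamma_-=\{(x,v)\in\partial\Omega\times\mathbb R^3:n(x)\cdot v<0\}$, $d\gamma=|n(x)\cdot v|\,dS_x\,dv$ with $dS_x$ the surface measure. $\mu(v)=e^{-|v|^2/2}$ and $c_\mu\int_{n(x)\cdot u>0}\mu(u)\{n(x)\cdot u\}du=1$. $\|\cdot\|_p$ is the $L^p(\Omega\times\mathbb R^3)$ norm and $|\cdot|_{\gamma,p}$ the $L^p(\partial\Omega\times\mathbb R^3;d\gamma)$ norm; $\lesssim_t$ denotes an inequality up to a constant depending on $t$. *)

(* Defs.v *)
From HB Require Import structures.
From mathcomp Require Import all_boot all_order all_algebra.
From mathcomp Require Import all_classical all_reals all_analysis.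

Set Implicit Arguments.
Unset Strict Implicit.
Unset Printing Implicit Defensive.

Import Order.TTheory GRing.Theory Num.Theory numFieldNormedType.Exports.

Local Open Scope classical_set_scope.
Local Open Scope ring_scope.

(* R^3 is a nested product, so that it carries both the product topology and
   the product measurable structure. *)
Notation R3 R := (R * R * R)%type.

Lemma sigma_finite_prod d1 d2 (T1 : measurableType d1) (T2 : measurableType d2)
    (R : realType) (m1 : {sigma_finite_measure set T1 -> \bar R})
    (m2 : {sigma_finite_measure set T2 -> \bar R}) :
  sigma_finite [set: T1 * T2] (m1 \x m2)%E.
Proof.
have /sigma_finiteP[F [TF ndF Foo]] := sigma_finiteT m1.
have /sigma_finiteP[G [TG ndG Goo]] := sigma_finiteT m2.
exists (fun n => F n `*` G n).
  rewrite -setXTT TF TG predeqE => -[x y]; split.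
    move=> [/= [n _ Fnx] [k _ Gky]]; exists (maxn n k) => //; split.
    - by move: x Fnx; exact/subsetPset/ndF/leq_maxl.
    - by move: y Gky; exact/subsetPset/ndG/leq_maxr.
  by move=> [n _ []/= ? ?]; split; exists n.
move=> k; have [? ?] := Foo k; have [? ?] := Goo k.
split; first exact: measurableX.
by rewrite product_measure1E// lte_mul_pinfty// ge0_fin_numE.
Qed.

Section lebesgue_Rn.
Context {R : realType}.
Local Notation MR := (measurableTypeR R).
Local Notation leb := (@lebesgue_measure R).

(* The library's canonical sigma-finite structure on [m1 \x m2] is shadowed by
   the one for subprobabilities, hence the explicit instances. *)
Definition leb2 : set (MR * MR) -> \bar R := (leb \x leb)%E.
HB.instance Definition _ := Measure.on leb2.
Let leb2_sigma_finite : sigma_finite setT leb2.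
Proof. exact: sigma_finite_prod. Qed.
HB.instance Definition _ :=
  Measure_isSigmaFinite.Build _ _ _ leb2 leb2_sigma_finite.

Definition leb3 : set (MR * MR * MR) -> \bar R := (leb2 \x leb)%E.
HB.instance Definition _ := Measure.on leb3.
Let leb3_sigma_finite : sigma_finite setT leb3.
Proof. exact: sigma_finite_prod. Qed.
HB.instance Definition _ :=
  Measure_isSigmaFinite.Build _ _ _ leb3 leb3_sigma_finite.

Definition leb33 : set ((MR * MR * MR) * (MR * MR * MR)) -> \bar R :=
  (leb3 \x leb3)%E.
HB.instance Definition _ := Measure.on leb33.
Let leb33_sigma_finite : sigma_finite setT leb33.
Proof. exact: sigma_finite_prod. Qed.
HB.instance Definition _ :=
  Measure_isSigmaFinite.Build _ _ _ leb33 leb33_sigma_finite.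

End lebesgue_Rn.

Section geometry.
Context {R : realType}.
Implicit Types x u v : R3 R.

Definition dot u v : R := u.1.1 * v.1.1 + u.1.2 * v.1.2 + u.2 * v.2.

(* The library norm on a product is the maximum norm. *)
Definition enorm u : R := Num.sqrt (dot u u).

Definition unit_ball : set (R3 R) := [set x | enorm x < 1].
Definition unit_sphere : set (R3 R) := [set x | enorm x = 1].
Definition closed_unit_ball : set (R3 R) := [set x | enorm x <= 1].

Definition normal x : R3 R := (enorm x)^-1 *: x.

(* [gamma_full] is the whole phase boundary; [gamma_zero] its grazing part. *)
Definition gamma_full : set (R3 R * R3 R) := [set z | unit_sphere z.1].
Definition gamma_minus : set (R3 R * R3 R) :=
  [set z | unit_sphere z.1 /\ dot (normal z.1) z.2 < 0].
Definition gamma_zero : set (R3 R * R3 R) :=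
  [set z | unit_sphere z.1 /\ dot (normal z.1) z.2 = 0].

(* Surface measure of the unit sphere through its parametrization by
   a.1 = colatitude and a.2 = longitude, whose area element is
   |d_1 X x d_2 X| = sin a.1. *)
Definition sphere_point (a : R * R) : R3 R :=
  (sin a.1 * cos a.2, sin a.1 * sin a.2, cos a.1).

Definition sphere_integral (h : R3 R -> \bar R) : \bar R :=
  (\int[leb2]_(a in `[0%R, pi%R] `*` `[0%R, (2 * pi)%R])
     (h (sphere_point a) * (sin a.1)%:E))%E.

(* integral of [h] over [A] with respect to |n(x).v| dS_x dv; meant for
   nonnegative [h] *)
Definition gamma_integral (A : set (R3 R * R3 R)) (h : R3 R -> R3 R -> \bar R) :
    \bar R :=
  sphere_integral (fun x =>
    \int[leb3]_(v in [set v | A (x, v)]) (h x v * `|dot (normal x) v|%:E))%E.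

Definition maxwellian v : R := expR (- (enorm v ^+ 2) / 2).

End geometry.

Section calculus.
Context {R : realType}.

Definition grad (g : R3 R -> R) (x : R3 R) : R3 R :=
  ('D_((1, 0, 0) : R3 R) g x, 'D_((0, 1, 0) : R3 R) g x,
   'D_((0, 0, 1) : R3 R) g x).

Fixpoint iter_derive (E : normedModType R) (l : seq E) (g : E -> R) : E -> R :=
  if l is e :: l' then 'D_e (iter_derive l' g) else g.

Definition smooth (E : normedModType R) (g : E -> R) : Prop :=
  forall l : seq E, continuous (iter_derive l g) /\
    forall e z, derivable (iter_derive l g) z e.

Definition test_datum (f0 : R3 R * R3 R -> R) : Prop :=
  let supp := closure [set z | f0 z != 0] in
  [/\ smooth f0, compact supp & supp `<=` unit_ball `*` unit_ball].

Implicit Types (f : R -> R3 R -> R3 R -> R) (t : R) (x v : R3 R).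

Definition grad_x f t x v : R3 R := grad (fun y => f t y v) x.
Definition grad_v f t x v : R3 R := grad (fun w => f t x w) v.

(* componentwise boundary value of a vector field, as a limit from inside the
   ball *)
Definition trace (G : R3 R -> R3 R) x : R3 R :=
  let tr (g : R3 R -> R) : R := lim (g y @[y --> within unit_ball (nbhs x)]) in
  (tr (fun y => (G y).1.1), tr (fun y => (G y).1.2), tr (fun y => (G y).2)).

Definition bdry_grad_x f t x v : R3 R := trace (fun y => grad_x f t y v) x.
Definition bdry_grad_v f t x v : R3 R := trace (fun y => grad_v f t y v) x.

Definition uncurry3 f (z : R * (R3 R * R3 R)) : R := f z.1 z.2.1 z.2.2.

Definition interior_dom : set (R * (R3 R * R3 R)) :=
  [set z | 0 < z.1 /\ unit_ball z.2.1].

Definition closed_dom : set (R * (R3 R * R3 R)) :=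
  [set z | [/\ 0 <= z.1, closed_unit_ball z.2.1 & ~ gamma_zero z.2]].

(* Classical solutions of free transport with diffuse reflection: C^1 up to
   the boundary away from the grazing set, where solutions are in general
   singular, and bounded on bounded time intervals (this is what makes the
   boundary integral converge and the solution unique). [c] stands for c_mu. *)
Record diffuse_solution (c : R) (f0 : R3 R * R3 R -> R) f : Prop := {
  sol_continuous : {within closed_dom, continuous (uncurry3 f)} ;
  sol_differentiable : forall z, interior_dom z -> differentiable (uncurry3 f) z ;
  sol_C1 : forall e : R * (R3 R * R3 R),
    exists2 G : R * (R3 R * R3 R) -> R, {within closed_dom, continuous G} &
      forall z, interior_dom z -> G z = 'D_e (uncurry3 f) z ;
  sol_transport : forall t x v, 0 < t -> unit_ball x ->
    derive1 (fun s => f s x v) t + dot v (grad_x f t x v) = 0 ;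
  sol_initial : forall x v, unit_ball x -> f 0 x v = f0 (x, v) ;
  sol_diffuse : forall t x v, 0 <= t -> gamma_minus (x, v) ->
    f t x v = c * Num.sqrt (maxwellian v) *
      \int[leb3]_(u in [set u | 0 < dot (normal x) u])
        (f t x u * Num.sqrt (maxwellian u) * dot (normal x) u) ;
  sol_bounded : forall T : R, exists M : R, forall t x v,
    t <= T -> closed_dom (t, (x, v)) -> `|f t x v| <= M }.

End calculus.

Section estimate.
Context {R : realType}.
Implicit Types (p theta t : R) (P : {poly R}).

(* p-th power of the L^p norm over Omega x R^3 of a vector field *)
Definition Lp_pow p (G : R3 R -> R3 R -> R3 R) : \bar R :=
  (\int[leb33]_(z in unit_ball `*` setT) (enorm (G z.1 z.2) `^ p)%:E)%E.

(* p-th power of the L^p norm over the phase boundary with measure d gamma *)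
Definition bdry_Lp_pow p (G : R3 R -> R3 R -> R3 R) : \bar R :=
  gamma_integral gamma_full (fun x v => (enorm (G x v) `^ p)%:E).

Definition weighted_sup theta (f0 : R3 R * R3 R -> R) : \bar R :=
  ('N[leb33]_+oo[
    (fun z => (expR (theta * enorm z.2 ^+ 2) * f0 z)%:E)
      \_ (unit_ball `*` setT)])%E.

(* The W^{1,p} estimate at time [t], with a constant that does not depend on
   the data, for data in C_c^infty(B(0;1) x B(0;1)). *)
Definition W1p_estimate (c p theta : R) P t : Prop :=
  exists C : R, forall f0 f, test_datum f0 -> diffuse_solution c f0 f ->
    (Lp_pow p (grad_x f t) + Lp_pow p (grad_v f t)
     + \int[lebesgue_measure]_(s in `[0%R, t])
         (bdry_Lp_pow p (bdry_grad_x f s) + bdry_Lp_pow p (bdry_grad_v f s))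
     <= C%:E * (Lp_pow p (fun x v => grad (fun y => f0 (y, v)) x)
                + Lp_pow p (fun x v => grad (fun w => f0 (x, w)) v)
                + (P.[fine (weighted_sup theta f0)])%:E))%E.

End estimate.

(* Main.v *)
Require Import Defs.
From HB Require Import structures.
From mathcomp Require Import all_boot all_order all_algebra.
From mathcomp Require Import all_classical all_reals all_analysis.
From mathcomp Require Import measurable_realfun ring lra.
Set Implicit Arguments.
Unset Strict Implicit.
Unset Printing Implicit Defensive.
Import Order.TTheory GRing.Theory Num.Theory numFieldNormedType.Exports.
Local Open Scope classical_set_scope.
Local Open Scope ring_scope.

(* For a rotation invariant datum the boundary flux of the solution depends on time only, and is
   the solution phi of a renewal equation phi = S + A phi on the half line: S is the flux of the
   particles that have not yet met the boundary, and A averages phi over the times of flight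
   along the chords of the ball. A is a contraction in sup norm on every bounded time interval,
   because slow particles need arbitrarily long to cross the ball, so phi exists and inherits the
   C^1 regularity of S. With t_b the backward exit time, the solution is
     f(t,x,v) = f0(x - t v, v) + sqrt(mu(v)) phi(t - t_b(x,v)).
   On gamma_- one has n . grad_x t_b = 1 / (n . v), hence
   |grad_x f|^2 |n . v| >= mu(v) phi'(t)^2 / |n . v|, whose integral in v diverges
   logarithmically at the grazing set as soon as phi'(t) <> 0; this happens on a time interval
   since S(1) > 0 = phi(0). *)

(** * Measure theory on R^3 *)

(** Symmetry turns the unknown flux, a function of time and boundary point, into a function of time
    alone. The price is a measure-preserving rotation carrying the north pole to a given boundary
    point; as the measure on R^3 is an iterated product, rotations are composed from shears, which
    product measures handle section by section. The datum is smooth on the whole space and supported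
    inside the ball, so S and S' vanish for t <= 0, and phi extended by zero to negative times is
    C^1 across t = 0. Its regularity comes from solving the equation for the derivative first and
    integrating afterwards. Uniqueness cannot use the symmetry: the flux of an arbitrary solution
    may depend on the boundary point. The same contraction then works for the supremum over times
    and boundary points together. The divergent integrals are bounded below by comparing suprema of
    simple functions, so gradients and traces are never shown to be measurable. *)

Section mono.
Local Open Scope ereal_scope.
Context d (T : measurableType d) (R : realType) (mu : {measure set T -> \bar R}).

Import HBNNSimple.

(** The integral of a nonnegative function is a supremum over the simple functions below it, and a
    simple function below [f] extended by zero lies below [g] extended by zero. This allows
    integrands whose measurability is unknown, such as boundary gradients. *)
Lemma ge0_subset_le_integral (D E : set T) (f g : T -> \bar R) :
  (forall x, D x -> 0 <= f x) -> (forall x, E x -> 0 <= g x) ->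
  (forall x, D x -> E x /\ f x <= g x) ->
  \int[mu]_(x in D) f x <= \int[mu]_(x in E) g x.
Proof.
move=> f0 g0 fg; rewrite !ge0_integralE//.
apply: le_ereal_sup => _ [h hf <-]; exists h => // x.
apply: (le_trans (hf x)); rewrite /patch; case: ifPn => xD.
  by have [Ex fgx] := fg x (set_mem xD); rewrite mem_set.
by case: ifPn => // /set_mem; exact: g0.
Qed.

End mono.

Section shears.
Local Open Scope ereal_scope.
Context {R : realType}.
Local Notation MR := (measurableTypeR R).
Local Notation leb := (@lebesgue_measure R).

(** Lebesgue measure is determined by its values on half-open intervals, where the pushforward by a
    translation agrees with it. *)
Lemma lebesgue_measure_shift (a : R) (A : set MR) : measurable A ->
  leb ((fun x : MR => (a + x)%R : MR) @^-1` A) = leb A.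
Proof.
move=> mA.
have mf : measurable_fun setT (fun x : MR => (a + x)%R : MR) by exact: measurable_funD.
pose m := pushforward leb (fun x : MR => (a + x)%R : MR).
have mE : forall X, ocitv X -> leb X = m X.
  move=> X [[x y] _ <-]; rewrite /m /pushforward.
  have -> : (fun x : MR => (a + x)%R : MR) @^-1` (`]x, y]%classic : set R) =
      (`](x - a)%R, (y - a)%R]%classic : set R).
    by apply/seteqP; split => z /=; rewrite !in_itv/=; lra.
  rewrite !lebesgue_measure_itv/= !lte_fin ltrD2r; case: ifP => // _.
  by rewrite -!EFinD; congr (_%:E); ring.
exact/esym/(lebesgue_measure_unique mE).
Qed.

Context d1 d2 (T1 : measurableType d1) (T2 : measurableType d2).
Variables (m1 : {sigma_finite_measure set T1 -> \bar R})
  (m2 : {sigma_finite_measure set T2 -> \bar R}).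

(** The product measure integrates the measures of the x-sections, and the shear acts on each of
    them by a map preserving [m2]. *)
Lemma product_measure1_shear (g : T1 -> T2 -> T2) (A : set (T1 * T2)) :
  measurable_fun setT (fun z : T1 * T2 => (z.1, g z.1 z.2)) ->
  (forall x B, measurable B -> m2 (g x @^-1` B) = m2 B) ->
  measurable A ->
  (m1 \x m2) ((fun z : T1 * T2 => (z.1, g z.1 z.2)) @^-1` A) = (m1 \x m2) A.
Proof.
move=> mg gE mA; apply: eq_integral => x _ /=.
rewrite -(gE x (xsection A x)); last exact: measurable_xsection.
by congr (m2 _); apply/seteqP; split => y; rewrite /xsection/= !inE.
Qed.

(** Here the y-sections are moved, so the product is first replaced by the one integrated in the
    other order; the two agree by uniqueness of the product measure. *)
Lemma product_measure1_shear2 (g : T2 -> T1 -> T1) (A : set (T1 * T2)) :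
  measurable_fun setT (fun z : T1 * T2 => (g z.2 z.1, z.2)) ->
  (forall y B, measurable B -> m1 (g y @^-1` B) = m1 B) ->
  measurable A ->
  (m1 \x m2) ((fun z : T1 * T2 => (g z.2 z.1, z.2)) @^-1` A) = (m1 \x m2) A.
Proof.
move=> mg gE mA.
have E X : measurable X -> (m1 \x m2) X = (m1 \x^ m2) X.
  move=> mX; apply: (product_measure_unique (m' := m1 \x^ m2)) => // B C mB mC.
  exact: product_measure2E.
rewrite !E//; last by rewrite -[X in measurable X]setTI; exact: mg.
apply: eq_integral => x _ /=.
rewrite -(gE x (ysection A x)); last exact: measurable_ysection.
by congr (m1 _); apply/seteqP; split => y; rewrite /ysection/= !inE.
Qed.

End shears.

(** * Measurability of open sets and of continuous functions on R^3 *)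

Section open_measurable.

(** An open set is measurable for a product sigma-algebra once it is a countable union of measurable
    boxes. The family [M] is a bare parameter, so that the property passes to products without tying
    the topology to a measurable structure. *)
Definition countable_measurable_basis (T : topologicalType)
    (M : set (set T)) :=
  exists2 B : nat -> set T, (forall n, M (B n)) &
    forall x U, nbhs x U -> exists n, B n x /\ B n `<=` U.

Lemma countable_measurable_basis_prod (T1 T2 : topologicalType)
    (M1 : set (set T1)) (M2 : set (set T2)) (M : set (set (T1 * T2))) :
  countable_measurable_basis M1 -> countable_measurable_basis M2 ->
  (forall A B, M1 A -> M2 B -> M (A `*` B)) ->
  countable_measurable_basis M.
Proof.
move=> [B1 mB1 hB1] [B2 mB2 hB2] hM.
(* Integers that code no pair fall back to the pair (0, 0), whose box is still in [M]. *)
exists (fun n => let p := odflt (0, 0)%N (unpickle n) in B1 p.1 `*` B2 p.2).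
  by move=> n; exact: hM.
move=> [x y] U [[U1 U2]/= [/hB1[n [Bx BU1]] /hB2[m [By BU2]]] UU].
exists (pickle (n, m)); rewrite pickleK/=; split => //.
by move=> [a b] [/= /BU1 ? /BU2 ?]; exact: UU.
Qed.

Lemma countable_measurable_basis_R (R : realType) :
  countable_measurable_basis (measurable : set (set R)).
Proof.
exists (fun n => if unpickle n is Some (p, q) then
   `](ratr (p : rat) : R), (ratr (q : rat) : R)[%classic else set0).
  by move=> n; case: (unpickle n) => [[p q]|].
move=> x U /nbhs_ballP[e /= e0 xeU].
have [p] : exists p : rat, ratr p \in `]x - e, x[.
  by apply: rat_in_itvoo; rewrite ltrBlDr ltrDl.
rewrite in_itv/= => /andP[p1 p2].
have [q] : exists q : rat, ratr q \in `]x, x + e[.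
  by apply: rat_in_itvoo; rewrite ltrDl.
rewrite in_itv/= => /andP[q1 q2].
exists (pickle (p, q)); rewrite pickleK/= in_itv/= p2 q1; split => // z/=.
rewrite in_itv/= => /andP[z1 z2]; apply: xeU; rewrite /ball/= ltr_norml.
by apply/andP; split; lra.
Qed.

Lemma measurable_open_R3 (R : realType) (U : set (R3 R)) :
  open U -> measurable U.
Proof.
move=> oU; have [B mB hB] : countable_measurable_basis
    (measurable : set (set (R3 R))).
  apply: countable_measurable_basis_prod (countable_measurable_basis_R R) _.
    apply: countable_measurable_basis_prod (countable_measurable_basis_R R)
      (countable_measurable_basis_R R) _.
    by move=> A B; exact: measurableX.
  by move=> A B; exact: measurableX.
have -> : U = \bigcup_(n in [set n | B n `<=` U]) B n.
  apply/seteqP; split => [x Ux|x [n /= + Bnx]]; last exact.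
  have [n [Bnx BU]] := hB x U (open_nbhs_nbhs (conj oU Ux)).
  by exists n.
by apply: bigcup_measurable => n _; exact: mB.
Qed.

Lemma continuous_measurable_R3 (R : realType) (D : set (R3 R))
    (f : R3 R -> R) : open D -> (forall x, D x -> {for x, continuous f}) ->
  measurable_fun D f.
Proof.
move=> oD cf; apply: (measurability _ (RGenOpens.measurableE R)) => //.
move=> _ [_ [a [b ->] <-]]; apply: measurable_open_R3.
rewrite openE => x [Dx /= fx].
rewrite /interior/=; apply: filterI; first exact: open_nbhs_nbhs.
apply: (cf x Dx); apply: open_nbhs_nbhs; split => //; exact: interval_open.
Qed.

Lemma continuous_measurable_R3T (R : realType) (D : set (R3 R))
    (f : R3 R -> R) : continuous f -> measurable D -> measurable_fun D f.
Proof.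
move=> cf mD; apply: (@measurable_funS _ _ _ _ setT) => //.
by apply: continuous_measurable_R3; [exact: openT|move=> x _; exact: cf].
Qed.

End open_measurable.

Arguments product_measure1_shear {R d1 d2 T1 T2} m1 m2 g A.
Arguments product_measure1_shear2 {R d1 d2 T1 T2} m1 m2 g A.

(** * Rotation invariance of Lebesgue measure *)

Section rotations.
Context {R : realType}.
Local Notation MR := (measurableTypeR R).
Local Notation leb := (@lebesgue_measure R).

Definition leb3_preserving (T : R3 R -> R3 R) :=
  measurable_fun setT T /\
  forall A : set (R3 R), measurable A -> leb3 (T @^-1` A) = leb3 A.

Lemma leb3_preserving_comp S T : leb3_preserving S -> leb3_preserving T ->
  leb3_preserving (S \o T).
Proof.
move=> [mS hS] [mT hT]; split; first exact: measurableT_comp.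
move=> A mA; rewrite comp_preimage hT ?hS//.
by rewrite -[X in measurable X]setTI; exact: mS.
Qed.

(** With a = (1 - c) / s, the rotation is the horizontal shear by a, then the vertical shear by -s,
    then the horizontal shear by a again. The predicate [Q] is abstract so that the argument applies
    in two different coordinate planes. *)
Lemma plane_rotation_shears (Q : (R * R -> R * R) -> Prop) (c s : R) :
  (forall f g, Q f -> Q g -> Q (f \o g)) ->
  (forall a, Q (fun p => (p.1 + a * p.2, p.2))) ->
  (forall a, Q (fun p => (p.1, p.2 + a * p.1))) ->
  c ^+ 2 + s ^+ 2 = 1 -> Q (fun p => (c * p.1 + s * p.2, - s * p.1 + c * p.2)).
Proof.
move=> Qc QU QL.
have Qs c' s' : s' != 0 -> c' ^+ 2 + s' ^+ 2 = 1 ->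
    Q (fun p => (c' * p.1 + s' * p.2, - s' * p.1 + c' * p.2)).
  move=> s0 cs.
  have -> : (fun p : R * R => (c' * p.1 + s' * p.2, - s' * p.1 + c' * p.2)) =
    (fun p => (p.1 + ((1 - c') / s') * p.2, p.2)) \o
    ((fun p => (p.1, p.2 + (- s') * p.1)) \o
     (fun p => (p.1 + ((1 - c') / s') * p.2, p.2))).
    apply/funext => -[x y] /=; have e : s' * s' = 1 - c' * c' by rewrite -!expr2 -cs; ring.
    congr (_, _); last by field.
    transitivity (x * c' + y * ((1 - c' * c') / s')); last by field.
    by rewrite -e; field.
  by apply: (Qc _ _ _ (Qc _ _ _ _)).
have [-> cs|s0] := eqVneq s 0; last exact: Qs.
have : c ^+ 2 == 1 by rewrite -cs expr0n addr0.
rewrite sqrf_eq1 => /orP[/eqP->|/eqP->].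
  have -> : (fun p : R * R => (1 * p.1 + 0 * p.2, - 0 * p.1 + 1 * p.2)) =
    (fun p => (p.1 + 0 * p.2, p.2)).
    by apply/funext => -[x y] /=; congr (_, _); ring.
  exact: QU.
(* The half turn has s = 0 and escapes the three-shear formula, but it is the square of the quarter
   turn. *)
have -> : (fun p : R * R => (-1 * p.1 + 0 * p.2, - 0 * p.1 + -1 * p.2)) =
    (fun p => (0 * p.1 + 1 * p.2, - 1 * p.1 + 0 * p.2)) \o
    (fun p => (0 * p.1 + 1 * p.2, - 1 * p.1 + 0 * p.2)).
  by apply/funext => -[x y] /=; congr (_, _); ring.
by apply: Qc; apply: Qs; rewrite ?oner_eq0//; ring.
Qed.

Let act12 (f : R * R -> R * R) (x : R3 R) : R3 R := (f x.1, x.2).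
Let act23 (f : R * R -> R * R) (x : R3 R) : R3 R :=
  let p := f (x.1.2, x.2) in (x.1.1, p.1, p.2).

Lemma measurable_pair3 (f g h : R3 R -> R) : measurable_fun setT f ->
  measurable_fun setT g -> measurable_fun setT h ->
  measurable_fun setT (fun x => (f x, g x, h x)).
Proof. by move=> mf mg mh; do !apply: measurable_fun_pair. Qed.

Lemma measurable_coord1 : measurable_fun setT (fun x : R3 R => x.1.1).
Proof. exact: measurableT_comp. Qed.
Lemma measurable_coord2 : measurable_fun setT (fun x : R3 R => x.1.2).
Proof. exact: measurableT_comp. Qed.
Lemma measurable_coord3 : measurable_fun setT (fun x : R3 R => x.2).
Proof. exact: measurable_snd. Qed.

#[local] Hint Resolve measurable_coord1 measurable_coord2 measurable_coord3 : core.

Lemma leb2_shear1 (a : R -> R) (A : set (MR * MR)) : measurable_fun setT a ->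
  measurable A ->
  leb2 ((fun p : MR * MR => (a p.2 + p.1, p.2) : MR * MR) @^-1` A) = leb2 A.
Proof.
move=> ma mA.
apply: (product_measure1_shear2 leb leb
     (fun y x => (a y + x) : MR) A) => //.
  apply: measurable_fun_pair => //; apply: measurable_funD => //.
  exact: measurableT_comp.
by move=> y B mB; exact: lebesgue_measure_shift.
Qed.

Lemma leb2_shear2 (a : R -> R) (A : set (MR * MR)) : measurable_fun setT a ->
  measurable A ->
  leb2 ((fun p : MR * MR => (p.1, a p.1 + p.2) : MR * MR) @^-1` A) = leb2 A.
Proof.
move=> ma mA.
apply: (product_measure1_shear leb leb
     (fun y x => (a y + x) : MR) A) => //.
  apply: measurable_fun_pair => //; apply: measurable_funD => //.
  exact: measurableT_comp.
by move=> y B mB; exact: lebesgue_measure_shift.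
Qed.

Lemma measurable_mulr (a : R) : measurable_fun setT (fun z : R => a * z).
Proof. exact: measurable_funM. Qed.

Lemma leb3_preserving_act12 c s : c ^+ 2 + s ^+ 2 = 1 ->
  leb3_preserving (fun x => (c * x.1.1 + s * x.1.2, - s * x.1.1 + c * x.1.2, x.2)).
Proof.
move=> cs; apply: (plane_rotation_shears (Q := fun f => leb3_preserving (act12 f))) cs.
- by move=> f g Qf Qg; exact: leb3_preserving_comp Qf Qg.
- move=> a; have m : measurable_fun setT (act12 (fun p => (p.1 + a * p.2, p.2))).
    apply: measurable_pair3 => //.
    by apply: measurable_funD => //; exact: measurable_funM.
  split; first exact: m. move=> A mA.
  apply: (product_measure1_shear2 leb2 leb
     (fun _ (p : MR * MR) => (p.1 + a * p.2, p.2) : MR * MR) A); [exact: m| |exact: mA].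
  move=> y B mB; rewrite -[RHS](leb2_shear1 (measurable_mulr a) mB).
  by congr (leb2 _); apply/funext => p /=; rewrite addrC.
- move=> a; have m : measurable_fun setT (act12 (fun p => (p.1, p.2 + a * p.1))).
    apply: measurable_pair3 => //.
    by apply: measurable_funD => //; exact: measurable_funM.
  split; first exact: m. move=> A mA.
  apply: (product_measure1_shear2 leb2 leb
     (fun _ (p : MR * MR) => (p.1, p.2 + a * p.1) : MR * MR) A); [exact: m| |exact: mA].
  move=> y B mB; rewrite -[RHS](leb2_shear2 (measurable_mulr a) mB).
  by congr (leb2 _); apply/funext => p /=; rewrite addrC.
Qed.

(** Coordinates 2 and 3 lie in different factors of [leb2 \x leb]: one kind of shear moves the first
    factor by an amount read off the second, the other kind does the reverse, hence one use of each
    product lemma. *)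
Lemma leb3_preserving_act23 c s : c ^+ 2 + s ^+ 2 = 1 ->
  leb3_preserving (fun x => (x.1.1, c * x.1.2 + s * x.2, - s * x.1.2 + c * x.2)).
Proof.
move=> cs; apply: (plane_rotation_shears (Q := fun f => leb3_preserving (act23 f))) cs.
- move=> f g Qf Qg; have := leb3_preserving_comp Qf Qg.
  rewrite (_ : act23 f \o _ = act23 (f \o g))//.
  by apply/funext => x; rewrite /act23/= -!surjective_pairing.
- move=> a; have m : measurable_fun setT (act23 (fun p => (p.1 + a * p.2, p.2))).
    apply: measurable_pair3 => //.
    by apply: measurable_funD => //; exact: measurable_funM.
  split; first exact: m. move=> A mA.
  have := product_measure1_shear2 leb2 leb
     (fun y (p : MR * MR) => (p.1, p.2 + a * y) : MR * MR) A m.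
  apply; [|exact: mA]; move=> y B mB; rewrite -[RHS](@leb2_shear2 (fun z => a * y))//.
  by congr (leb2 _); apply/funext => p /=; rewrite addrC.
- move=> a; have m : measurable_fun setT (act23 (fun p => (p.1, p.2 + a * p.1))).
    apply: measurable_pair3 => //.
    by apply: measurable_funD => //; exact: measurable_funM.
  have E : act23 (fun p => (p.1, p.2 + a * p.1)) =
     (fun x : R3 R => (x.1, x.2 + a * x.1.2)).
    by apply/funext => -[[x y] z].
  rewrite E in m *; split; first exact: m. move=> A mA.
  apply: (product_measure1_shear leb2 leb
     (fun (p : MR * MR) y => (y + a * p.2) : MR) A); [exact: m| |exact: mA].
  move=> y B mB; rewrite -[RHS](@lebesgue_measure_shift _ (a * y.2))//.
  by congr (leb _); apply/funext => p /=; rewrite addrC.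
Qed.

Lemma R3_linE (u v : R3 R) (a : R) : u + a *: v =
  (u.1.1 + a * v.1.1, u.1.2 + a * v.1.2, u.2 + a * v.2).
Proof. by move: u v => [[? ?] ?] [[? ?] ?]. Qed.

Definition north_pole : R3 R := (0, 0, 1).

(** Exactly the properties of a rotation that the sequel draws on. Linearity is stated in the shape
    [u + a *: v] of a point on a trajectory. *)
Record rotation (T : R3 R -> R3 R) := {
  rotation_measurable : measurable_fun setT T ;
  rotation_preserving : forall A : set (R3 R), measurable A ->
    leb3 (T @^-1` A) = leb3 A ;
  rotation_linear : forall u v a, T (u + a *: v) = T u + a *: T v ;
  rotation_dot : forall u v, dot (T u) (T v) = dot u v }.

Lemma exists_rotation (n : R3 R) : dot n n = 1 ->
  exists2 T, rotation T & T north_pole = n.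
Proof.
move: n => [[n1 n2] n3]; rewrite /dot/= => n_unit.
pose r := Num.sqrt (n1 ^+ 2 + n2 ^+ 2).
have r2 : r ^+ 2 = n1 ^+ 2 + n2 ^+ 2 by rewrite sqr_sqrtr// addr_ge0 ?sqr_ge0.
(* T1 will send the north pole to (0, r, n3) and T2 must send (0, r) to (n1, n2). If r = 0 the point
   is on the polar axis and the identity serves for T2. *)
have [c [s [cs sr cr]]] : exists c s, [/\ c ^+ 2 + s ^+ 2 = 1, s * r = n1 & c * r = n2].
  have [r0|r0] := eqVneq r 0.
    have /eqP : n1 ^+ 2 + n2 ^+ 2 = 0 by rewrite -r2 r0 expr0n.
    rewrite paddr_eq0 ?sqr_ge0// !sqrf_eq0 => /andP[/eqP-> /eqP->].
    by exists 1, 0; rewrite r0 !mulr0; split => //; ring.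
  exists (n2 / r), (n1 / r); rewrite !divfK//; split => //.
  by rewrite !expr_div_n -mulrDl addrC -r2 divff// expf_neq0.
pose T1 := fun x : R3 R => (x.1.1, n3 * x.1.2 + r * x.2, - r * x.1.2 + n3 * x.2) : R3 R.
pose T2 := fun x : R3 R => (c * x.1.1 + s * x.1.2, - s * x.1.1 + c * x.1.2, x.2) : R3 R.
have nr : n3 ^+ 2 + r ^+ 2 = 1 by rewrite r2 -n_unit; ring.
have [mT pT] : leb3_preserving (T2 \o T1).
  apply: leb3_preserving_comp; first exact: leb3_preserving_act12.
  exact: leb3_preserving_act23.
exists (T2 \o T1); last first.
  by rewrite /T1/T2/north_pole/= !mulr0 !mulr1 !add0r sr cr.
split => //.
- by move=> u v a; rewrite !R3_linE /T1 /T2 /=; congr (_, _, _); ring.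
- move=> [[u1 u2] u3] [[v1 v2] v3]; rewrite /T1 /T2 /dot/=.
  transitivity ((c ^+ 2 + s ^+ 2) * (u1 * v1) + (c ^+ 2 + s ^+ 2) * ((n3 * u2 + r * u3) * (n3 * v2 + r * v3))
     + (- r * u2 + n3 * u3) * (- r * v2 + n3 * v3)); first by ring.
  rewrite cs; transitivity (u1 * v1 + (n3 ^+ 2 + r ^+ 2) * (u2 * v2 + u3 * v3)); first by ring.
  by rewrite nr; ring.
Qed.

Lemma integral_rotation (T : R3 R -> R3 R) (D : set (R3 R)) (f : R3 R -> \bar R) :
  rotation T -> measurable D -> measurable_fun D f ->
  (\int[leb3]_(u in D) f u = \int[leb3]_(u in T @^-1` D) f (T u))%E.
Proof.
move=> [mT pT _ _] mD mf.
have ge0 (g : R3 R -> \bar R) : measurable_fun D g -> (forall u, 0 <= g u)%E ->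
   (\int[leb3]_(u in D) g u = \int[leb3]_(u in T @^-1` D) g (T u))%E.
  move=> mg g0; rewrite -(@ge0_integral_pushforward _ _ (MR * MR * MR)%type (MR * MR * MR)%type R
     T mT leb3 D g mD mg); last by move=> u _; exact: g0.
  by apply: eq_measure_integral => A mA _; exact/esym/pT.
rewrite integralE [RHS]integralE; congr (_ - _)%E.
- have m : measurable_fun D (f ^\+)%E by exact/measurable_funepos.
  rewrite (ge0 _ m (fun u => funepos_ge0 f u)).
  by apply: eq_integral => u _; rewrite !funeposE.
- have m : measurable_fun D (f ^\-)%E by exact/measurable_funeneg.
  rewrite (ge0 _ m (fun u => funeneg_ge0 f u)).
  by apply: eq_integral => u _; rewrite !funenegE.
Qed.

Lemma Rintegral_rotation (T : R3 R -> R3 R) (D : set (R3 R)) (f : R3 R -> R) :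
  rotation T -> measurable D -> measurable_fun D f ->
  \int[leb3]_(u in D) f u = \int[leb3]_(u in T @^-1` D) f (T u).
Proof.
move=> rT mD mf; congr fine.
by rewrite (integral_rotation rT mD)//; exact/measurable_EFinP.
Qed.

End rotations.

(** * Flat functions and C^1 functions *)

Section bump.
Context {R : realType}.
Implicit Types (s y : R) (k n : nat).

(** Raise the inequality y / n <= exp (y / n) to the power n. *)
Lemma expRN_exprn_le y n : 0 <= y -> expR (- y) * y ^+ n <= n%:R ^+ n.
Proof.
move=> y0; case: n => [|n]; first by rewrite !expr0 mulr1 -expR0 ler_expR oppr_le0.
set m := n.+1; have m0 : 0 < m%:R :> R by rewrite ltr0n.
rewrite expRN mulrC ler_pdivrMr ?expR_gt0//.
have -> : expR y = expR (y / m%:R) ^+ m by rewrite -expRM_natl mulrC divfK ?gt_eqF.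
rewrite -exprMn lerXn2r ?nnegrE ?mulr_ge0 ?expR_ge0 ?(ltW m0)//.
rewrite -ler_pdivrMl// (le_trans _ (expR_ge1Dx _))// mulrC.
by rewrite lerDr.
Qed.

(* These functions are closed under differentiation, see [is_derive_flat_bump]. *)
Definition flat_bump k s : R := if 0 < s then expR (- s^-1) * s^-1 ^+ k else 0.

Lemma flat_bump_ge0 k s : 0 <= flat_bump k s.
Proof.
by rewrite /flat_bump; case: ifPn => // s0; rewrite mulr_ge0 ?expR_ge0 ?exprn_ge0 ?invr_ge0 ?ltW.
Qed.

Lemma flat_bump_le k s : flat_bump k s <= k%:R ^+ k.
Proof.
rewrite /flat_bump; case: ifPn => [s0|_]; last by rewrite exprn_ge0.
by rewrite expRN_exprn_le ?invr_ge0 ?ltW.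
Qed.

Lemma flat_bump0 k s : s <= 0 -> flat_bump k s = 0.
Proof. by move=> s0; rewrite /flat_bump ltNge s0. Qed.

(** A quadratic bound at 0 makes the derivative there exist and vanish. *)
Lemma flat_bump_le_sqr k s : flat_bump k s <= k.+2%:R ^+ k.+2 * s ^+ 2.
Proof.
rewrite /flat_bump; case: ifPn => [s0|_]; last by rewrite mulr_ge0 ?sqr_ge0 ?exprn_ge0 ?ler0n.
rewrite -ler_pdivrMr ?exprn_gt0// -exprVn -mulrA -exprD addn2.
by rewrite expRN_exprn_le ?invr_ge0 ?ltW.
Qed.

Lemma is_derive_cvg (E F : normedModType R) (f : E -> F) (x v : E) (l : F) :
  h^-1 *: (f (h *: v + x) - f x) @[h --> 0^'] --> l -> is_derive x v f l.
Proof. by move=> fl; split; [by apply/cvg_ex; exists l|exact/cvg_lim]. Qed.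

Lemma is_derive_invr s : s != 0 -> is_derive s 1 (fun x : R => x^-1) (- s ^- 2).
Proof.
move=> s0; have di : derivable (id : R -> R) s 1 by exact: derivable_id.
apply: DeriveDef; first exact: (@derivableV _ _ id s 1 s0 di).
by rewrite (@deriveV _ _ id s 1 s0 di) derive_id /GRing.scale/= mulr1.
Qed.

Lemma is_derive_flat_bump k s :
  is_derive s 1 (flat_bump k) (flat_bump k.+2 s - k%:R * flat_bump k.+1 s).
Proof.
have [s0|s0|->] := ltgtP s 0.
- rewrite !flat_bump0 ?ltW// mulr0 subr0.
  apply: (near_eq_is_derive (f := cst 0)) => //.
  near=> x; rewrite flat_bump0// ltW//; near: x; exact: lt_nbhsl.
- have sn0 : s != 0 by rewrite gt_eqF.
  have dV := is_derive_invr sn0.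
  have dNV : is_derive s 1 (fun x : R => - x^-1) (s ^- 2).
    by have := is_deriveN dV; rewrite opprK.
  have dE := @is_derive1_comp _ expR (fun x : R => - x^-1) s _ _ (is_derive_expR _) dNV.
  have dX : is_derive s 1 (fun x : R => x^-1 ^+ k) (k%:R * s^-1 ^+ k.-1 * - s ^- 2).
    have dk : is_derive (s^-1) 1 (@GRing.exp R ^~ k) (k%:R * s^-1 ^+ k.-1).
      apply: DeriveDef; first exact: exprn_derivable.
      by rewrite exp_derive /GRing.scale/= mulr1.
    exact: (@is_derive1_comp _ (@GRing.exp R ^~ k) (fun x : R => x^-1) s _ _ dk dV).
  apply: (near_eq_is_derive (f := (expR \o (fun x : R => - x^-1)) * (fun x : R => x^-1 ^+ k))).
    near=> x; rewrite /flat_bump ifT//; near: x; exact: lt_nbhsr.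
  apply: (is_derive_eq (is_deriveM dE dX)).
  rewrite /flat_bump s0 /GRing.scale/= -exprVn; clear -k s.
  by case: k => [|k]/=; rewrite ?exprS; ring.
(* At the origin the difference quotient is squeezed by a multiple of |h|, thanks to
   [flat_bump_le_sqr]. *)
- rewrite !flat_bump0// mulr0 subr0; apply: is_derive_cvg.
  apply/norm_cvg0P; rewrite (flat_bump0 k (lexx 0)).
  apply: (@squeeze_cvgr _ _ _ _ (cst 0) (fun h => k.+2%:R ^+ k.+2 * `|h|)).
  + near=> h; rewrite normr_ge0/= subr0 addr0 /GRing.scale/= mulr1.
    rewrite normrM normfV ler_pdivrMl ?normr_gt0; last by by near: h; exact: nbhs_dnbhs_neq.
    rewrite (ger0_norm (flat_bump_ge0 _ _)) (le_trans (flat_bump_le_sqr _ _))//.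
    by rewrite -(real_normK (num_real h)) expr2 mulrCA.
  + exact: cvg_cst.
  + rewrite [X in _ --> X](_ : 0 = k.+2%:R ^+ k.+2 * `|0 : R|); last by rewrite normr0 mulr0.
    by apply: cvgM; [exact: cvg_cst|apply: cvg_norm; exact: cvg_within].
Unshelve. all: by end_near. Qed.

End bump.

Section C1on.
Context {R : realType}.

(** Continuity is required direction by direction because this is the form in which
    [diffuse_solution] asks for C^1 regularity. *)
Definition C1on (E : normedModType R) (U : set E) (g : E -> R) :=
  forall z, U z -> differentiable g z /\ forall e, {for z, continuous ('D_e g)}.

Section normed.
Context (E : normedModType R).
Implicit Types (U : set E) (g h : E -> R).

Lemma C1on_eq U g h : open U -> (forall z, U z -> g z = h z) ->
  C1on U g -> C1on U h.
Proof.
move=> oU gh Cg z Uz; have [dg cg] := Cg z Uz.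
have near_gh y : U y -> \forall x \near y, g x = h x.
  by move=> Uy; apply: filterS (open_nbhs_nbhs (conj oU Uy)) => x; exact: gh.
have E' e y : U y -> 'D_e g y = 'D_e h y by move=> Uy; exact/near_eq_derive/near_gh.
split.
- have [cd dgE] := (diff_locallyP _ _).1 dg.
  have dhE : h \o shift z = cst (h z) + 'd g z +o_ 0 id.
    apply/eqaddoP => e e0; move/eqaddoP : dgE => /(_ e e0).
    apply: filterS2 ((nbhs0P _ _).1 (near_gh z Uz)) => x; rewrite addrC => gx.
    by rewrite -[h \o _]/(fun y => h (y + z)) -[g \o _]/(fun y => g (y + z)) -(gh z Uz) !fctE/= gx.
  by apply/diff_locallyP; rewrite (diff_unique cd dhE).
- move=> e; have : 'D_e g x @[x --> z] --> 'D_e g z := cg e.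
  rewrite (E' e z Uz) => cge.
  apply: cvg_trans cge; apply: near_eq_cvg.
  by apply: filterS (open_nbhs_nbhs (conj oU Uz)) => x Ux; exact: E'.
Qed.

Lemma C1onS U V g : U `<=` V -> C1on V g -> C1on U g.
Proof. by move=> UV Cg z /UV /Cg. Qed.

Lemma C1onU U V g : C1on U g -> C1on V g -> C1on (U `|` V) g.
Proof. by move=> CU CV z [/CU|/CV]. Qed.

Lemma C1on_derive U g (g' : E -> E -> R) : open U ->
  (forall z, U z -> differentiable g z) ->
  (forall z e, U z -> 'D_e g z = g' e z) ->
  (forall z e, U z -> {for z, continuous (g' e)}) -> C1on U g.
Proof.
move=> oU dg gg' cg' z Uz; split; first exact: dg.
move=> e; have : g' e x @[x --> z] --> g' e z := cg' z e Uz.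
rewrite -(gg' z e Uz) => cge.
apply: cvg_trans cge; apply: near_eq_cvg.
by apply: filterS (open_nbhs_nbhs (conj oU Uz)) => x Ux; rewrite gg'.
Qed.

Lemma C1onD U g h : open U -> C1on U g -> C1on U h -> C1on U (fun z => g z + h z).
Proof.
move=> oU Cg Ch; apply: (@C1on_derive _ _ (fun e z => 'D_e g z + 'D_e h z)) => //.
- by move=> z Uz; apply: differentiableD; [have [] := Cg _ Uz|have [] := Ch _ Uz].
- move=> z e Uz; have [dg _] := Cg _ Uz; have [dh _] := Ch _ Uz.
  by rewrite -deriveD//; exact: diff_derivable.
- by move=> z e Uz; have [_ cg] := Cg _ Uz; have [_ ch] := Ch _ Uz; apply: cvgD; [exact: cg|exact: ch].
Qed.

Lemma C1onM U g h : open U -> C1on U g -> C1on U h -> C1on U (fun z => g z * h z).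
Proof.
move=> oU Cg Ch; apply: (@C1on_derive _ _ (fun e z => g z * 'D_e h z + h z * 'D_e g z)) => //.
- by move=> z Uz; apply: differentiableM; [have [] := Cg _ Uz|have [] := Ch _ Uz].
- move=> z e Uz; have [dg _] := Cg _ Uz; have [dh _] := Ch _ Uz.
  by rewrite -[LHS]/('D_e (g * h) z) deriveM//; exact: diff_derivable.
- move=> z e Uz; have [dg cg] := Cg _ Uz; have [dh ch] := Ch _ Uz.
  by apply: cvgD; apply: cvgM; (try exact: differentiable_continuous); [exact: ch|exact: cg].
Qed.

Lemma C1on_comp U (V : set R) g (f f' : R -> R) : open U ->
  (forall z, U z -> V (g z)) ->
  (forall s, V s -> is_derive s 1 f (f' s)) ->
  (forall s, V s -> {for s, continuous f'}) ->
  C1on U g -> C1on U (fun z => f (g z)).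
Proof.
move=> oU UV df cf' Cg.
apply: (@C1on_derive _ _ (fun e z => f' (g z) * 'D_e g z)) => //.
- move=> z Uz; apply: differentiable_comp; first by have [] := Cg _ Uz.
  by apply/derivable1_diffP; have [] := df _ (UV _ Uz).
- move=> z e Uz; have [dg _] := Cg _ Uz.
  have dfg := df _ (UV _ Uz).
  have dif : differentiable f (g z) by apply/derivable1_diffP; case: dfg.
  rewrite deriveE; last exact: differentiable_comp.
  rewrite (diff_comp dg dif)/= (deriveE e dg) diff1E//= derive1E.
  by case: dfg => _ ->; rewrite /GRing.scale/= mulrC.
- move=> z e Uz; have [dg cg] := Cg _ Uz.
  apply: cvgM; last exact: cg.
  apply: (@continuous_comp _ _ _ g f'); first exact: differentiable_continuous.
  exact/cf'/UV.
Qed.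

Lemma derive_comp1 (f : R -> R) g (z e : E) (a : R) : differentiable g z ->
  is_derive (g z) 1 f a -> 'D_e (f \o g) z = a * 'D_e g z.
Proof.
move=> dg dfg; have dif : differentiable f (g z) by apply/derivable1_diffP; case: dfg.
rewrite deriveE; last exact: differentiable_comp.
rewrite (diff_comp dg dif)/= (deriveE e dg) diff1E//= derive1E.
by case: dfg => _ ->; rewrite /GRing.scale/= mulrC.
Qed.

End normed.
End C1on.

(** * The initial datum *)

Section smooth_class.
Context {R : realType}.

(** [smooth] quantifies over all iterated directional derivatives, so an induction needs a class
    closed under differentiation. Polynomials in continuous linear forms, together with composition
    by [flat_bump], form one that contains the datum. *)
Inductive bump_algebra (E : normedModType R) : (E -> R) -> Prop :=
| bump_algebra_cst c : bump_algebra (fun=> c)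
| bump_algebra_lin (g : E -> R) : (forall a u v, g (a *: u + v) = a * g u + g v) ->
    continuous g -> bump_algebra g
| bump_algebraD (g h : E -> R) : bump_algebra g -> bump_algebra h ->
    bump_algebra (fun z => g z + h z)
| bump_algebraM (g h : E -> R) : bump_algebra g -> bump_algebra h ->
    bump_algebra (fun z => g z * h z)
| bump_algebra_bump k (g : E -> R) : bump_algebra g -> bump_algebra (fun z => flat_bump k (g z)).

Context (E : normedModType R).
Implicit Types g h : E -> R.

Lemma differentiable_lin g : (forall a u v, g (a *: u + v) = a * g u + g v) ->
  continuous g -> forall z, differentiable g z /\ forall e, 'D_e g z = g e.
Proof.
move=> lg cg z.
pose gl := GRing.isLinear.Build _ _ _ _ _ lg.
pose gL : {linear E -> R} := HB.pack g gl.
have dg : differentiable gL z by exact: linear_differentiable.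
by split=> // e; rewrite (deriveE e dg) (diff_lin z (f := gL)).
Qed.

Lemma bump_algebra_derive g : bump_algebra g ->
  (forall z, differentiable g z) /\ forall e, bump_algebra ('D_e g).
Proof.
elim=> [c|{}g lg cg|{}g h _ [dg Dg] _ [dh Dh]|{}g h Ag [dg Dg] Ah [dh Dh]|k {}g Ag [dg Dg]].
- split=> [z|e]; first exact: differentiable_cst.
  rewrite (_ : 'D_e _ = fun=> 0); first exact: bump_algebra_cst.
  by apply/funext => z; rewrite derive_cst.
- have := differentiable_lin lg cg; split=> [z|e]; first by have [] := H z.
  rewrite (_ : 'D_e _ = fun=> g e); first exact: bump_algebra_cst.
  by apply/funext => z; have [] := H z.
- split=> [z|e]; first exact: differentiableD.
  rewrite (_ : 'D_e _ = fun z => 'D_e g z + 'D_e h z); first exact: bump_algebraD.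
  by apply/funext => z; rewrite -deriveD//; exact: diff_derivable.
- split=> [z|e]; first exact: differentiableM.
  rewrite (_ : 'D_e _ = fun z => g z * 'D_e h z + h z * 'D_e g z).
    by apply: bump_algebraD; apply: bump_algebraM.
  apply/funext => z; rewrite -[LHS]/('D_e (g * h) z) deriveM//; exact: diff_derivable.
- split=> [z|e].
    apply: differentiable_comp => //; apply/derivable1_diffP.
    by case: (is_derive_flat_bump k (g z)).
  rewrite (_ : 'D_e _ = fun z => (flat_bump k.+2 (g z) + (- k%:R) * flat_bump k.+1 (g z)) * 'D_e g z).
    apply: bump_algebraM => //; apply: bump_algebraD; first exact: bump_algebra_bump.
    by apply: bump_algebraM; [exact: bump_algebra_cst|exact: bump_algebra_bump].
  apply/funext => z; rewrite mulNr -[LHS]/('D_e (flat_bump k \o g) z).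
  by rewrite (derive_comp1 e (dg z) (is_derive_flat_bump k (g z))).
Qed.

Lemma bump_algebra_smooth g : bump_algebra g -> smooth g.
Proof.
move=> Ag l; have {Ag} : bump_algebra (iter_derive l g).
  by elim: l => //= e l Al; have [_] := bump_algebra_derive Al.
move=> /bump_algebra_derive[dg _]; split=> [z|e z].
- exact: differentiable_continuous.
- exact: diff_derivable.
Qed.

Lemma bump_algebra_C1on g : bump_algebra g -> C1on setT g.
Proof.
move=> /bump_algebra_derive[dg Dg] z _; split=> // e.
have [de _] := bump_algebra_derive (Dg e).
exact: differentiable_continuous.
Qed.

Lemma bump_algebraN g : bump_algebra g -> bump_algebra (fun z => - g z).
Proof.
move=> Ag; rewrite (_ : (fun _ => _) = fun z => (-1) * g z).
  by apply: bump_algebraM => //; exact: bump_algebra_cst.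
by apply/funext => z; rewrite mulN1r.
Qed.

End smooth_class.

(** * Euclidean geometry of R^3 *)

Section geometry.
Context {R : realType}.
Implicit Types u v x : R3 R.

Lemma dotE u v : dot u v = u.1.1 * v.1.1 + u.1.2 * v.1.2 + u.2 * v.2.
Proof. by []. Qed.

Lemma dotC u v : dot u v = dot v u.
Proof. by rewrite !dotE; ring. Qed.

Lemma dot_linr u v x (a : R) : dot x (u + a *: v) = dot x u + a * dot x v.
Proof. by rewrite R3_linE !dotE/=; ring. Qed.

Lemma dot_linl u v x (a : R) : dot (u + a *: v) x = dot u x + a * dot v x.
Proof. by rewrite dotC dot_linr ![dot x _]dotC. Qed.

Lemma dot_ge0 u : 0 <= dot u u.
Proof. by rewrite dotE -!expr2 !addr_ge0 ?sqr_ge0. Qed.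

Lemma dot_eq0 u : (dot u u == 0) = (u == 0).
Proof.
case: u => [[a b] c]; rewrite dotE/= -!expr2 !paddr_eq0 ?addr_ge0 ?sqr_ge0//.
by rewrite !sqrf_eq0.
Qed.

Lemma dot_gt0 u : (0 < dot u u) = (u != 0).
Proof. by rewrite lt_neqAle dot_ge0 andbT eq_sym dot_eq0. Qed.

Lemma sqr_enorm u : enorm u ^+ 2 = dot u u.
Proof. by rewrite sqr_sqrtr// dot_ge0. Qed.

Lemma enorm_ge0 u : 0 <= enorm u.
Proof. exact: sqrtr_ge0. Qed.

Lemma unit_ballE x : unit_ball x <-> dot x x < 1.
Proof.
by rewrite -sqr_enorm expr_lt1 ?enorm_ge0.
Qed.

Lemma closed_unit_ballE x : closed_unit_ball x <-> dot x x <= 1.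
Proof.
by rewrite -sqr_enorm expr_le1 ?enorm_ge0.
Qed.

Lemma unit_sphereE x : unit_sphere x <-> dot x x = 1.
Proof.
rewrite /unit_sphere/= -sqr_enorm; split=> [->|/eqP]; first by rewrite expr1n.
rewrite sqrf_eq1 => /orP[/eqP//|/eqP x1].
by have := enorm_ge0 x; rewrite x1 oppr_ge0 ler10.
Qed.

Lemma normal_sphere x : dot x x = 1 -> normal x = x.
Proof. by move=> /unit_sphereE; rewrite /normal => ->; rewrite invr1 scale1r. Qed.

(** Lagrange's identity: the defect is the squared length of the cross product. *)
Lemma CauchySchwarz_dot u v : dot u v ^+ 2 <= dot u u * dot v v.
Proof.
rewrite !dotE -subr_ge0.
have -> : (u.1.1 * u.1.1 + u.1.2 * u.1.2 + u.2 * u.2) *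
   (v.1.1 * v.1.1 + v.1.2 * v.1.2 + v.2 * v.2) -
   (u.1.1 * v.1.1 + u.1.2 * v.1.2 + u.2 * v.2) ^+ 2 =
   (u.1.1 * v.1.2 - u.1.2 * v.1.1) ^+ 2 + (u.1.1 * v.2 - u.2 * v.1.1) ^+ 2 +
   (u.1.2 * v.2 - u.2 * v.1.2) ^+ 2 by ring.
by rewrite !addr_ge0 ?sqr_ge0.
Qed.

Lemma continuous_fst_comp (T A B : topologicalType) (p : T -> A * B) :
  continuous p -> continuous (fun z => (p z).1).
Proof. by move=> cp z; apply: (cvg_comp _ _ (cp z)); exact: cvg_fst. Qed.

Lemma continuous_snd_comp (T A B : topologicalType) (p : T -> A * B) :
  continuous p -> continuous (fun z => (p z).2).
Proof. by move=> cp z; apply: (cvg_comp _ _ (cp z)); exact: cvg_snd. Qed.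

Lemma continuous_dot (T : topologicalType) (p q : T -> R3 R) :
  continuous p -> continuous q -> continuous (fun z => dot (p z) (q z)).
Proof.
move=> cp cq z; rewrite /dot.
have c11 (r : T -> R3 R) : continuous r -> continuous (fun z => (r z).1.1).
  by move=> cr; do 2 apply: continuous_fst_comp.
have c12 (r : T -> R3 R) : continuous r -> continuous (fun z => (r z).1.2).
  by move=> cr; apply: continuous_snd_comp; apply: continuous_fst_comp.
have c2 (r : T -> R3 R) : continuous r -> continuous (fun z => (r z).2).
  by move=> cr; apply: continuous_snd_comp.
apply: cvgD; [apply: cvgD|]; apply: cvgM.
- exact: c11.
- exact: c11.
- exact: c12.
- exact: c12.
- exact: c2.
- exact: c2.
Qed.

End geometry.

Section datum.
Context {R : realType}.

(** Being below 1, it keeps the support inside the product of the unit balls. Being above 1/2, it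
    lets particles reach the sphere at time 1: the maximum over u of 1 - |n - u|^2 - |u|^2 at a unit
    vector n is 1/2, so the argument of the bump there has maximum [radius2] - 1/2. *)
Definition radius2 : R := 81 / 100.

(** Only |x|^2 + |v|^2 enters, so rotating position and velocity together changes nothing. *)
Definition datum (z : R3 R * R3 R) : R :=
  flat_bump 0 (radius2 - dot z.1 z.1 - dot z.2 z.2).

Lemma datum_ge0 z : 0 <= datum z.
Proof. exact: flat_bump_ge0. Qed.

Lemma datum_le1 z : datum z <= 1.
Proof. by rewrite (le_trans (flat_bump_le _ _))// expr0. Qed.

Lemma datum_eq0 z : radius2 <= dot z.1 z.1 + dot z.2 z.2 -> datum z = 0.
Proof. by move=> h; rewrite /datum flat_bump0//; lra. Qed.

Lemma bump_algebra_dot (E : normedModType R) (p q : E -> R3 R) :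
  (forall a u v, p (a *: u + v) = a *: p u + p v) -> continuous p ->
  (forall a u v, q (a *: u + v) = a *: q u + q v) -> continuous q ->
  bump_algebra (fun z => dot (p z) (q z)).
Proof.
have H (r : E -> R3 R) : (forall a u v, r (a *: u + v) = a *: r u + r v) ->
    continuous r -> [/\ bump_algebra (fun z => (r z).1.1),
      bump_algebra (fun z => (r z).1.2) & bump_algebra (fun z => (r z).2)].
  move=> lr cr; split; apply: bump_algebra_lin.
  - by move=> a u v; rewrite lr.
  - by apply: continuous_fst_comp; apply: continuous_fst_comp.
  - by move=> a u v; rewrite lr.
  - by apply: continuous_snd_comp; apply: continuous_fst_comp.
  - by move=> a u v; rewrite lr.
  - exact: continuous_snd_comp.
move=> lp cp lq cq; have [p1 p2 p3] := H p lp cp; have [q1 q2 q3] := H q lq cq.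
by apply: bump_algebraD; [apply: bump_algebraD|]; apply: bump_algebraM.
Qed.

Lemma bump_algebra_datum : bump_algebra datum.
Proof.
apply: bump_algebra_bump; apply: bump_algebraD; first apply: bump_algebraD.
- exact: bump_algebra_cst.
- apply: bump_algebraN; apply: bump_algebra_dot; by [move=> z; exact: cvg_fst|].
- apply: bump_algebraN; apply: bump_algebra_dot; by [move=> z; exact: cvg_snd|].
Qed.

Lemma closure_datum_support :
  closure [set z | datum z != 0] `<=`
    [set z | dot z.1 z.1 + dot z.2 z.2 <= radius2].
Proof.
have cl : closed [set z : R3 R * R3 R | dot z.1 z.1 + dot z.2 z.2 <= radius2].
  apply: (@preimage_closed _ _ (fun z : R3 R * R3 R => dot z.1 z.1 + dot z.2 z.2) [set r | r <= radius2]).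
    move=> z _; apply: cvgD.
      by apply: continuous_dot => y; exact: cvg_fst.
    by apply: continuous_dot => y; exact: cvg_snd.
  exact: closed_le.
have sub : [set z | datum z != 0] `<=` [set z : R3 R * R3 R | dot z.1 z.1 + dot z.2 z.2 <= radius2].
  by move=> z /=; apply: contraR; rewrite -ltNge => /ltW/datum_eq0->.
by move=> z /(closureS sub); rewrite -((closure_id _).1 cl).
Qed.

Lemma test_datum_datum : test_datum datum.
Proof.
split; first exact/bump_algebra_smooth/bump_algebra_datum.
- have cI : compact (`[-1, 1]%classic : set R) by exact: segment_compact.
  have cB : compact ((`[-1, 1] `*` `[-1, 1] `*` `[-1, 1]) `*`
      (`[-1, 1] `*` `[-1, 1] `*` `[-1, 1]) : set (R3 R * R3 R)).
    by do !apply: compact_setX.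
  apply: (subclosed_compact (@closed_closure _ _) cB).
  move=> z /closure_datum_support/=; rewrite !dotE -!expr2 /radius2 => h.
  have itv (x : R) : x ^+ 2 <= 81 / 100 -> x \in `[-1, 1].
    by move=> xy; rewrite in_itv/=; apply/andP; split; nra.
  have [[s1 s2] s3] := (sqr_ge0 z.1.1.1, sqr_ge0 z.1.1.2, sqr_ge0 z.1.2).
  have [[s4 s5] s6] := (sqr_ge0 z.2.1.1, sqr_ge0 z.2.1.2, sqr_ge0 z.2.2).
  by split; [split; [split|]|split; [split|]]; apply: itv; lra.
- move=> z /closure_datum_support/= h; split; apply/unit_ballE;
  have := dot_ge0 z.1; have := dot_ge0 z.2; move: h; rewrite /radius2; lra.
Qed.

End datum.

(** * The outgoing Maxwellian flux *)

Section flux_density.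
Context {R : realType}.
(* Convertible to [R3 R], but its inferred measurable structure is syntactically that of [leb3]. *)
Local Notation V3 := (measurableTypeR R * measurableTypeR R * measurableTypeR R)%type.
Implicit Types (u : R3 R) (G : V3 -> R).


(** The outgoing velocities at [north_pole], where n . u is the third coordinate. Fluxes at other
    boundary points are brought here by a rotation. *)
Definition half_space : set V3 := [set u | 0 < u.2].

Definition flux_density u : R := maxwellian u * u.2.

Lemma open_half_space : open (half_space : set (R3 R)).
Proof.
apply: (@open_comp _ _ (fun u : R3 R => u.2) [set r | 0 < r]); last exact: open_gt.
by move=> u _; exact: cvg_snd.
Qed.

Lemma measurable_half_space : measurable half_space.
Proof. by apply: measurable_open_R3; exact: open_half_space. Qed.

Lemma maxwellianE u : maxwellian u = expR (- dot u u / 2).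
Proof. by rewrite /maxwellian sqr_enorm. Qed.

Lemma maxwellian_gt0 u : 0 < maxwellian u.
Proof. exact: expR_gt0. Qed.

Lemma sqrt_maxwellian u : Num.sqrt (maxwellian u) = expR (- dot u u / 4).
Proof.
have -> : maxwellian u = expR (- dot u u / 4) ^+ 2.
  by rewrite maxwellianE -expRM_natl; congr expR; field.
by rewrite sqrtr_sqr ger0_norm ?expR_ge0.
Qed.

Lemma continuous_dot_self : continuous (fun u => dot u u).
Proof. by apply: continuous_dot => u; exact: cvg_id. Qed.

Lemma continuous_maxwellian : continuous (@maxwellian R).
Proof.
have -> : @maxwellian R = fun u => expR (- dot u u / 2) by apply/funext => u; rewrite maxwellianE.
move=> u; apply: (@continuous_comp _ _ _ (fun u => - dot u u / 2) expR); last exact: continuous_expR.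
by apply: cvgM; [apply: cvgN; exact: continuous_dot_self|exact: cvg_cst].
Qed.

Lemma continuous_flux_density : continuous flux_density.
Proof. by move=> u; apply: cvgM; [exact: continuous_maxwellian|exact: cvg_snd]. Qed.

Lemma flux_density_gt0 u : half_space u -> 0 < flux_density u.
Proof. by move=> u0; rewrite mulr_gt0 ?maxwellian_gt0. Qed.

Lemma measurable_flux_density : measurable_fun half_space flux_density.
Proof. exact: continuous_measurable_R3T continuous_flux_density measurable_half_space. Qed.

Context (cmu : R)
  (cmuE : cmu * (\int[leb3]_(u in half_space) flux_density u)%R = 1).

Let I := (\int[leb3]_(u in half_space) (flux_density u)%:E)%E.

(** The normalization itself forces convergence: a real integral is [fine] of the extended one and
    [fine] sends infinities to 0, while cmu * 0 is not 1. The Gaussian integral is never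
    evaluated. *)
Let I_fin : I \is a fin_num.
Proof.
have : fine I != 0.
  by apply/eqP => I0; move: cmuE; rewrite /Rintegral -/I I0 mulr0 => /esym/eqP; rewrite oner_eq0.
by case: I => //=; rewrite eqxx.
Qed.

Lemma cmu_gt0 : 0 < cmu.
Proof.
have : 0 <= fine I.
  by rewrite fine_ge0// integral_ge0// => u /flux_density_gt0/ltW; rewrite lee_fin.
rewrite ltNge => I0; apply/negP => c0; move: cmuE; rewrite /Rintegral -/I => h.
by have := mulr_le0_ge0 c0 I0; rewrite h ler10.
Qed.

Lemma integrable_flux_density : leb3.-integrable half_space (EFin \o flux_density).
Proof.
apply/integrableP; split; first by apply/measurable_EFinP; exact: measurable_flux_density.
rewrite (_ : (\int[leb3]_(u in half_space) _)%E = I); first by rewrite ltey_eq I_fin.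
by apply: eq_integral => u /set_mem/flux_density_gt0 u0 /=; rewrite ger0_norm// ltW.
Qed.

Lemma integrable_flux G (M : R) : measurable_fun half_space G ->
  (forall u, half_space u -> `|G u| <= M) ->
  leb3.-integrable half_space (EFin \o (fun u => flux_density u * G u)).
Proof.
move=> mG GM.
have iM : leb3.-integrable half_space (EFin \o (fun u => M * flux_density u)).
  by have := integrableZl measurable_half_space M integrable_flux_density.
apply: (le_integrable measurable_half_space _ _ iM).
  apply/measurable_EFinP; exact: (measurable_funM measurable_flux_density mG).
move=> u Hu; rewrite lee_fin !normrM mulrC.
rewrite ler_wpM2r// (le_trans (GM u Hu))//; exact: ler_norm.
Qed.

(** An average for a probability density on the outgoing velocities; it is applied to f divided by
    the square root of the Maxwellian. *)
Definition flux G : R := cmu * \int[leb3]_(u in half_space) (flux_density u * G u).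

Lemma flux_cst1 : flux (fun=> 1) = 1.
Proof. by rewrite -[RHS]cmuE; congr (_ * _); apply: eq_Rintegral => u _; rewrite mulr1. Qed.

Lemma eq_flux G G' : (forall u, half_space u -> G u = G' u) -> flux G = flux G'.
Proof.
by move=> GG'; congr (_ * _); apply: eq_Rintegral => u /set_mem/GG' ->.
Qed.

Section bounded.
Variables (G G' : V3 -> R) (M M' : R).
Hypotheses (mG : measurable_fun half_space G) (mG' : measurable_fun half_space G').
Hypotheses (GM : forall u, half_space u -> `|G u| <= M).
Hypotheses (GM' : forall u, half_space u -> `|G' u| <= M').

Lemma fluxD : flux (fun u => G u + G' u) = flux G + flux G'.
Proof.
rewrite /flux -mulrDr; congr (_ * _).
rewrite -RintegralD; [|exact: measurable_half_space|exact: integrable_flux GM|exact: integrable_flux GM'].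
by apply: eq_Rintegral => u _; rewrite mulrDr.
Qed.

Lemma fluxB : flux (fun u => G u - G' u) = flux G - flux G'.
Proof.
rewrite /flux -mulrBr; congr (_ * _).
rewrite -RintegralB; [|exact: measurable_half_space|exact: integrable_flux GM|exact: integrable_flux GM'].
by apply: eq_Rintegral => u _; rewrite mulrBr.
Qed.

Lemma le_flux : (forall u, half_space u -> G u <= G' u) -> flux G <= flux G'.
Proof.
move=> GG'; rewrite ler_pM2l ?cmu_gt0//.
apply: le_Rintegral; [exact: measurable_half_space|exact: integrable_flux GM|exact: integrable_flux GM'|].
by move=> u Hu; rewrite ler_wpM2l ?GG'// ltW// flux_density_gt0.
Qed.

End bounded.

Lemma fluxZ G (M a : R) : measurable_fun half_space G ->
  (forall u, half_space u -> `|G u| <= M) -> flux (fun u => a * G u) = a * flux G.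
Proof.
move=> mG GM; rewrite /flux mulrCA; congr (_ * _).
rewrite -RintegralZl; [|exact: measurable_half_space|exact: integrable_flux GM].
by apply: eq_Rintegral => u _; rewrite mulrCA.
Qed.

Lemma norm_flux_le G G' (M' : R) : measurable_fun half_space G ->
  measurable_fun half_space G' ->
  (forall u, half_space u -> `|G u| <= G' u) ->
  (forall u, half_space u -> G' u <= M') -> `|flux G| <= flux G'.
Proof.
move=> mG mG' GG' GM'.
have bG u : half_space u -> `|G u| <= M' by move=> Hu; rewrite (le_trans (GG' u Hu))// GM'.
have bG' u : half_space u -> `|G' u| <= M'.
  by move=> Hu; rewrite ger0_norm ?GM'// (le_trans _ (GG' u Hu)).
rewrite ler_norml; apply/andP; split; last first.
  by apply: (le_flux mG mG' bG bG') => u Hu; rewrite (le_trans _ (GG' u Hu))// ler_norm.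
rewrite -mulN1r -(fluxZ (-1) mG' bG').
apply: (le_flux (M := M') _ mG _ bG).
- by apply: measurable_funM => //; exact: measurable_cst.
- by move=> u Hu; rewrite normrM normrN1 mul1r bG'.
- by move=> u Hu; rewrite mulN1r lerNl (le_trans _ (GG' u Hu))// ler_normr lexx orbT.
Qed.

Lemma leb3_box (a1 b1 a2 b2 a3 b3 : R) : a1 < b1 -> a2 < b2 -> a3 < b3 ->
  leb3 (`[a1, b1] `*` `[a2, b2] `*` `[a3, b3]) = ((b1 - a1) * (b2 - a2) * (b3 - a3))%:E.
Proof.
move=> h1 h2 h3.
rewrite /leb3 product_measure1E; [|exact: measurableX|exact: measurable_itv].
rewrite /= /leb2 product_measure1E; [|exact: measurable_itv|exact: measurable_itv].
by rewrite /= !lebesgue_measure_itv/= !lte_fin h1 h2 h3 -!EFinD -!EFinM.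
Qed.

Lemma flux_gt0 G (M m a1 b1 a2 b2 a3 b3 : R) : measurable_fun half_space G ->
  (forall u, half_space u -> 0 <= G u <= M) ->
  a1 < b1 -> a2 < b2 -> 0 < a3 -> a3 < b3 -> 0 < m ->
  (forall u, a1 <= u.1.1 <= b1 -> a2 <= u.1.2 <= b2 -> a3 <= u.2 <= b3 ->
    m <= G u) ->
  0 < flux G.
Proof.
move=> mG GM h1 h2 a30 h3 m0 Gm.
pose Q : set V3 := `[a1, b1] `*` `[a2, b2] `*` `[a3, b3].
(* An upper bound for |u|^2 on the box. A coordinate of unknown sign is controlled by both its
   endpoints, the third one is positive and needs only [b3]. *)
pose K := a1 ^+ 2 + b1 ^+ 2 + a2 ^+ 2 + b2 ^+ 2 + b3 ^+ 2.
pose m' := expR (- K / 2) * a3 * m.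
have m'0 : 0 < m' by rewrite !mulr_gt0 ?expR_gt0.
have Gm' u : Q u -> half_space u /\ m' <= flux_density u * G u.
  case: u => [[x y] z]; rewrite /Q/= !in_itv/= => -[[hx hy] hz].
  have z0 : 0 < z by case/andP: hz => hz _; rewrite (lt_le_trans a30).
  split=> //; rewrite ler_pM ?mulr_ge0 ?expR_ge0 ?(ltW a30) ?(ltW m0)//.
    rewrite ler_pM ?expR_ge0 ?(ltW a30)//; last by case/andP: hz.
    rewrite maxwellianE ler_expR dotE/= /K.
    have sq (a b r : R) : a <= r <= b -> r * r <= a ^+ 2 + b ^+ 2.
      by move=> /andP[? ?]; have [?|?] := leP 0 r; nra.
    have := sq _ _ _ hx; have := sq _ _ _ hy; case/andP: hz => ? ?.
    have : z * z <= b3 ^+ 2 by nra.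
    lra.
  exact: Gm.
have iG : leb3.-integrable half_space (EFin \o (fun u => flux_density u * G u)).
  apply: (integrable_flux (M := M) mG) => u Hu.
  by have /andP[? ?] := GM u Hu; rewrite ger0_norm.
rewrite mulr_gt0 ?cmu_gt0// fine_gt0// andbC.
have mQ : measurable Q by apply: measurableX; [apply: measurableX|]; exact: measurable_itv.
have /= := integrable_lty measurable_half_space iG; rewrite /comp => ->/=.
apply: (@lt_le_trans _ _ (m' * ((b1 - a1) * (b2 - a2) * (b3 - a3)))%:E).
  by rewrite lte_fin (mulr_gt0 m'0)// !mulr_gt0 ?subr_gt0.
rewrite EFinM -(leb3_box h1 h2 h3) -/Q -integral_cst//.
apply: ge0_subset_le_integral.
- by move=> u _; rewrite lee_fin ltW.
- move=> u Hu; rewrite lee_fin mulr_ge0 ?(ltW (flux_density_gt0 _))//.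
  by have /andP[] := GM u Hu.
- by move=> u /Gm'[].
Qed.

(* Time needed to cross the ball when arriving at [north_pole] with velocity [u] *)
Definition chord_time u : R := 2 * u.2 / dot u u.

Lemma half_space_dot u : half_space u -> 0 < dot u u.
Proof.
rewrite dot_gt0; apply: contraPneq => ->; by rewrite /half_space/= ltxx.
Qed.

Lemma chord_time_gt0 u : half_space u -> 0 < chord_time u.
Proof. by move=> Hu; rewrite /chord_time divr_gt0 ?half_space_dot// mulr_gt0. Qed.

Lemma continuous_chord_time u : half_space u -> {for u, continuous chord_time}.
Proof.
move=> Hu; apply: cvgM.
  by apply: cvgM; [exact: cvg_cst|exact: cvg_snd].
by apply: cvgV; [rewrite gt_eqF// half_space_dot|exact: continuous_dot_self].
Qed.

(* Slow particles do not cross the ball before time [T], and they carry a positive fraction of the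
   flux. *)
Lemma flux_contraction (T : R) : exists k : R, 0 <= k < 1 /\
  forall G (M : R), measurable_fun half_space G ->
    (forall u, half_space u -> `|G u| <= M) ->
    (forall u, half_space u -> T < chord_time u -> G u = 0) ->
    `|flux G| <= k * M.
Proof.
(* On the box [Q] below, |u|^2 <= 6 d^2 and u.2 >= d, so the chord time is at least 1 / (3 d) = |T|
   + 1. *)
pose d := (3 * (`|T| + 1))^-1.
have T1 : 0 < `|T| + 1 by rewrite ltr_wpDl.
have d0 : 0 < d by rewrite invr_gt0 mulr_gt0.
pose Q : set V3 := `[0, d] `*` `[0, d] `*` `[d, 2 * d].
have mQ : measurable Q by apply: measurableX; [apply: measurableX|]; exact: measurable_itv.
have QT u : half_space u -> Q u -> T < chord_time u.
  case: u => [[x y] z] Hu; rewrite /Q/= !in_itv/= => -[[/andP[? ?] /andP[? ?]] /andP[? ?]].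
  rewrite /chord_time ltr_pdivlMr ?half_space_dot// dotE/=.
  have dT : 3 * ((`|T| + 1) * d) = 1 by rewrite mulrA mulfV// mulf_neq0// gt_eqF.
  have hd : x * x + y * y + z * z <= 6 * (d * d) by nra.
  have hT : T <= `|T| by exact: ler_norm.
  have : `|T| * (x * x + y * y + z * z) <= `|T| * (6 * (d * d)) by rewrite ler_wpM2l.
  have : T * (x * x + y * y + z * z) <= `|T| * (x * x + y * y + z * z).
    by rewrite ler_wpM2r// -!expr2 !addr_ge0 ?sqr_ge0.
  have : `|T| * (6 * (d * d)) = 2 * d - 6 * (d * d).
    by transitivity (2 * d * (3 * ((`|T| + 1) * d)) - 6 * (d * d)); [ring|rewrite dT; ring].
  nra.
pose G0 u : R := 1 - \1_Q u.
have m1 : measurable_fun half_space (\1_Q : V3 -> R) by exact: measurable_indic.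
have b1 u : half_space u -> `|(\1_Q u : R)| <= 1.
  by move=> _; rewrite indicE; case: (_ \in _); rewrite ?normr1 ?normr0.
have mG0 : measurable_fun half_space G0 by apply: measurable_funB => //; exact: measurable_cst.
have G01 u : 0 <= G0 u <= 1.
  by rewrite /G0 indicE; case: (_ \in _); rewrite ?subrr ?subr0 ?lexx ?ler01.
have bG0 u : half_space u -> `|G0 u| <= 1.
  by move=> _; have /andP[? ?] := G01 u; rewrite ger0_norm.
(* The constant is the share of the flux outside [Q]. It is below 1 because the flux of the
   indicator of [Q] is positive. *)
exists (flux G0); split.
  rewrite (@fluxB (fun=> 1) \1_Q 1 1)//; last by move=> u _; rewrite normr1.
  rewrite flux_cst1 subr_ge0 -{1}flux_cst1; apply/andP; split.
    by apply: (@le_flux _ _ 1 1) => // u _; rewrite normr1.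
  rewrite ltrBlDr ltrDl; apply: (@flux_gt0 _ 1 1 0 d 0 d d (2 * d)) => //.
  - by move=> u _; rewrite indicE; case: (_ \in _); rewrite ?lexx ?ler01.
  - by rewrite ltr_pMl// ltr1n.
  - by move=> u h1 h2 h3; rewrite indicE mem_set.
move=> G M mG GM G0T; rewrite mulrC -(fluxZ M mG0 bG0).
have M0 : 0 <= M by have := GM north_pole ltr01; exact: le_trans.
apply: (@norm_flux_le _ _ M) => //.
- by apply: measurable_funM => //; exact: measurable_cst.
- move=> u Hu; rewrite /G0 indicE; have [/set_mem Qu|_] := boolP (u \in Q).
    by rewrite subrr mulr0 G0T ?normr0// QT.
  by rewrite subr0 mulr1 GM.
- by move=> u Hu; have /andP[? ?] := G01 u; rewrite ler_piMr.
Qed.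

End flux_density.

(** * The renewal equation for the boundary flux *)

Section renewal.
Context {R : realType} (cmu : R).
Local Notation V3 := (measurableTypeR R * measurableTypeR R * measurableTypeR R)%type.
Hypothesis cmuE : cmu * (\int[leb3]_(u in half_space) flux_density u)%R = 1.
Local Notation flux := (flux cmu).
Implicit Types phi psi : R -> R.

Lemma continuous_flux (F : R -> V3 -> R) (t M : R) :
  (forall s, measurable_fun half_space (F s)) ->
  (forall s u, t - 1 < s < t + 1 -> half_space u -> `|F s u| <= M) ->
  (forall u, half_space u -> continuous (F ^~ u)) ->
  {for t, continuous (fun s => flux (F s))}.
Proof.
move=> mF FM cF; apply: cvgM; first exact: cvg_cst.
have tI : t \in (`]t - 1, t + 1[%classic : set R).
  by rewrite inE/= in_itv/= ltrBlDr ltrDl ltr01.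
have iM : leb3.-integrable half_space (EFin \o (fun u : V3 => M * flux_density u)).
  by have := integrableZl measurable_half_space M (integrable_flux_density cmuE).
apply: (continuity_under_integral measurable_half_space _ _ iM _ tI).
- move=> s; rewrite /= in_itv/= => sI.
  by apply: (integrable_flux cmuE (M := M) (mF s)) => u Hu; exact: FM.
- by apply: aeW => u Hu s _; apply: cvgM; [exact: cvg_cst|exact: cF].
- move=> s; rewrite /= in_itv/= => sI; apply: aeW => u Hu.
  rewrite normrM ger0_norm ?(ltW (flux_density_gt0 Hu))// mulrC.
  by rewrite ler_wpM2r ?FM// ltW// flux_density_gt0.
Qed.

Lemma is_derive_flux (F F' : R -> V3 -> R) (t M M' : R) :
  (forall s, measurable_fun half_space (F s)) ->
  (forall s u, t - 1 < s < t + 1 -> half_space u -> `|F s u| <= M) ->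
  (forall s u, t - 1 < s < t + 1 -> half_space u -> `|F' s u| <= M') ->
  (forall (s : R) (u : V3), half_space u -> is_derive s (1 : R) (F ^~ u) (F' s u)) ->
  is_derive t (1 : R) (fun s => flux (F s)) (flux (F' t)).
Proof.
move=> mF FM FM' dF.
have tI : (`]t - 1, t + 1[%classic : set R) t.
  by rewrite /= in_itv/= ltrBlDr ltrDl ltr01.
have iM : leb3.-integrable half_space (EFin \o (fun u : V3 => M' * flux_density u)).
  by have := integrableZl measurable_half_space M' (integrable_flux_density cmuE).
pose f s (u : V3) := flux_density u * F s u.
have df (s : R) (u : V3) : half_space u -> is_derive s (1 : R) (f ^~ u) (flux_density u * F' s u).
  by move=> Hu; have dFs := dF s u Hu; exact: is_deriveZ.
have d1f (s : R) (u : V3) : half_space u -> partial1of2 f s u = flux_density u * F' s u.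
  by move=> Hu; rewrite partial1of2E; have [] := df s u Hu.
have d0 u : half_space u -> 0 <= flux_density u by move=> /flux_density_gt0/ltW.
pose g (u : V3) := M' * `|flux_density u|.
have ig : leb3.-integrable half_space (EFin \o g).
  apply: eq_integrable iM => //; first exact: measurable_half_space.
  by move=> u /set_mem/d0 u0; rewrite /g /= ger0_norm.
have M'0 : 0 <= M' by apply: le_trans (FM' t north_pole tI ltr01).
have g0 u : 0 <= g u by rewrite mulr_ge0.
have int_f s : `]t - 1, t + 1[%classic s -> leb3.-integrable half_space (EFin \o f s).
  by move=> sI; apply: (integrable_flux cmuE (M := M) (mF s)) => u Hu; exact: FM.
have der_f (s : R) (u : V3) : `]t - 1, t + 1[%classic s -> half_space u ->
    derivable (f ^~ u) s 1.
  by move=> _ Hu; have [] := df s u Hu.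
have g_ub (s : R) (u : V3) : `]t - 1, t + 1[%classic s -> half_space u ->
    `|partial1of2 f s u| <= g u.
  move=> sI Hu; rewrite d1f// normrM mulrC /g ler_wpM2r//.
  exact: FM'.
have := cvg_differentiation_under_integral measurable_half_space tI int_f der_f g0 ig g_ub.
have -> : \int[leb3]_(u in half_space) partial1of2 f t u =
    \int[leb3]_(u in half_space) (flux_density u * F' t u).
  by apply: eq_Rintegral => u /set_mem Hu; exact: d1f.
move=> h; apply: is_derive_cvg.
rewrite [X in X @ _ --> _](_ : _ = fun h => cmu *
  (h^-1 *: (\int[leb3]_(u in half_space) f (h + t) u - \int[leb3]_(u in half_space) f t u))).
  by apply: cvgM => //; exact: cvg_cst.
apply/funext => r; rewrite /flux /GRing.scale/= mulr1; ring.
Qed.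

Lemma flux0 : flux (fun=> 0) = 0.
Proof.
rewrite /flux (@eq_Rintegral _ _ _ _ _ (cst 0)); last by move=> u _; rewrite mulr0.
by rewrite /Rintegral integral0 mulr0.
Qed.

(** Extension by zero to nonpositive times makes the cutoff automatic: a particle whose chord time
    exceeds t contributes nothing to [renewal] at time t. It also makes suprema over all times up to
    T finite. *)
Definition causal (psi : R -> R) := continuous psi /\ forall t, t <= 0 -> psi t = 0.

Lemma causal_bounded psi (T : R) : causal psi ->
  exists2 M : R, 0 <= M & forall s, s <= T -> `|psi s| <= M.
Proof.
move=> [cpsi psi0]; have [T0|T0] := leP T 0.
  by exists 0 => // s sT; rewrite psi0 ?normr0// (le_trans sT).
have [c _ hc] : exists2 c, c \in `[0, T] & forall t, t \in `[0, T] -> `|psi t| <= `|psi c|.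
  apply: EVT_max; first exact: ltW.
  by apply: continuous_subspaceT => s; apply: cvg_norm; exact: cpsi.
exists `|psi c| => // s sT; have [s0|s0] := leP s 0; first by rewrite psi0 ?normr0.
by apply: hc; rewrite in_itv/= ltW.
Qed.

Definition renewal psi (t : R) : R := flux (fun u => psi (t - chord_time u)).

Lemma measurable_renewal psi (t : R) : continuous psi ->
  measurable_fun half_space (fun u : V3 => psi (t - chord_time u)).
Proof.
move=> cpsi; apply: continuous_measurable_R3; first exact: open_half_space.
move=> u Hu; apply: (@continuous_comp _ _ _ (fun u => t - chord_time u) psi); last exact: cpsi.
by apply: cvgB; [exact: cvg_cst|exact: continuous_chord_time].
Qed.

Lemma causal_renewal psi : causal psi -> causal (renewal psi).
Proof.
move=> cpsi; have [cont psi0] := cpsi; split=> [t|t t0].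
  have [M _ psiM] := causal_bounded (t + 1) cpsi.
  apply: (@continuous_flux (fun s u => psi (s - chord_time u)) t M).
  - by move=> s; exact: measurable_renewal.
  - move=> s u /andP[_ st] /chord_time_gt0 u0; apply: psiM; lra.
  - move=> u Hu s; apply: (@continuous_comp _ _ _ (fun s => s - chord_time u) psi); last exact: cont.
    by apply: cvgB; [exact: cvg_id|exact: cvg_cst].
have H u : half_space u -> psi (t - chord_time u) = 0.
  by move=> /chord_time_gt0 u0; rewrite psi0//; lra.
by rewrite /renewal (eq_flux cmu H) flux0.
Qed.

Lemma is_derive_renewal phi psi (t : R) : causal phi -> causal psi ->
  (forall s : R, is_derive s (1 : R) phi (psi s)) ->
  is_derive t (1 : R) (renewal phi) (renewal psi t).
Proof.
move=> cphi cpsi dphi.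
have [M _ phiM] := causal_bounded (t + 1) cphi.
have [M' _ psiM] := causal_bounded (t + 1) cpsi.
apply: (@is_derive_flux (fun s u => phi (s - chord_time u))
  (fun s u => psi (s - chord_time u)) t M M').
- by move=> s; apply: measurable_renewal; case: cphi.
- move=> s u /andP[_ st] /chord_time_gt0 u0; apply: phiM; lra.
- move=> s u /andP[_ st] /chord_time_gt0 u0; apply: psiM; lra.
- move=> s u Hu.
  have dshift : is_derive s (1 : R) (shift (- chord_time u)) 1 by exact: is_derive_shift.
  by have := @is_derive1_comp R phi _ s _ _ (dphi (s - chord_time u)) dshift; rewrite mulr1.
Qed.

Lemma renewalB phi psi (t : R) : causal phi -> causal psi ->
  renewal phi t - renewal psi t = renewal (fun s => phi s - psi s) t.
Proof.
move=> cphi cpsi.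
have [M _ phiM] := causal_bounded t cphi.
have [M' _ psiM] := causal_bounded t cpsi.
rewrite /renewal (fluxB cmuE (M := M) (M' := M'))//.
- by apply: measurable_renewal; case: cphi.
- by apply: measurable_renewal; case: cpsi.
- move=> u /chord_time_gt0 u0; apply: phiM; lra.
- move=> u /chord_time_gt0 u0; apply: psiM; lra.
Qed.

Lemma causalB phi psi : causal phi -> causal psi -> causal (fun s => phi s - psi s).
Proof.
move=> [cphi phi0] [cpsi psi0]; split=> [t|t t0]; last by rewrite phi0// psi0// subrr.
by apply: cvgB; [exact: cphi|exact: cpsi].
Qed.

Lemma causalD phi psi : causal phi -> causal psi -> causal (fun s => phi s + psi s).
Proof.
move=> [cphi phi0] [cpsi psi0]; split=> [t|t t0]; last by rewrite phi0// psi0// addr0.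
by apply: cvgD; [exact: cphi|exact: cpsi].
Qed.

(** For s <= T the integrand vanishes by causality wherever the chord time exceeds T, which is the
    situation of [flux_contraction]. *)
Lemma renewal_contraction (T : R) : exists k : R, 0 <= k < 1 /\
  forall psi M, causal psi -> (forall s, s <= T -> `|psi s| <= M) ->
    forall s, s <= T -> `|renewal psi s| <= k * M.
Proof.
have [k [k01 hk]] := flux_contraction cmuE T; exists k; split=> // psi M cpsi psiM s sT.
apply: hk.
- by apply: measurable_renewal; case: cpsi.
- by move=> u /chord_time_gt0 u0; apply: psiM; lra.
- by move=> u Hu uT; case: cpsi => _ ->//; lra.
Qed.

Section picard.
Variables (h : R -> R).
Hypothesis ch : causal h.

(** The contraction constant depends on T, so no single Banach space is used: one sequence serves
    all times, with geometric convergence on each half line of times up to T. *)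
Fixpoint picard n : R -> R :=
  if n is m.+1 then fun t => h t + renewal (picard m) t else fun=> 0.

Lemma causal_picard n : causal (picard n).
Proof.
elim: n => [|n IH]/=; last by apply: causalD => //; exact: causal_renewal.
by split=> // t; exact: cvg_cst.
Qed.

Lemma picard_cauchy (T : R) : exists k C : R, [/\ 0 <= k < 1, 0 <= C &
  forall n j t, t <= T -> `|picard (n + j) t - picard n t| <= C * k ^+ n].
Proof.
have [k [k01 hk]] := renewal_contraction T.
have [M M0 hM] := causal_bounded T ch.
have step n t : t <= T -> `|picard n.+1 t - picard n t| <= M * k ^+ n.
  elim: n t => [|n IH] t tT.
    have -> : picard 1 t = h t + renewal (fun=> 0) t by [].
    have -> : renewal (fun=> 0) t = 0 by exact: flux0.
    by rewrite addr0 subr0 expr0 mulr1 hM.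
  have -> : picard n.+2 t - picard n.+1 t =
      renewal (fun s => picard n.+1 s - picard n s) t.
    rewrite -renewalB; [|exact: causal_picard|exact: causal_picard].
    by rewrite /=; ring.
  rewrite exprS mulrCA; apply: hk => //.
  by apply: causalB; exact: causal_picard.
have [k0 k1] := andP k01; have k10 : 0 < 1 - k by rewrite subr_gt0.
exists k, (M / (1 - k)); split=> //; first by rewrite divr_ge0// ltW.
move=> n j t tT.
(* The partial geometric sum is kept because the uniform bound is not stable under induction on
   j. *)
suff : `|picard (n + j) t - picard n t| <= M * k ^+ n * ((1 - k ^+ j) / (1 - k)).
  move=> /le_trans; apply.
  rewrite [leRHS]mulrAC ler_wpM2l ?mulr_ge0 ?exprn_ge0//.
  by rewrite -[leRHS]mul1r ler_wpM2r ?invr_ge0 ?(ltW k10)// gerBl exprn_ge0.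
elim: j => [|j IH]; first by rewrite addn0 subrr normr0 expr0 subrr mul0r mulr0.
rewrite addnS -[X in `|X|](subrKA (picard (n + j) t)) (le_trans (ler_normD _ _))//.
rewrite (le_trans (lerD (step _ _ tT) IH))// le_eqVlt; apply/orP; left; apply/eqP.
by rewrite exprD exprS; field; rewrite gt_eqF.
Qed.

Lemma exists_small_geometric (k C e : R) : 0 <= k < 1 -> 0 <= C -> 0 < e ->
  exists n, C * k ^+ n < e.
Proof.
move=> /andP[k0 k1] C0 e0.
have : C * k ^+ n @[n --> \oo] --> C * 0.
  by apply: cvgM; [exact: cvg_cst|apply: cvg_expr; rewrite ger0_norm].
rewrite mulr0 => /cvgrPdist_lt/(_ _ e0)[N _ /(_ N (leqnn N))]/=.
rewrite sub0r normrN ger0_norm ?mulr_ge0 ?exprn_ge0// => hN; by exists N.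
Qed.

Lemma exists_renewal_solution :
  exists psi, causal psi /\ forall t, psi t = h t + renewal psi t.
Proof.
have cvg_picard t : cvgn (picard ^~ t).
  have [k [C [k01 C0 hk]]] := picard_cauchy t.
  apply/cauchy_cvgP/cauchy_exP => e e0.
  have [n hn] := exists_small_geometric k01 C0 e0.
  exists (picard n t), n => // m /= nm.
  rewrite /ball/= distrC -(subnKC nm); apply: le_lt_trans hn; exact: hk.
pose psi t := limn (picard ^~ t).
have psi_picard (T : R) : exists k C : R, [/\ 0 <= k < 1, 0 <= C &
    forall n t, t <= T -> `|psi t - picard n t| <= C * k ^+ n].
  have [k [C [k01 C0 hk]]] := picard_cauchy T; exists k, C; split=> // n t tT.
  have c : `|picard m t - picard n t| @[m --> \oo] --> `|psi t - picard n t|.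
    by apply: cvg_norm; apply: cvgB; [exact: cvg_picard|exact: cvg_cst].
  rewrite -(cvg_lim _ c)//; apply: limr_le; first exact: cvgP c.
  by exists n => // m /= nm; rewrite -(subnKC nm); exact: hk.
have cpsi : causal psi.
  split=> [t|t t0]; last first.
    rewrite /psi (_ : picard ^~ t = cst 0) ?lim_cst//.
    by apply/funext => n; case: (causal_picard n) => _ ->.
  (* Continuity passes to the limit by the usual three-term estimate; the bound up to t + 1 covers a
     neighbourhood of t. *)
  have [k [C [k01 C0 hk]]] := psi_picard (t + 1).
  apply/cvgrPdist_lt => e e0; have e_3 : 0 < e / 3 by rewrite divr_gt0.
  have [n hn] := exists_small_geometric k01 C0 e_3.
  have [cn _] := causal_picard n.
  have /cvgrPdist_lt/(_ _ e_3) c := cn t.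
  near=> s.
  have h1 : `|psi t - picard n t| < e / 3 by apply: le_lt_trans hn; apply: hk; lra.
  have h2 : `|psi s - picard n s| < e / 3.
    apply: le_lt_trans hn; apply: hk; apply: ltW; near: s; apply: lt_nbhsl; lra.
  have h3 : `|picard n t - picard n s| < e / 3 by near: s; exact: c.
  have -> : psi t - psi s = (psi t - picard n t) + (picard n t - picard n s) -
     (psi s - picard n s) by ring.
  rewrite (le_lt_trans (ler_normB _ _))// (le_lt_trans (lerD (ler_normD _ _) (lexx _)))//.
  lra.
exists psi; split=> // t; apply/eqP; rewrite -subr_eq0 -normr_le0; apply/ler_addgt0Pr => e e0.
rewrite add0r.
have [k [C [k01 C0 hk]]] := psi_picard t.
have [k' [/andP[k'0 k'1] hk']] := renewal_contraction t.
have e2 : 0 < e / 2 by rewrite divr_gt0.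
have [n hn] := exists_small_geometric k01 C0 e2.
(* Subtracting the recursion for the next iterate leaves two errors, both geometrically small. *)
have -> : psi t - (h t + renewal psi t) = (psi t - picard n.+1 t) -
    renewal (fun s => psi s - picard n s) t.
  by rewrite -renewalB//=; [ring|exact: causal_picard].
rewrite (le_trans (ler_normB _ _))//.
have h1 : `|psi t - picard n.+1 t| <= C * k ^+ n.
  rewrite (le_trans (hk n.+1 t (lexx t)))// ler_wpM2l// exprS ler_piMl ?exprn_ge0//.
    by case/andP: k01.
  by case/andP: k01 => _ /ltW.
have h2 : `|renewal (fun s => psi s - picard n s) t| <= k' * (C * k ^+ n).
  apply: hk' => //; first by apply: causalB => //; exact: causal_picard.
  by move=> s st; exact: hk.
have h3 : k' * (C * k ^+ n) <= C * k ^+ n.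
  by rewrite ler_piMl ?(ltW k'1)// mulr_ge0// exprn_ge0//; case/andP: k01.
lra.
Unshelve. all: by end_near. Qed.

End picard.

Lemma exists_causal_primitive psi : causal psi ->
  exists phi, causal phi /\ forall t : R, is_derive t (1 : R) phi (psi t).
Proof.
move=> cpsi; have [cont psi0] := cpsi.
(* The base point lies strictly below 0 so that the fundamental theorem of calculus applies at t = 0
   too; [psi] vanishes between -1 and 0. *)
pose phi x : R := \int[lebesgue_measure]_(s in `[-1, x]) psi s.
have phi0 x : x <= 0 -> phi x = 0.
  move=> x0; rewrite /phi (@eq_Rintegral _ _ _ _ _ (cst 0)).
    by rewrite /Rintegral integral0.
  by move=> s; rewrite inE/= in_itv/= => /andP[_ sx]; rewrite psi0// (le_trans sx).
have dphi (t : R) : is_derive t (1 : R) phi (psi t).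
  have [t0|t1] := ltP t 0.
    rewrite psi0; last exact: ltW.
    apply: (near_eq_is_derive (f := cst 0)) => //.
    near=> x; rewrite phi0// ltW//; near: x; exact: lt_nbhsl.
  have tt1 : t < t + 1 by rewrite ltrDl.
  have i : lebesgue_measure.-integrable `[-1, t + 1] (EFin \o psi).
    apply: continuous_compact_integrable; first exact: segment_compact.
    exact: continuous_subspaceT.
  have [] := @continuous_FTC1_closed _ psi (-1) t (t + 1) tt1 i _ (cont t).
    by rewrite (lt_le_trans _ t1)// ltrN10.
  by rewrite derive1E => d dE; exact: DeriveDef.
exists phi; split=> //; split=> // t.
apply: differentiable_continuous; apply/derivable1_diffP; exact: (dphi t).(ex_derive).
Unshelve. all: by end_near. Qed.

(** Solve psi = S' + A psi and integrate. Then phi - (S + A phi) has zero derivative and vanishes at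
    0, hence everywhere. *)
Lemma exists_renewal_solution_C1 (S S' : R -> R) : causal S -> causal S' ->
  (forall t : R, is_derive t (1 : R) S (S' t)) ->
  exists phi psi, [/\ causal phi, causal psi,
    forall t : R, is_derive t (1 : R) phi (psi t) &
    forall t, phi t = S t + renewal phi t].
Proof.
move=> cS cS' dS; have [psi [cpsi psiE]] := exists_renewal_solution cS'.
have [phi [cphi dphi]] := exists_causal_primitive cpsi.
exists phi, psi; split=> // t.
have d0 (x : R) : is_derive x (1 : R) (phi - (S + renewal phi)) 0.
  have dr := is_derive_renewal x cphi cpsi dphi.
  apply: (is_derive_eq (is_deriveB (dphi x) (is_deriveD (dS x) dr))).
  by rewrite -psiE subrr.
have := @is_derive_0_is_cst R _ t 0 d0; rewrite !fctE => h0.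
apply/eqP; rewrite -subr_eq0; apply/eqP; rewrite h0.
have [_ -> //] := cphi; have [_ -> //] := cS.
by have [_ ->] := causal_renewal cphi; rewrite // addr0 subrr.
Qed.

End renewal.

Lemma is_derive_quadratic (R : realType) (a b c s : R) :
  is_derive s (1 : R) (fun t => a + b * t - c * t ^+ 2) (b - 2 * c * s).
Proof.
have di : is_derive s (1 : R) (id : R -> R) 1 by exact: is_derive_id.
have da : is_derive s (1 : R) (cst a : R -> R) 0 by exact: is_derive_cst.
have h := is_deriveB (is_deriveD da (is_deriveZ b di)) (is_deriveZ c (is_deriveM di di)).
rewrite (_ : (fun _ => _) = cst a + b *: id - c *: (id * id)).
  by apply: (is_derive_eq h); rewrite /GRing.scale/=; ring.
by apply/funext => t; rewrite !fctE /GRing.scale/=; ring.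
Qed.

(** * Flux of the particles that have not yet met the boundary *)

Section source.
Context {R : realType} (cmu : R).
Local Notation V3 := (measurableTypeR R * measurableTypeR R * measurableTypeR R)%type.
Hypothesis cmuE : cmu * (\int[leb3]_(u in half_space) flux_density u)%R = 1.
Local Notation flux := (flux cmu).
Implicit Types (s t : R) (u : V3).

Let q t u : R := radius2 - 1 + 2 * t * u.2 - t ^+ 2 * dot u u - dot u u.

Lemma datum_northE t u : datum (north_pole + (- t) *: u, u) = flat_bump 0 (q t u).
Proof.
rewrite /datum /q/= dot_linl !dot_linr (dotC u north_pole).
have -> : dot north_pole u = u.2 by rewrite dotE/= !mul0r !add0r mul1r.
have -> : dot north_pole north_pole = 1 :> R by rewrite dotE/= !mul0r !add0r mul1r.
by congr (flat_bump 0 _); ring.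
Qed.

(* [expR (dot u u / 4)] is the inverse of the square root of the Maxwellian: [flux] integrates
   against the Maxwellian itself. *)
Let source_integrand t u : R := datum (north_pole + (- t) *: u, u) * expR (dot u u / 4).

Definition source t : R := flux (source_integrand t).

Let source_integrand' t u : R :=
  flat_bump 2 (q t u) * (2 * u.2 - 2 * t * dot u u) * expR (dot u u / 4).

Let is_derive_source_integrand (s : R) u :
  is_derive s (1 : R) (source_integrand ^~ u) (source_integrand' s u).
Proof.
have dq := is_derive_quadratic (radius2 - 1 - dot u u) (2 * u.2) (dot u u) s.
have E : (fun t : R => radius2 - 1 - dot u u + 2 * u.2 * t - dot u u * t ^+ 2) = q ^~ u.
  by apply/funext => t; rewrite /q; ring.
rewrite E in dq.
have := @is_derive1_comp _ _ _ s _ _ (is_derive_flat_bump 0 (q s u)) dq.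
rewrite mul0r subr0 => db.
have -> : source_integrand ^~ u = expR (dot u u / 4) *: (flat_bump 0 \o (fun t => q t u)).
  by apply/funext => t; rewrite /source_integrand datum_northE mulrC.
apply: (is_derive_eq (is_deriveZ _ db)).
by rewrite /source_integrand' /GRing.scale/=; ring.
Qed.

(** For outgoing u and t <= 0 the foot n - t u is outside the ball. Moreover 2 t u.2 <= t^2 |u|^2 +
    1 gives q <= [radius2] - |u|^2. The first fact yields causality, the second bounds the factor
    exp (|u|^2 / 4). *)
Let q_gt0 t u : 0 < q t u -> half_space u -> dot u u < 1 /\ 0 < t.
Proof.
rewrite /q /radius2 => q0 u0.
have t0 : 0 < t.
  rewrite ltNge; apply/negP => t0.
  have : t * u.2 <= 0 by rewrite mulr_le0_ge0 ?(ltW u0).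
  have := dot_ge0 u; have := mulr_ge0 (sqr_ge0 t) (dot_ge0 u); lra.
split=> //.
have : u.2 ^+ 2 <= dot u u by rewrite dotE -!expr2 lerDr addr_ge0 ?sqr_ge0.
move: q0; set d := dot u u => q0 ud.
have h1 : 2 * t * u.2 <= t ^+ 2 * d + 1.
  have : t ^+ 2 * u.2 ^+ 2 <= t ^+ 2 * d by rewrite ler_wpM2l ?sqr_ge0.
  have := sqr_ge0 (t * u.2 - 1); nra.
lra.
Qed.

Let expR_dot_le u : dot u u < 1 -> expR (dot u u / 4) <= expR 1.
Proof. by move=> u1; rewrite ler_expR; lra. Qed.

Let source_integrand_le s u : half_space u -> `|source_integrand s u| <= expR 1.
Proof.
move=> Hu; rewrite /source_integrand datum_northE ger0_norm; last first.
  by rewrite mulr_ge0 ?flat_bump_ge0 ?expR_ge0.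
have [q0|q0] := leP (q s u) 0; first by rewrite flat_bump0// mul0r expR_ge0.
have [u1 _] := q_gt0 q0 Hu.
rewrite -[leRHS]mul1r ler_pM ?flat_bump_ge0 ?expR_ge0 ?expR_dot_le//.
by rewrite (le_trans (flat_bump_le _ _))// expr0.
Qed.

(** The three factors of the bound: 2^2 from [flat_bump_le], 2 + 2 a from |u| < 1, and e. *)
Let source_integrand'_le s u (a : R) : `|s| <= a -> half_space u ->
  `|source_integrand' s u| <= 4 * (2 + 2 * a) * expR 1.
Proof.
move=> sa Hu; have a0 : 0 <= a by exact: le_trans sa.
rewrite /source_integrand'.
have [q0|q0] := leP (q s u) 0.
  by rewrite flat_bump0// !mul0r normr0 !mulr_ge0 ?expR_ge0// addr_ge0// mulr_ge0.
have [u1 _] := q_gt0 q0 Hu.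
rewrite !normrM (ger0_norm (expR_ge0 _)) ler_pM ?mulr_ge0 ?normr_ge0 ?expR_ge0 ?expR_dot_le//.
rewrite ler_pM ?normr_ge0//.
  by rewrite ger0_norm ?flat_bump_ge0// (le_trans (flat_bump_le _ _))// -natrX.
rewrite (le_trans (ler_normB _ _))// lerD//.
  rewrite normrM ger0_norm// -[leRHS]mulr1 ler_wpM2l// ger0_norm ?(ltW Hu)//.
  have : u.2 ^+ 2 <= dot u u by rewrite dotE -!expr2 lerDr addr_ge0 ?sqr_ge0.
  by move: Hu; rewrite /half_space/=; nra.
rewrite !normrM ger0_norm// (ger0_norm (dot_ge0 u)) -mulrA ler_wpM2l//.
by rewrite -[leRHS]mulr1 ler_pM ?normr_ge0 ?dot_ge0 ?(ltW u1).
Qed.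

Let continuous_q t : continuous (fun u : R3 R => q t u).
Proof.
move=> u; apply: cvgB; last exact: continuous_dot_self.
apply: cvgB; last by apply: cvgM; [exact: cvg_cst|exact: continuous_dot_self].
by apply: cvgD; [exact: cvg_cst|apply: cvgM; [exact: cvg_cst|exact: cvg_snd]].
Qed.

Let continuous_flat_bump k : continuous (@flat_bump R k).
Proof.
move=> x; apply: differentiable_continuous; apply/derivable1_diffP.
by case: (is_derive_flat_bump k x).
Qed.

Lemma continuous_expR_dot : continuous (fun u : R3 R => expR (dot u u / 4)).
Proof.
move=> u; apply: (@continuous_comp _ _ _ (fun u : R3 R => dot u u / 4) expR); last exact: continuous_expR.
by apply: cvgM; [exact: continuous_dot_self|exact: cvg_cst].
Qed.

Let measurable_source_integrand t : measurable_fun half_space (source_integrand t).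
Proof.
apply: continuous_measurable_R3; first exact: open_half_space.
move=> u _; have -> : source_integrand t = fun u => flat_bump 0 (q t u) * expR (dot u u / 4).
  by apply/funext => w; rewrite /source_integrand datum_northE.
apply: cvgM; last exact: continuous_expR_dot.
by apply: (@continuous_comp _ _ _ (fun u : R3 R => q t u) (flat_bump 0));
  [exact: continuous_q|exact: continuous_flat_bump].
Qed.

Let measurable_source_integrand' t : measurable_fun half_space (source_integrand' t).
Proof.
apply: continuous_measurable_R3; first exact: open_half_space.
move=> u _; apply: cvgM; last exact: continuous_expR_dot.
apply: cvgM.
  by apply: (@continuous_comp _ _ _ (fun u : R3 R => q t u) (flat_bump 2));
    [exact: continuous_q|exact: continuous_flat_bump].
apply: cvgB; first by apply: cvgM; [exact: cvg_cst|exact: cvg_snd].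
by apply: cvgM; [exact: cvg_cst|exact: continuous_dot_self].
Qed.

Lemma measurable_source t : measurable_fun half_space
  (fun u : V3 => datum (north_pole + (- t) *: u, u) * expR (dot u u / 4)).
Proof. exact: measurable_source_integrand. Qed.

Lemma source_integrand_bound t u : half_space u ->
  `|datum (north_pole + (- t) *: u, u) * expR (dot u u / 4)| <= expR 1.
Proof. exact: source_integrand_le. Qed.

Let near_norm t s : t - 1 < s < t + 1 -> `|s| <= `|t| + 1.
Proof.
move=> /andP[h1 h2]; have := ler_norm t; have := ler_norm (- t); rewrite normrN ler_norml.
by move=> ? ?; apply/andP; split; lra.
Qed.

Lemma causal_source : causal source.
Proof.
split=> [t|t t0].
  apply: (continuous_flux cmuE (M := expR 1)) => //.
  - by move=> s u _; exact: source_integrand_le.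
  - move=> u Hu s; apply: differentiable_continuous; apply/derivable1_diffP.
    by case: (is_derive_source_integrand s u).
rewrite -[RHS](flux0 cmu); apply: eq_flux => u Hu.
rewrite /source_integrand datum_northE flat_bump0 ?mul0r//.
by rewrite leNgt; apply/negP => /q_gt0/(_ Hu)[_]; rewrite ltNge t0.
Qed.

Lemma exists_source_derivative : exists S' : R -> R,
  causal S' /\ forall t, is_derive t (1 : R) source (S' t).
Proof.
exists (fun t => flux (source_integrand' t)); split; last first.
  move=> t; apply: (is_derive_flux cmuE (M := expR 1) (M' := 4 * (2 + 2 * (`|t| + 1)) * expR 1)) => //.
  - by move=> s u _; exact: source_integrand_le.
  - by move=> s u /near_norm; exact: source_integrand'_le.
split=> [t|t t0].
  apply: (continuous_flux cmuE (M := 4 * (2 + 2 * (`|t| + 1)) * expR 1)) => //.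
  - by move=> s u /near_norm; exact: source_integrand'_le.
  - move=> u Hu s; rewrite /source_integrand'; apply: cvgM; last exact: cvg_cst.
    have cq : {for s, continuous (fun t => q t u)}.
      rewrite /q; apply: cvgB; last exact: cvg_cst.
      apply: cvgB.
        apply: cvgD; first exact: cvg_cst.
        by apply: cvgM; [apply: cvgM; [exact: cvg_cst|exact: cvg_id]|exact: cvg_cst].
      by apply: cvgM; [exact: exprn_continuous|exact: cvg_cst].
    apply: cvgM.
      by apply: (@continuous_comp _ _ _ (fun t => q t u) (flat_bump 2));
        [exact: cq|exact: continuous_flat_bump].
    apply: cvgB; first exact: cvg_cst.
    by apply: cvgM; [apply: cvgM; [exact: cvg_cst|exact: cvg_id]|exact: cvg_cst].
rewrite -[RHS](flux0 cmu); apply: eq_flux => u Hu.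
rewrite /source_integrand' flat_bump0 ?mul0r//.
by rewrite leNgt; apply/negP => /q_gt0/(_ Hu)[_]; rewrite ltNge t0.
Qed.

Lemma source1_gt0 : 0 < source 1.
Proof.
(* Velocities close to half the north pole: these particles started near the midpoint of a radius,
   well inside the support. There q >= 1/5, whence the lower bound exp (-5). *)
pose r : R := 10^-1; pose a : R := 9 / 20; pose b : R := 11 / 20.
have h1 : - r < r by rewrite /r; lra.
have h2 : a < b by rewrite /a /b; lra.
have a0 : 0 < a by rewrite /a; lra.
apply: (@flux_gt0 _ _ cmuE _ (expR 1) (expR (- 5)) (- r) r (- r) r a b) => //.
- move=> u Hu; rewrite (le_trans (ler_norm _) (source_integrand_le _ _))// andbT.
  by rewrite mulr_ge0 ?datum_ge0 ?expR_ge0.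
move=> [[x y] z] /= /andP[hx hx'] /andP[hy hy'] /andP[hz hz'].
rewrite /source_integrand datum_northE.
have q1 : 1 / 5 <= q 1 (x, y, z).
  by move: hx hx' hy hy' hz hz'; rewrite /r /a /b /q /radius2 dotE/=; nra.
have q0 : 0 < q 1 (x, y, z) by lra.
rewrite /flat_bump q0 expr0 mulr1 -[leLHS]mulr1 ler_pM ?expR_ge0//.
  rewrite ler_expR lerN2 -[leRHS]invrK lef_pV2 ?posrE ?invr_gt0//; lra.
by rewrite -expR0 ler_expR divr_ge0 ?dot_ge0.
Qed.

(** If phi' vanished on ]0, 1[, phi would vanish up to time 1, and so would A phi at time 1; the
    equation would give S(1) = 0. Continuity of psi then spreads one nonzero value to an
    interval. *)
Lemma renewal_density_neq0 (phi psi : R -> R) : causal phi -> causal psi ->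
  (forall t, is_derive t (1 : R) phi (psi t)) ->
  (forall t, phi t = source t + renewal cmu phi t) ->
  exists a b : R, [/\ 0 <= a, a < b, b <= 1 &
    forall s, a < s < b -> psi s != 0].
Proof.
move=> cphi cpsi dphi phiE.
have [s0 s01 psis0] : exists2 s0, 0 < s0 < 1 & psi s0 != 0.
  apply: contrapT => h.
  have psi0 s : 0 < s < 1 -> psi s = 0.
    by move=> s01; apply: contrapT => /eqP ps; apply: h; exists s.
  have phi0 s : s <= 1 -> phi s = 0.
    move=> s1; have [s0|s0] := leP s 0; first by case: cphi => _ ->.
    have cphi0 : {within `[0, s], continuous phi} by apply: continuous_subspaceT; case: cphi.
    have [c] := @MVT _ phi psi _ _ s0 (fun x _ => dphi x) cphi0.
    rewrite in_itv/= => /andP[c0 cs]; rewrite psi0 ?c0 ?(lt_le_trans cs)// mul0r.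
    by have [_ p0] := cphi; rewrite (p0 0)// subr0.
  have : source 1 = 0.
    have r0 : renewal cmu phi 1 = 0.
      rewrite -[RHS](flux0 cmu); apply: eq_flux => u /chord_time_gt0 u0.
      by rewrite phi0//; lra.
    by have := phiE 1; rewrite phi0// r0 addr0.
  by have := source1_gt0 => /[swap] ->; rewrite ltxx.
have [cont _] := cpsi.
have : \forall s \near s0, psi s != 0 by exact: (cvgr_neq0 _ (cont s0) psis0).
move=> /nbhs_ballP[e /= e0 he].
have [s00 s0_1] := andP s01.
exists (Num.max 0 (s0 - e)), (Num.min 1 (s0 + e)); split.
- by rewrite le_max lexx.
- rewrite gt_max !lt_min ltr01/= ltr_wpDr ?(ltW e0)//= ; apply/andP; split; lra.
- by rewrite ge_min lexx.
- move=> s; rewrite gt_max lt_min => /andP[/andP[_ h1] /andP[_ h2]]; apply: he.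
  by rewrite /ball/= ltr_norml; apply/andP; split; lra.
Qed.

End source.

(** * Backward exit times and the solution *)

Section phase_derivatives.
Context {R : realType}.
Implicit Types (g : R -> R3 R -> R3 R -> R) (t : R) (x v e : R3 R).
Local Notation Z := (R * (R3 R * R3 R))%type.

Lemma derive_uncurry3_t g t x v :
  'D_((1, (0, 0)) : Z) (uncurry3 g) (t, (x, v)) = derive1 (fun s => g s x v) t.
Proof.
rewrite derive1E /derive.
set F := (fun h : R => _); set G := (fun h : R => h^-1 *: _); suff -> : F = G by [].
by apply/funext => h; rewrite /F /G /uncurry3 /= !scaler0 !add0r.
Qed.

Lemma derive_uncurry3_x g t x v e :
  'D_((0, (e, 0)) : Z) (uncurry3 g) (t, (x, v)) = 'D_e (fun y => g t y v) x.
Proof.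
rewrite /derive.
set F := (fun h : R => _); set G := (fun h : R => h^-1 *: _); suff -> : F = G by [].
by apply/funext => h; rewrite /F /G /uncurry3 /= !scaler0 !add0r.
Qed.

Lemma derive_dot_grad_x g t x v e : differentiable (uncurry3 g) (t, (x, v)) ->
  'D_((0, (e, 0)) : Z) (uncurry3 g) (t, (x, v)) = dot e (grad_x g t x v).
Proof.
move=> dg; rewrite /dot /grad_x /grad/= -!derive_uncurry3_x !deriveE//.
pose l (w : Z) : R := 'd (uncurry3 g) (t, (x, v)) w.
have lZ a w : a * l w = l (a *: w) by rewrite /l linearZ.
have lD w w' : l w + l w' = l (w + w') by rewrite /l linearD.
rewrite -[LHS]/(l _) -[X in _ = _ * X + _ + _]/(l _) -[X in _ = _ + _ * X + _]/(l _).
rewrite -[X in _ = _ + _ * X]/(l _) !lZ !lD; congr (l _).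
apply: f_equal2; first by rewrite /= !scaler0 !addr0.
apply: f_equal2; last by rewrite /= !scaler0 !addr0.
rewrite /= -[e.1.1 *: _]add0r !R3_linE; case: e => [[a b] c] /=.
by congr (_, _, _); ring.
Qed.

Lemma derive_transport g t x v : differentiable (uncurry3 g) (t, (x, v)) ->
  'D_((1, (v, 0)) : Z) (uncurry3 g) (t, (x, v)) =
  derive1 (fun s => g s x v) t + dot v (grad_x g t x v).
Proof.
move=> dg; rewrite -derive_dot_grad_x// -derive_uncurry3_t !deriveE// -linearD.
congr ('d _ _ _); apply: f_equal2; first by rewrite /= addr0.
by apply: f_equal2; rewrite /= ?add0r ?addr0.
Qed.

Lemma derive_along_cst (E : normedModType R) (f : E -> R) (z e : E) :
  (forall h : R, f (h *: e + z) = f z) -> 'D_e f z = 0.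
Proof.
move=> fE; rewrite /derive (_ : (fun h => _) = cst 0) ?lim_cst//.
by apply/funext => h /=; rewrite fE subrr scaler0.
Qed.

End phase_derivatives.

Section exit_time.
Context {R : realType}.
Implicit Types (t : R) (x v : R3 R).

(** A quarter of the discriminant of |x - t v|^2 = 1, quadratic in t, whose larger root is
    [exit_time]. *)
Definition disc x v : R := dot x v ^+ 2 + dot v v * (1 - dot x x).

(* Time needed to reach the unit sphere from [x] with velocity [- v]; meaningless for [v = 0]. *)
Definition exit_time x v : R := (dot x v + Num.sqrt (disc x v)) / dot v v.

Lemma disc_ge x v : dot x x <= 1 -> dot x v ^+ 2 <= disc x v.
Proof. by move=> x1; rewrite lerDl mulr_ge0 ?dot_ge0// subr_ge0. Qed.

Lemma exit_time_ge0 x v : dot x x <= 1 -> 0 <= exit_time x v.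
Proof.
move=> /(disc_ge v) h; rewrite divr_ge0 ?dot_ge0// -lerBlDl sub0r.
by rewrite (le_trans (ler_norm _))// normrN -sqrtr_sqr ler_wsqrtr.
Qed.

Lemma exit_time_incoming x v : dot x x = 1 -> dot x v < 0 -> exit_time x v = 0.
Proof.
move=> x1 xv; rewrite /exit_time /disc x1 subrr mulr0 addr0 sqrtr_sqr.
by rewrite ltr0_norm// subrr mul0r.
Qed.

Lemma exit_time_outgoing x v : dot x x = 1 -> 0 < dot x v ->
  exit_time x v = 2 * dot x v / dot v v.
Proof.
move=> x1 xv; rewrite /exit_time /disc x1 subrr mulr0 addr0 sqrtr_sqr.
by rewrite gtr0_norm//; congr (_ / _); ring.
Qed.

Lemma disc_shift x v (s : R) : disc (x + s *: v) v = disc x v.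
Proof. by rewrite /disc !dot_linl !dot_linr (dotC v x); ring. Qed.

Lemma exit_time_shift x v (s : R) : v != 0 ->
  exit_time (x + s *: v) v = exit_time x v + s.
Proof.
move=> v0; rewrite /exit_time disc_shift dot_linl.
by field; rewrite dot_eq0.
Qed.

Lemma dot_foot x v t : dot (x + (- t) *: v) (x + (- t) *: v) =
  dot x x - 2 * t * dot x v + t ^+ 2 * dot v v.
Proof. by rewrite dot_linl !dot_linr (dotC v x); ring. Qed.

(** A foot inside the ball means that t lies strictly between the two roots, that is (t |v|^2 - x .
    v)^2 < [disc x v]. *)
Lemma lt_exit_time x v t : v != 0 ->
  dot (x + (- t) *: v) (x + (- t) *: v) < 1 -> t < exit_time x v.
Proof.
rewrite -dot_gt0 dot_foot => v0 xtv.
rewrite ltr_pdivlMr// -ltrBlDl (le_lt_trans (ler_norm _))// -sqrtr_sqr.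
rewrite ltr_sqrt.
  by rewrite /disc; nra.
by apply: (@le_lt_trans _ _ ((t * dot v v - dot x v) ^+ 2)); rewrite ?sqr_ge0// /disc; nra.
Qed.

Lemma foot_outside x v t : dot x x = 1 -> dot x v <= 0 -> 0 <= t ->
  1 <= dot (x + (- t) *: v) (x + (- t) *: v).
Proof.
move=> x1 xv t0; rewrite dot_foot x1; have := dot_ge0 v; have := sqr_ge0 t.
have := mulr_ge0 t0 (_ : 0 <= - dot x v); rewrite oppr_ge0 => /(_ xv); nra.
Qed.

Lemma foot_on_sphere x v : 0 <= disc x v -> v != 0 ->
  let y := x + (- exit_time x v) *: v in
  dot y y = 1 /\ dot y v = - Num.sqrt (disc x v).
Proof.
move=> d0 v0 /=; have v1 : dot v v != 0 by rewrite dot_eq0.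
have tE : exit_time x v * dot v v = dot x v + Num.sqrt (disc x v) by rewrite divfK.
split; last by rewrite dot_linl mulNr tE; ring.
rewrite dot_foot; apply: (mulIf v1); rewrite mul1r.
have -> : (dot x x - 2 * exit_time x v * dot x v + exit_time x v ^+ 2 * dot v v) * dot v v =
  dot x x * dot v v - 2 * (exit_time x v * dot v v) * dot x v + (exit_time x v * dot v v) ^+ 2 by ring.
rewrite tE; have := sqr_sqrtr d0; rewrite /disc; nra.
Qed.

End exit_time.

Section solution.
Context {R : realType} (cmu : R).
Local Notation V3 := (measurableTypeR R * measurableTypeR R * measurableTypeR R)%type.
Local Notation Z := (R * (R3 R * R3 R))%type.
Hypothesis cmuE : cmu * (\int[leb3]_(u in half_space) flux_density u)%R = 1.
Variables (phi psi : R -> R).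
Hypotheses (cphi : causal phi) (cpsi : causal psi).
Hypothesis (dphi : forall t : R, is_derive t (1 : R) phi (psi t)).
Hypothesis (phiE : forall t, phi t = source cmu t + renewal cmu phi t).
Implicit Types (t : R) (x v : R3 R).

(** A particle at rest never meets the boundary, hence the separate case v = 0, where [exit_time]
    has no meaning. *)
Definition sol t x v : R := datum (x + (- t) *: v, v) +
  (if v == 0 then 0 else expR (- dot v v / 4) * phi (t - exit_time x v)).

Lemma sol_shift t x v (s : R) : sol (t + s) (x + s *: v) v = sol t x v.
Proof.
rewrite /sol.
have -> : x + s *: v + (- (t + s)) *: v = x + (- t) *: v.
  by rewrite !R3_linE /=; congr (_, _, _); ring.
congr (_ + _); case: ifPn => [//|v0].
by rewrite exit_time_shift//; congr (_ * phi _); ring.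
Qed.

Lemma sol_inside t x v : dot (x + (- t) *: v) (x + (- t) *: v) < 1 ->
  sol t x v = datum (x + (- t) *: v, v).
Proof.
move=> xtv; rewrite /sol; case: ifPn => v0; first by rewrite addr0.
have [_ ->] := cphi; first by rewrite mulr0 addr0.
by rewrite subr_le0 ltW// lt_exit_time.
Qed.

Lemma open_disc_gt0 : open [set z : Z | 0 < disc z.2.1 z.2.2].
Proof.
apply: (@open_comp _ _ (fun z : Z => disc z.2.1 z.2.2) [set r | 0 < r]); last exact: open_gt.
have c1 : continuous (fun z : Z => z.2.1) by apply: continuous_fst_comp => z; exact: cvg_snd.
have c2 : continuous (fun z : Z => z.2.2) by apply: continuous_snd_comp => z; exact: cvg_snd.
move=> z _; apply: cvgD.
  by apply: (@continuous_comp _ _ _ (fun z : Z => dot z.2.1 z.2.2) (fun r => r ^+ 2));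
    [exact: (continuous_dot c1 c2)|exact: exprn_continuous].
apply: cvgM; first exact: (continuous_dot c2 c2).
by apply: cvgB; [exact: cvg_cst|exact: (continuous_dot c1 c1)].
Qed.


Lemma open_foot_inside :
  open [set z : Z | dot (z.2.1 + (- z.1) *: z.2.2) (z.2.1 + (- z.1) *: z.2.2) < 1].
Proof.
pose F (z : Z) := dot z.2.1 z.2.1 - 2 * z.1 * dot z.2.1 z.2.2 + z.1 ^+ 2 * dot z.2.2 z.2.2.
rewrite (_ : [set z | _] = [set z | F z < 1]); last first.
  by apply/seteqP; split=> z /=; rewrite dot_foot.
apply: (@open_comp _ _ F [set r | r < 1]); last exact: open_lt.
have c1 : continuous (fun z : Z => z.2.1) by apply: continuous_fst_comp => z; exact: cvg_snd.
have c2 : continuous (fun z : Z => z.2.2) by apply: continuous_snd_comp => z; exact: cvg_snd.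
have c0 : continuous (fun z : Z => z.1) by move=> z; exact: cvg_fst.
move=> z _; apply: cvgD.
  apply: cvgB; first exact: (continuous_dot c1 c1).
  apply: cvgM; last exact: (continuous_dot c1 c2).
  by apply: cvgM; [exact: cvg_cst|exact: c0].
apply: cvgM; last exact: (continuous_dot c2 c2).
by apply: (@continuous_comp _ _ _ (fun z : Z => z.1) (fun r => r ^+ 2));
    [exact: c0|exact: exprn_continuous].
Qed.

Let bump_algebra_dots : [/\ bump_algebra (fun z : Z => z.1),
  bump_algebra (fun z : Z => dot z.2.1 z.2.1),
  bump_algebra (fun z : Z => dot z.2.1 z.2.2) &
  bump_algebra (fun z : Z => dot z.2.2 z.2.2)].
Proof.
have c1 : continuous (fun z : Z => z.2.1) by apply: continuous_fst_comp => z; exact: cvg_snd.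
have c2 : continuous (fun z : Z => z.2.2) by apply: continuous_snd_comp => z; exact: cvg_snd.
split.
- by apply: bump_algebra_lin => // z; exact: cvg_fst.
- exact: bump_algebra_dot.
- exact: bump_algebra_dot.
- exact: bump_algebra_dot.
Qed.

Let bump_algebra_foot : bump_algebra (fun z : Z => datum (z.2.1 + (- z.1) *: z.2.2, z.2.2)).
Proof.
have [b0 b11 b12 b22] := bump_algebra_dots.
rewrite (_ : (fun _ => _) = fun z : Z => flat_bump 0 (radius2 +
    - (dot z.2.1 z.2.1 + - (2 * z.1 * dot z.2.1 z.2.2) + z.1 * z.1 * dot z.2.2 z.2.2) +
    - dot z.2.2 z.2.2)).
  apply: bump_algebra_bump; apply: bump_algebraD; last exact: bump_algebraN.
  apply: bump_algebraD; first exact: bump_algebra_cst.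
  apply: bump_algebraN; apply: bump_algebraD; last by apply: bump_algebraM => //; exact: bump_algebraM.
  apply: bump_algebraD => //; apply: bump_algebraN; apply: bump_algebraM => //.
  by apply: bump_algebraM => //; exact: bump_algebra_cst.
by apply/funext => z; rewrite /datum dot_foot.
Qed.

(* On the second set the backward trajectory has not met the boundary, so that the boundary term of
   [sol] vanishes there; this covers [v = 0]. *)
Definition C1_region : set Z := [set z | 0 < disc z.2.1 z.2.2] `|`
  [set z | dot (z.2.1 + (- z.1) *: z.2.2) (z.2.1 + (- z.1) *: z.2.2) < 1].

Lemma C1on_sol : C1on C1_region (uncurry3 sol).
Proof.
have [b0 b11 b12 b22] := bump_algebra_dots.
apply: C1onU; last first.
  apply: (C1on_eq open_foot_inside (g := fun z : Z => datum (z.2.1 + (- z.1) *: z.2.2, z.2.2))).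
    by move=> [t [x v]] /= h; rewrite /uncurry3/= sol_inside.
  by apply: (@C1onS _ _ _ setT) => //; exact: bump_algebra_C1on.
have oU := open_disc_gt0.
set U := [set z : Z | _] in oU *.
have CT (g : Z -> R) : bump_algebra g -> C1on U g.
  by move=> bg; apply: (@C1onS _ _ _ setT) => //; exact: bump_algebra_C1on.
have v0 (z : Z) : U z -> z.2.2 != 0.
  move=> Uz; apply/eqP => z0; move: Uz; rewrite /U /disc/= z0 !dotE/=.
  by rewrite !mulr0 !addr0 expr0n/= mul0r addr0 ltxx.
have bdisc : bump_algebra (fun z : Z => disc z.2.1 z.2.2).
  rewrite (_ : (fun _ => _) = fun z : Z => dot z.2.1 z.2.2 * dot z.2.1 z.2.2 +
    dot z.2.2 z.2.2 * (1 + - dot z.2.1 z.2.1)) //.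
  apply: bump_algebraD; first exact: bump_algebraM.
  apply: bump_algebraM => //; apply: bump_algebraD; first exact: bump_algebra_cst.
  exact: bump_algebraN.
have Csqrt : C1on U (fun z : Z => Num.sqrt (disc z.2.1 z.2.2)).
  apply: (C1on_comp (V := [set r | 0 < r]) (f := Num.sqrt) (f' := fun r => (2 * Num.sqrt r)^-1) oU) => //.
  - move=> r /= r0; apply: cvgV; first by rewrite mulf_neq0// gt_eqF// sqrtr_gt0.
    by apply: cvgM; [exact: cvg_cst|exact: sqrt_continuous].
  - exact: CT.
have Cinv : C1on U (fun z : Z => (dot z.2.2 z.2.2)^-1).
  apply: (C1on_comp (V := [set r | r != 0]) (f := GRing.inv) (f' := fun r => - r ^- 2) oU).
  - by move=> z /v0; rewrite /= dot_eq0.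
  - by move=> r /= r0; exact: is_derive_invr.
  - move=> r /= r0; apply: cvgN; apply: cvgV; first by rewrite expf_neq0.
    exact: exprn_continuous.
  - exact: CT.
have Cexit : C1on U (fun z : Z => z.1 + - exit_time z.2.1 z.2.2).
  apply: (C1onD oU); first exact: CT.
  have := C1onM oU (CT _ (bump_algebra_cst _ (-1))) (C1onM oU (C1onD oU (CT _ b12) Csqrt) Cinv).
  rewrite (_ : (fun z : Z => -1 * _) = fun z : Z => - exit_time z.2.1 z.2.2)//.
  by apply/funext => z; rewrite mulN1r.
have Cphi : C1on U (fun z : Z => phi (z.1 + - exit_time z.2.1 z.2.2)).
  apply: (C1on_comp (V := setT) (f := phi) (f' := psi) oU); [by []| |exact: Cexit].
  by move=> r _; case: cpsi => + _; exact.
have Cexp : C1on U (fun z : Z => expR (- dot z.2.2 z.2.2 / 4)).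
  apply: (C1on_comp (V := setT) (f := expR) (f' := expR) oU) => //.
  - by move=> r _; exact: continuous_expR.
  - by apply: CT; apply: bump_algebraM; [exact: bump_algebraN|exact: bump_algebra_cst].
apply: (C1on_eq oU _ (C1onD oU (CT _ bump_algebra_foot) (C1onM oU Cexp Cphi))).
by move=> [t [x v]] /v0 /= vn0; rewrite /uncurry3 /sol /= (negbTE vn0).
Qed.

(** Inside the ball the discriminant is positive unless v = 0, and then the foot is x itself. On the
    sphere it equals (x . v)^2, positive off the grazing set. *)
Lemma closed_dom_C1_region : closed_dom `<=` C1_region.
Proof.
move=> [t [x v]] [/= t0 /closed_unit_ballE x1 ng].
have [x1'|x1'] := ltP (dot x x) 1.
  have [->|v0] := eqVneq v 0; first by right; rewrite /= scaler0 addr0.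
  left; rewrite /= /disc (@lt_le_trans _ _ (dot v v * (1 - dot x x)))//.
    by rewrite mulr_gt0 ?dot_gt0// subr_gt0.
  by rewrite lerDr sqr_ge0.
have {x1 x1'}x1 : dot x x = 1 by apply/eqP; rewrite eq_le x1.
left; rewrite /= /disc x1 subrr mulr0 addr0 exprn_even_gt0//=.
apply/eqP => xv; apply: ng; split=> /=; first exact/unit_sphereE.
by rewrite normal_sphere.
Qed.

End solution.

Lemma within_continuous_comp (S T U : topologicalType) (A : set S) (B : set T)
    (c : S -> T) (G : T -> U) :
  continuous c -> (forall s, A s -> B (c s)) -> {within B, continuous G} ->
  {within A, continuous (G \o c)}.
Proof.
move=> cc cAB /subspace_continuousP cG; apply/subspace_continuousP => s As.
apply: cvg_comp (cG (c s) (cAB s As)) => P hP.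
have hP' : nbhs (c s) (fun y => B y -> P y) := hP.
have h : nbhs s (fun r => A r -> P (c r)).
  have hc : nbhs s (fun r => B (c r) -> P (c r)) := cc s _ hP'.
  by apply: filterS hc => r hr Ar; exact/hr/cAB.
exact: h.
Qed.

Lemma continuous_pair (T A B : topologicalType) (p : T -> A) (q : T -> B) :
  continuous p -> continuous q -> continuous (fun z => (p z, q z)).
Proof. by move=> cp cq z; apply: cvg_pair; [exact: cp|exact: cq]. Qed.

(** * The diffuse boundary condition as a flux at the north pole *)

Section diffuse.
Context {R : realType} (cmu : R).
Local Notation V3 := (measurableTypeR R * measurableTypeR R * measurableTypeR R)%type.
Local Notation Z := (R * (R3 R * R3 R))%type.
Implicit Types (t : R) (x v : R3 R).

Lemma rotation_dot_north (T : R3 R -> R3 R) x u : rotation T -> T north_pole = x ->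
  dot x (T u) = u.2.
Proof. by move=> rT <-; rewrite (rotation_dot rT) dotE/= !mul0r !add0r mul1r. Qed.

Lemma open_outgoing x : open [set u : R3 R | 0 < dot x u].
Proof.
apply: (@open_comp _ _ (fun u : R3 R => dot x u) [set r | 0 < r]); last exact: open_gt.
by move=> u _; apply: continuous_dot => y; [exact: cvg_cst|exact: cvg_id].
Qed.

(** After the change of variables u = T w, the factor exp (|w|^2 / 4) completes the square root of
    the Maxwellian to the full Maxwellian in [flux_density]. *)
Lemma diffuse_flux (f : V3 -> R) (T : R3 R -> R3 R) x :
  rotation T -> T north_pole = x -> dot x x = 1 ->
  measurable_fun ([set u | 0 < dot x u] : set V3) f ->
  cmu * (\int[leb3]_(u in [set u : R3 R | (0 < dot (normal x) u)%R])
    (f u * Num.sqrt (maxwellian u) * dot (normal x) u))%R =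
  flux cmu (fun w => f (T w) * expR (dot w w / 4)).
Proof.
move=> rT Tx x1 mf; rewrite normal_sphere// /flux; congr (_ * _).
have mD : measurable ([set u | 0 < dot x u] : set V3).
  by apply: measurable_open_R3; exact: open_outgoing.
have mg : measurable_fun ([set u | 0 < dot x u] : set V3)
    (fun u : V3 => f u * Num.sqrt (maxwellian u) * dot x u).
  apply: measurable_funM; first apply: measurable_funM => //.
    apply: continuous_measurable_R3T mD => u.
    by apply: (@continuous_comp _ _ _ (@maxwellian R) Num.sqrt);
      [exact: continuous_maxwellian|exact: sqrt_continuous].
  apply: continuous_measurable_R3T mD.
  by apply: continuous_dot => y; [exact: cvg_cst|exact: cvg_id].
rewrite (Rintegral_rotation rT mD mg).
have -> : T @^-1` [set u : R3 R | 0 < dot x u] = half_space.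
  by apply/seteqP; split=> u; rewrite /preimage/= (rotation_dot_north u rT Tx).
apply: eq_Rintegral => u _; rewrite (rotation_dot_north u rT Tx) sqrt_maxwellian.
rewrite (rotation_dot rT) /flux_density maxwellianE.
have -> : - dot u u / 2 = - dot u u / 4 + - dot u u / 4 by lra.
have h : expR (- dot u u / 4) * expR (dot u u / 4) = 1.
  by rewrite -expRD mulNr addNr expR0.
rewrite expRD.
transitivity (f (T u) * expR (- dot u u / 4) * u.2 *
  (expR (- dot u u / 4) * expR (dot u u / 4))); first by rewrite h mulr1.
by ring.
Qed.

Lemma exit_time_rotation (T : R3 R -> R3 R) x w : rotation T -> T north_pole = x ->
  dot x x = 1 -> half_space w -> exit_time x (T w) = chord_time w.
Proof.
move=> rT Tx x1 Hw; rewrite exit_time_outgoing// (rotation_dot_north w rT Tx)//.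
by rewrite (rotation_dot rT).
Qed.

End diffuse.

Section solution.
Context {R : realType} (cmu : R).
Local Notation V3 := (measurableTypeR R * measurableTypeR R * measurableTypeR R)%type.
Local Notation Z := (R * (R3 R * R3 R))%type.
Hypothesis cmuE : cmu * (\int[leb3]_(u in half_space) flux_density u)%R = 1.
Variables (phi psi : R -> R).
Hypotheses (cphi : causal phi) (cpsi : causal psi).
Hypothesis (dphi : forall t : R, is_derive t (1 : R) phi (psi t)).
Hypothesis (phiE : forall t, phi t = source cmu t + renewal cmu phi t).
Implicit Types (t : R) (x v : R3 R).
Local Notation sol := (sol phi).

Lemma sol_incoming t x v : 0 <= t -> dot x x = 1 -> dot x v < 0 ->
  sol t x v = expR (- dot v v / 4) * phi t.
Proof.
move=> t0 x1 xv; rewrite /sol exit_time_incoming// subr0.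
have v0 : v != 0.
  by apply/eqP => v0; move: xv; rewrite v0 dotE/= !mulr0 !addr0 ltxx.
rewrite (negbTE v0) datum_eq0 ?add0r// /radius2.
by have := foot_outside x1 (ltW xv) t0; have := dot_ge0 v; rewrite /=; lra.
Qed.

(** Outgoing velocities avoid the grazing set, so continuity on [closed_dom] suffices. Stated for a
    general [g] because the uniqueness proof applies it to arbitrary solutions. *)
Lemma measurable_outgoing (g : R -> R3 R -> R3 R -> R) t x : 0 <= t -> dot x x = 1 ->
  {within closed_dom, continuous (uncurry3 g)} ->
  measurable_fun ([set u | 0 < dot x u] : set V3) (g t x).
Proof.
move=> t0 x1 cg.
have oD := @open_outgoing R x.
have cD : continuous (fun u : R3 R => (t, (x, u)) : Z).
  apply: (continuous_pair (p := fun=> t) (q := fun u => (x, u))).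
    by move=> y; exact: cvg_cst.
  by apply: continuous_pair => y; [exact: cvg_cst|exact: cvg_id].
have : {within [set u | 0 < dot x u], continuous (g t x)}.
  apply: (within_continuous_comp cD _ cg) => u /= xu.
  split=> //=; first by apply/closed_unit_ballE; rewrite x1.
  by move=> [_ /=]; rewrite normal_sphere// => xu0; move: xu; rewrite xu0 ltxx.
rewrite continuous_open_subspace// => cu.
by apply: continuous_measurable_R3 => // u Du; apply: cu; exact/mem_set.
Qed.

Lemma within_continuous_sol : {within closed_dom, continuous (uncurry3 sol)}.
Proof.
apply: continuous_in_subspaceT => z /set_mem/closed_dom_C1_region/(C1on_sol cphi cpsi dphi)[dz _].
exact: differentiable_continuous.
Qed.

(** This is the renewal equation read at x: on outgoing velocities [sol] divided by the square root
    of the Maxwellian is the integrand of [source] plus that of [renewal]. *)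
Lemma sol_diffuse_sol t x v : 0 <= t -> gamma_minus (x, v) ->
  sol t x v = cmu * Num.sqrt (maxwellian v) *
    \int[leb3]_(u in [set u | 0 < dot (normal x) u])
       (sol t x u * Num.sqrt (maxwellian u) * dot (normal x) u).
Proof.
move=> t0 [/= /unit_sphereE x1 nxv].
have xv : dot x v < 0 by move: nxv; rewrite normal_sphere.
rewrite sol_incoming// mulrAC -[LHS]mulrC -[in RHS]mulrC -sqrt_maxwellian.
have [T rT Tx] := exists_rotation x1.
have cs := within_continuous_sol.
rewrite (diffuse_flux cmu rT Tx x1 (measurable_outgoing t0 x1 cs)) mulrC; congr (_ * _).
have [M _ phiM] := causal_bounded t cphi.
rewrite phiE /source /renewal -(fluxD cmuE (M := expR 1) (M' := M)).
- apply: eq_flux => w Hw; rewrite /sol (exit_time_rotation rT Tx x1 Hw).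
  have Tw0 : T w != 0 by rewrite -dot_gt0 (rotation_dot rT) half_space_dot.
  rewrite (negbTE Tw0) (rotation_dot rT) [RHS]mulrDl; congr (_ + _).
    congr (_ * _); rewrite -Tx -(rotation_linear rT) /datum/=.
    by rewrite !(rotation_dot rT).
  rewrite mulrAC -expRD mulNr addNr expR0 mul1r//.
- exact: measurable_source.
- by apply: measurable_renewal; case: cphi.
- by move=> u; exact: source_integrand_bound.
- by move=> u /chord_time_gt0 u0; apply: phiM; lra.
Qed.

Lemma norm_datum_le1 z : `|datum z : R| <= 1.
Proof. by rewrite ger0_norm ?datum_ge0 ?datum_le1. Qed.

(** By [sol_shift] the solution is constant along the direction (1, v, 0), so its derivative in that
    direction is zero. *)
Lemma sol_transport_eq t x v : differentiable (uncurry3 sol) (t, (x, v)) ->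
  derive1 (fun s => sol s x v) t + dot v (grad_x sol t x v) = 0.
Proof.
move=> ds; rewrite -derive_transport//; apply: derive_along_cst => h.
rewrite /uncurry3 /=.
have -> : h *: (1 : R) + t = t + h by rewrite addrC /GRing.scale/= mulr1.
by rewrite scaler0 add0r [_ + x]addrC sol_shift.
Qed.

Lemma sol_bounded_le (T : R) : exists M : R, forall t x v,
  t <= T -> dot x x <= 1 -> `|sol t x v| <= M.
Proof.
have [M M0 phiM] := causal_bounded T cphi.
exists (1 + M) => t x v tT x1; rewrite (le_trans (ler_normD _ _))// lerD ?norm_datum_le1//.
case: ifPn => v0; first by rewrite normr0.
rewrite normrM -[leRHS]mul1r ler_pM ?normr_ge0//.
  rewrite ger0_norm ?expR_ge0// -[leRHS]expR0 ler_expR.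
  by have := dot_ge0 v; lra.
by apply: phiM; have := exit_time_ge0 v x1; lra.
Qed.

Lemma diffuse_solution_sol : diffuse_solution cmu datum sol.
Proof.
have C1 := C1on_sol cphi cpsi dphi.
have int_region (z : Z) : interior_dom z -> C1_region z.
  move=> [z0 /unit_ballE z1]; apply: closed_dom_C1_region; split; first exact: ltW.
    by apply/closed_unit_ballE; rewrite ltW.
  by move=> [/unit_sphereE /= z1' _]; move: z1; rewrite z1' ltxx.
split.
- exact: within_continuous_sol.
- by move=> z /int_region/C1[].
- move=> e; exists ('D_e (uncurry3 sol)) => //.
  apply: continuous_in_subspaceT => z /set_mem/closed_dom_C1_region/C1[_].
  exact.
- move=> t x v t0 x1; apply: sol_transport_eq.
  by have [] := C1 (t, (x, v)) (int_region (t, (x, v)) (conj t0 x1)).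
- move=> x v /unit_ballE x1.
  have E : x + (- (0 : R)) *: v = x by rewrite oppr0 scale0r addr0.
  have := @sol_inside _ phi cphi 0 x v; rewrite !E; exact.
- by move=> t x v t0 xv; exact: sol_diffuse_sol.
- move=> T; have [M hM] := sol_bounded_le T; exists M => t x v tT [_ /closed_unit_ballE x1 _].
  exact: hM.
Qed.

End solution.

(** * Uniqueness *)

Section uniqueness.
Context {R : realType} (cmu : R).
Local Notation V3 := (measurableTypeR R * measurableTypeR R * measurableTypeR R)%type.
Local Notation Z := (R * (R3 R * R3 R))%type.
Hypothesis cmuE : cmu * (\int[leb3]_(u in half_space) flux_density u)%R = 1.
Implicit Types (t : R) (x v : R3 R).

Lemma is_derive_line (E : normedModType R) (G : E -> R) (z e : E) (s : R) :
  derivable G (s *: e + z) e ->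
  is_derive s (1 : R) (fun r => G (r *: e + z)) ('D_e G (s *: e + z)).
Proof.
move=> dG.
have H : (fun h : R => h^-1 *: (((fun r => G (r *: e + z)) \o shift s) (h *: (1 : R)) - G (s *: e + z))) =
    (fun h => h^-1 *: ((G \o shift (s *: e + z)) (h *: e) - G (s *: e + z))).
  by apply/funext => h /=; rewrite [h%:A]mulr1 scalerDl addrA.
by split; rewrite /derivable /derive H.
Qed.

(** The dependence on x remains, since an arbitrary solution is not known to be rotation
    invariant. *)
Definition incoming_flux (g : R -> R3 R -> R3 R -> R) t x : R :=
  cmu * \int[leb3]_(u in [set u | 0 < dot (normal x) u])
     (g t x u * Num.sqrt (maxwellian u) * dot (normal x) u).

Section representation.
Variables (g : R -> R3 R -> R3 R -> R).
Hypothesis sg : diffuse_solution cmu datum g.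

Lemma solution_along_characteristic t x v (a b : R) : a < b ->
  (forall s, a < s < b -> 0 < t + s /\ dot (x + s *: v) (x + s *: v) < 1) ->
  closed_dom (t + a, (x + a *: v, v)) -> closed_dom (t + b, (x + b *: v, v)) ->
  g (t + b) (x + b *: v) v = g (t + a) (x + a *: v) v.
Proof.
move=> ab int_s ca cb.
pose e : Z := (1, (v, 0)); pose z : Z := (t, (x, v)).
have cE (s : R) : s *: e + z = (t + s, (x + s *: v, v)).
  rewrite -[LHS]/((s *: (1 : R) + t, (s *: v + x, s *: (0 : R3 R) + v)) : Z).
  by rewrite [s%:A]mulr1 scaler0 add0r [s + t]addrC [_ + x]addrC.
have interior s : a < s < b -> interior_dom (s *: e + z).
  by move=> /int_s[h1 h2]; rewrite cE; split=> //=; exact/unit_ballE.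
have dh (s : R) : s \in `]a, b[ -> is_derive s (1 : R) (fun r => uncurry3 g (r *: e + z)) 0.
  rewrite in_itv/= => sab; have ds := sol_differentiable sg (interior s sab).
  have dd : derivable (uncurry3 g) (s *: e + z) e by exact: diff_derivable.
  have := is_derive_line dd.
  rewrite (_ : 'D_e (uncurry3 g) (s *: e + z) = 0)//.
  move: ds; rewrite cE => ds; rewrite /e derive_transport//.
  have [h1 h2] := int_s s sab.
  by apply: (sol_transport sg) => //; exact/unit_ballE.
have ch : {within `[a, b], continuous (fun r => uncurry3 g (r *: e + z))}.
  apply: (@within_continuous_comp _ _ _ _ _ (fun r : R => r *: e + z) _ _ _ (sol_continuous sg)).
    by move=> r; apply: cvgD; [exact: scalel_continuous|exact: cvg_cst].
  move=> s /=; rewrite in_itv/= => /andP[].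
  rewrite le_eqVlt => /predU1P[<- _|sa]; first by rewrite cE.
  rewrite le_eqVlt => /predU1P[->|sb]; first by rewrite cE.
  have [h1 h2] : interior_dom (s *: e + z) by apply: interior; rewrite sa.
  split; first exact: ltW.
    by apply/closed_unit_ballE; rewrite ltW//; exact/unit_ballE.
  by move=> [/unit_sphereE h3 _]; move/unit_ballE : h2; rewrite h3 ltxx.
have [c _] := MVT ab dh ch; rewrite mul0r => /eqP; rewrite subr_eq0 => /eqP.
by rewrite !cE.
Qed.

Lemma solution_before_exit t x v : 0 <= t -> dot x x <= 1 ->
  dot (x + (- t) *: v) (x + (- t) *: v) < 1 -> (0 < t \/ dot x x < 1) ->
  closed_dom (t, (x, v)) -> g t x v = datum (x + (- t) *: v, v).
Proof.
move=> t0 x1 foot1 tx cz.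
have [t0'|t0'] := ltP 0 t; last first.
  have t00 : t = 0 by apply/eqP; rewrite eq_le t0'.
  rewrite t00 oppr0 scale0r addr0; apply: (sol_initial sg); apply/unit_ballE.
  by move: foot1; rewrite t00 oppr0 scale0r addr0.
have := @solution_along_characteristic t x v (- t) 0.
rewrite oppr_lt0 scale0r !addr0 subrr => -> //.
- apply: (sol_initial sg); exact/unit_ballE.
- move=> s /andP[s1 s2]; split; first by lra.
  (* Convexity of |x + s v|^2 in s: the value is below 1 at s = -t and at most 1 at s = 0, hence
     below 1 strictly in between. *)
  move: foot1; rewrite dot_foot dot_linl !dot_linr (dotC v x) => foot1.
  have := dot_ge0 v; set d := dot v v in foot1 *; set p := dot x v in foot1 *.
  set q := dot x x in foot1 x1 * => d0.
  have : s * (s + t) * d <= 0 by rewrite mulr_le0_ge0// nmulr_rle0//; lra.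
  have : 0 < - s by lra.
  nra.
- split=> //=; first by apply/closed_unit_ballE; exact: ltW.
  by move=> [/unit_sphereE /= h _]; move: foot1; rewrite h ltxx.
Qed.

Lemma sphere_closed_dom t x v : 0 <= t -> dot x x = 1 -> dot x v != 0 ->
  closed_dom (t, (x, v)).
Proof.
move=> t0 x1 xv; split=> //=; first by apply/closed_unit_ballE; rewrite x1.
by move=> [_ /=]; rewrite normal_sphere// => /eqP; rewrite (negbTE xv).
Qed.

(** The initial condition speaks of the open ball only. On the sphere the value is recovered by
    continuity along the segment entering the ball backwards from x. *)
Lemma solution_initial_outgoing x v : dot x x = 1 -> 0 < dot x v ->
  g 0 x v = datum (x, v).
Proof.
move=> x1 xv.
have d0 : 0 < dot v v.
  by rewrite dot_gt0; apply/eqP => v0; move: xv; rewrite v0 dotE/= !mulr0 !addr0 ltxx.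
(* Half the chord: x - e v is the midpoint of the chord through x in direction v, so the segment up
   to x stays inside the ball. *)
pose e := dot x v / dot v v; have e0 : 0 < e by rewrite divr_gt0.
have eE : e * dot v v = dot x v by rewrite divfK// gt_eqF.
have inside (s : R) : - e <= s -> s < 0 -> dot (x + s *: v) (x + s *: v) < 1.
  move=> s1 s0; rewrite dot_linl !dot_linr (dotC v x) x1.
  have : 0 < - s * (dot x v + (dot x v + s * dot v v)).
    rewrite mulr_gt0 ?oppr_gt0// ltr_pwDl//.
    by rewrite -eE -mulrDl mulr_ge0 ?(ltW d0)//; lra.
  nra.
pose c (s : R) : Z := (0, (x + s *: v, v)).
have cc : continuous c.
  apply: (continuous_pair (p := fun=> 0 : R) (q := fun s : R => (x + s *: v, v))).
    by move=> y; exact: cvg_cst.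
  apply: (continuous_pair (p := fun s : R => x + s *: v) (q := fun=> v)); last by move=> y; exact: cvg_cst.
  by move=> y; apply: cvgD; [exact: cvg_cst|exact: scalel_continuous].
pose k (s : R) : R := uncurry3 g (c s) - datum (x + s *: v, v).
have k0 (s : R) : - e <= s -> s < 0 -> k s = 0.
  move=> s1 s0; rewrite /k /uncurry3 /= (sol_initial sg) ?subrr//.
  by apply/unit_ballE; exact: inside.
have ck : {within `[- e, 0], continuous k}.
  have cA s : `[- e, 0]%classic s -> closed_dom (c s).
    rewrite /= in_itv/= => /andP[s1]; rewrite le_eqVlt => /predU1P[->|s0].
      by rewrite /c scale0r addr0; apply: sphere_closed_dom => //; rewrite gt_eqF.
    have := inside s s1 s0 => ins; split=> //=.
      by apply/closed_unit_ballE; exact: ltW.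
    by move=> [/unit_sphereE /= h _]; move: ins; rewrite h ltxx.
  have := within_continuous_comp cc cA (sol_continuous sg).
  move=> /subspace_continuousP cg; apply/subspace_continuousP => s sA.
  apply: cvgB; first exact: cg.
  apply: cvg_within_filter.
  have [dd _] := bump_algebra_derive (@bump_algebra_datum R).
  apply: (@continuous_comp _ _ _ (fun s : R => (x + s *: v, v)) (@datum R)).
    apply: (continuous_pair (p := fun s : R => x + s *: v) (q := fun=> v)); last by move=> y; exact: cvg_cst.
    by move=> y; apply: cvgD; [exact: cvg_cst|exact: scalel_continuous].
  exact: differentiable_continuous.
have dk (s : R) : s \in `]- e, 0[ -> is_derive s (1 : R) k 0.
  move=> sI; apply: (near_eq_is_derive (f := cst 0)).
  have : \forall r \near s, r \in `]- e, 0[ by exact: near_in_itvoo.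
  apply: filterS => r; rewrite in_itv/= => /andP[r1 r2].
  by rewrite k0// ltW.
have ne0 : - e < 0 by rewrite oppr_lt0.
have [r _] := MVT ne0 dk ck.
rewrite mul0r (k0 (- e))// subr0 /k /c /uncurry3 /= scale0r addr0.
by move=> /eqP; rewrite subr_eq0 => /eqP.
Qed.

Lemma exit_time_gt0 x v : v != 0 -> dot x x <= 1 -> (dot x x < 1 \/ 0 < dot x v) ->
  0 < exit_time x v.
Proof.
move=> v0 x1 xv; rewrite divr_gt0 ?dot_gt0//.
case: xv => [x1'|xv]; last by rewrite ltr_wpDr ?sqrtr_ge0.
rewrite -ltrBlDl sub0r (le_lt_trans (ler_norm _))// normrN -sqrtr_sqr ltr_sqrt /disc.
  by rewrite ltrDl mulr_gt0 ?dot_gt0// subr_gt0.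
by rewrite ltr_wpDl ?sqr_ge0// mulr_gt0 ?dot_gt0// subr_gt0.
Qed.

Lemma disc_gt0 x v : v != 0 -> dot x x <= 1 -> (dot x x < 1 \/ 0 < dot x v) ->
  0 < disc x v.
Proof.
move=> v0 x1 [x1'|xv]; rewrite /disc.
  by rewrite ltr_wpDl ?sqr_ge0// mulr_gt0 ?dot_gt0// subr_gt0.
by rewrite ltr_wpDr ?exprn_gt0// mulr_ge0 ?dot_ge0// subr_ge0.
Qed.

Lemma solution_incoming t x v : 0 <= t -> dot x x = 1 -> dot x v < 0 ->
  g t x v = expR (- dot v v / 4) * incoming_flux g t x.
Proof.
move=> t0 x1 xv; rewrite (sol_diffuse sg t0); last first.
  by split; [exact/unit_sphereE|rewrite /= normal_sphere].
by rewrite sqrt_maxwellian /incoming_flux mulrCA mulrA.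
Qed.

Lemma solution_after_exit t x v : v != 0 -> dot x x <= 1 ->
  (dot x x < 1 \/ 0 < dot x v) -> exit_time x v <= t ->
  closed_dom (t, (x, v)) ->
  g t x v = expR (- dot v v / 4) *
    incoming_flux g (t - exit_time x v) (x + (- exit_time x v) *: v).
Proof.
move=> v0 x1 xv tt cz.
have d0 := disc_gt0 v0 x1 xv; have e0 := exit_time_gt0 v0 x1 xv.
have [y1 yv] := foot_on_sphere (ltW d0) v0.
set e := exit_time x v in e0 tt y1 yv *; set y := x + (- e) *: v in y1 yv *.
have yv0 : dot y v < 0 by rewrite yv oppr_lt0 sqrtr_gt0.
have te0 : 0 <= t - e by rewrite subr_ge0.
rewrite -solution_incoming//.
have := @solution_along_characteristic t x v (- e) 0.
rewrite oppr_lt0 scale0r !addr0 => -> //.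
- move=> s /andP[s1 s2]; split; first by lra.
  (* Seen from the entry point y, with r = s + e, the squared norm is 1 + 2 r (y . v) + r^2 |v|^2.
     It is below 1 because r |v|^2 < e |v|^2 <= -2 (y . v). *)
  have -> : x + s *: v = y + (s + e) *: v.
    by rewrite /y !R3_linE /=; congr (_, _, _); ring.
  have -> : dot (y + (s + e) *: v) (y + (s + e) *: v) =
      dot y y + 2 * (s + e) * dot y v + (s + e) ^+ 2 * dot v v.
    by rewrite R3_linE !dotE /=; ring.
  rewrite y1 yv.
  have xv' : dot x v <= Num.sqrt (disc x v).
    by rewrite (le_trans (ler_norm _))// -sqrtr_sqr ler_wsqrtr// disc_ge.
  have ed : e * dot v v = dot x v + Num.sqrt (disc x v) by rewrite divfK// dot_eq0.
  have : (s + e) * dot v v < e * dot v v by rewrite ltr_pM2r ?dot_gt0//; lra.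
  have : 0 < s + e by lra.
  rewrite ed; nra.
- by apply: sphere_closed_dom => //; rewrite lt_eqF.
Qed.

(** The boundary condition at the incoming velocity v = -x expresses the flux as exp (1/4) times a
    value of the solution, which is bounded by assumption. *)
Lemma incoming_flux_bounded (T : R) : exists M : R, forall t x,
  0 <= t -> t <= T -> dot x x = 1 -> `|incoming_flux g t x| <= M.
Proof.
have [M hM] := sol_bounded sg T; exists (M * expR (4^-1)) => t x t0 tT x1.
have xx : dot x (- x) = - 1 by rewrite -x1 !dotE/=; ring.
have nxx : dot (- x) (- x) = 1 by rewrite -x1 !dotE/=; ring.
have xx0 : dot x (- x) < 0 by rewrite xx ltrN10.
have := hM t x (- x) tT (sphere_closed_dom t0 x1 _); rewrite lt_eqF// => /(_ isT).
rewrite (solution_incoming t0 x1 xx0) nxx normrM (ger0_norm (expR_ge0 _)).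
by rewrite mulNr mul1r expRN mulrC ler_pdivrMr ?expR_gt0.
Qed.

End representation.

(** Traced backwards, each outgoing value is either a value of the datum, which cancels in the
    difference, or an earlier flux at the other end of the chord. That end is another boundary
    point, hence the supremum over x as well. *)
Lemma incoming_fluxB_contraction (g f : R -> R3 R -> R3 R -> R) (T : R) :
  diffuse_solution cmu datum g -> diffuse_solution cmu datum f ->
  exists k : R, 0 <= k < 1 /\ forall m,
   (forall t x, 0 <= t -> t <= T -> dot x x = 1 ->
     `|incoming_flux g t x - incoming_flux f t x| <= m) ->
   (forall t x, 0 <= t -> t <= T -> dot x x = 1 ->
     `|incoming_flux g t x - incoming_flux f t x| <= k * m).
Proof.
move=> sg sf; have [k [k01 hk]] := flux_contraction cmuE T.
exists k; split=> // m hm t x t0 tT x1.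
have [Tr rT Tx] := exists_rotation x1.
pose G (h : R -> R3 R -> R3 R -> R) (w : V3) := h t x (Tr w) * expR (dot w w / 4).
have mG h : diffuse_solution cmu datum h -> measurable_fun half_space (G h).
  move=> sh; apply: measurable_funM; last first.
    by apply: continuous_measurable_R3T measurable_half_space; exact: continuous_expR_dot.
  have mD : measurable ([set u | 0 < dot x u] : set V3).
    by apply: measurable_open_R3; exact: open_outgoing.
  apply: (measurable_comp mD (f := h t x)) => //.
  - by move=> _ [w Hw <-]; rewrite /= (rotation_dot_north w rT Tx).
  - exact: measurable_outgoing (sol_continuous sh).
  - by apply: measurable_funS (rotation_measurable rT).
have fluxE h : diffuse_solution cmu datum h -> incoming_flux h t x = flux cmu (G h).
  by move=> sh; exact: (diffuse_flux cmu rT Tx x1 (measurable_outgoing t0 x1 (sol_continuous sh))).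
have rep h w : diffuse_solution cmu datum h -> half_space w ->
    (t < chord_time w -> G h w = datum (north_pole + (- t) *: w, w) * expR (dot w w / 4)) /\
    (chord_time w <= t ->
      G h w = incoming_flux h (t - chord_time w) (x + (- chord_time w) *: Tr w)).
  move=> sh Hw; have xw : dot x (Tr w) = w.2 by exact: rotation_dot_north.
  have tE : exit_time x (Tr w) = chord_time w by exact: exit_time_rotation.
  have w0 : Tr w != 0 by rewrite -dot_gt0 (rotation_dot rT) half_space_dot.
  have xw0 : 0 < dot x (Tr w) by rewrite xw.
  have cz : closed_dom (t, (x, Tr w)) by apply: sphere_closed_dom => //; rewrite gt_eqF.
  have x1' : dot x x <= 1 by rewrite x1.
  split=> tw; last first.
    rewrite /G (solution_after_exit sh w0 x1' (or_intror xw0))// ?tE// (rotation_dot rT).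
    by rewrite mulrAC -expRD mulNr addNr expR0 mul1r.
  rewrite /G; congr (_ * _).
  have -> : datum (north_pole + (- t) *: w, w) = datum (x + (- t) *: Tr w, Tr w).
    by rewrite -Tx -(rotation_linear rT) /datum/= !(rotation_dot rT).
  have [t0'|t0'] := ltP 0 t.
    apply: (solution_before_exit sh) => //; last by left.
    rewrite dot_foot x1 xw (rotation_dot rT).
    have : t * dot w w < 2 * w.2 by move: tw; rewrite /chord_time ltr_pdivlMr// half_space_dot.
    nra.
  have -> : t = 0 by apply/eqP; rewrite eq_le t0'.
  by rewrite oppr0 scale0r addr0; exact: (solution_initial_outgoing sh).
have foot_sphere w : half_space w ->
    dot (x + (- chord_time w) *: Tr w) (x + (- chord_time w) *: Tr w) = 1.
  move=> Hw; rewrite dot_foot x1 (rotation_dot_north w rT Tx) (rotation_dot rT).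
  rewrite /chord_time; field; rewrite gt_eqF// half_space_dot//.
have bG h : diffuse_solution cmu datum h -> exists M, forall w, half_space w -> `|G h w| <= M.
  move=> sh; have [M hM] := incoming_flux_bounded sh T.
  exists (Num.max (expR 1) M) => w Hw; have [h1 h2] := rep h w sh Hw.
  rewrite le_max; have [tw|tw] := ltP t (chord_time w).
    by rewrite h1// source_integrand_bound.
  rewrite h2// hM ?orbT// ?foot_sphere// ?subr_ge0//.
  by have := chord_time_gt0 Hw; lra.
have [Mg hMg] := bG g sg; have [Mf hMf] := bG f sf.
rewrite !fluxE// -(fluxB cmuE (mG g sg) (mG f sf) hMg hMf).
have m0 : 0 <= m by apply: le_trans (hm t x t0 tT x1); exact: normr_ge0.
apply: hk.
- exact: measurable_funB (mG g sg) (mG f sf).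
- move=> w Hw; have [g1 g2] := rep g w sg Hw; have [f1 f2] := rep f w sf Hw.
  have [tw|tw] := ltP t (chord_time w); first by rewrite g1// f1// subrr normr0.
  rewrite g2// f2// hm// ?foot_sphere// ?subr_ge0//.
  by have := chord_time_gt0 Hw; lra.
- move=> w Hw Tw; have [g1 _] := rep g w sg Hw; have [f1 _] := rep f w sf Hw.
  by rewrite g1 ?f1 ?subrr// (le_lt_trans tT).
Qed.

Lemma incoming_flux_unique (g f : R -> R3 R -> R3 R -> R) t x :
  diffuse_solution cmu datum g -> diffuse_solution cmu datum f ->
  0 <= t -> dot x x = 1 -> incoming_flux g t x = incoming_flux f t x.
Proof.
move=> sg sf t0 x1.
have [k [k01 hk]] := incoming_fluxB_contraction t sg sf.
have [Mg hMg] := incoming_flux_bounded sg t.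
have [Mf hMf] := incoming_flux_bounded sf t.
pose M := Mg + Mf.
have step n : forall s y, 0 <= s -> s <= t -> dot y y = 1 ->
    `|incoming_flux g s y - incoming_flux f s y| <= M * k ^+ n.
  elim: n => [s y s0 st y1|n IH].
    by rewrite expr0 mulr1 (le_trans (ler_normB _ _))// lerD ?hMg ?hMf.
  by rewrite exprS mulrCA; exact: hk.
have M0 : 0 <= M.
  by have := step 0%N t x t0 (lexx _) x1; rewrite expr0 mulr1; exact: le_trans.
apply/eqP; rewrite -subr_eq0 -normr_le0; apply/ler_addgt0Pr => e e0.
rewrite add0r; have [n hn] := exists_small_geometric k01 M0 e0.
exact: le_trans (step n t x t0 (lexx _) x1) (ltW hn).
Qed.

Theorem diffuse_solution_unique (g f : R -> R3 R -> R3 R -> R) :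
  diffuse_solution cmu datum g -> diffuse_solution cmu datum f ->
  forall t x v, closed_dom (t, (x, v)) -> g t x v = f t x v.
Proof.
move=> sg sf t x v cz; have [/= t0 /closed_unit_ballE x1 ng] := cz.
have [v0|v0] := eqVneq v 0.
  have x1' : dot x x < 1.
    rewrite lt_neqAle x1 andbT; apply/eqP => xx1; apply: ng; split=> /=.
      exact/unit_sphereE.
    by rewrite v0 dotE/= !mulr0 !addr0.
  have foot1 : dot (x + (- t) *: v) (x + (- t) *: v) < 1 by rewrite v0 scaler0 addr0.
  by rewrite (solution_before_exit sg)// ?(solution_before_exit sf)//; right.
have [xv|] := pselect (dot x x < 1 \/ 0 < dot x v); last first.
  move=> /not_orP[/negP + /negP]; rewrite -!leNgt => x1' xv.
  have {x1 x1'}x1 : dot x x = 1 by apply/eqP; rewrite eq_le x1.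
  have {}xv : dot x v < 0.
    rewrite lt_neqAle xv andbT; apply/eqP => xv0; apply: ng; split=> /=.
      exact/unit_sphereE.
    by rewrite normal_sphere.
  by rewrite (solution_incoming sg)// (solution_incoming sf)// (incoming_flux_unique sg sf).
have [tt|tt] := leP (exit_time x v) t.
  rewrite (solution_after_exit sg)// (solution_after_exit sf)//; congr (_ * _).
  apply: (incoming_flux_unique sg sf); first by rewrite subr_ge0.
  by have [] := foot_on_sphere (ltW (disc_gt0 v0 x1 xv)) v0.
have [t0'|t0'] := ltP 0 t; last first.
  have {t0 t0' tt cz}-> : t = 0 by apply/eqP; rewrite eq_le t0'.
  have [x1'|x1'] := ltP (dot x x) 1.
    by rewrite (sol_initial sg) ?(sol_initial sf)//; exact/unit_ballE.
  have {}x1 : dot x x = 1 by apply/eqP; rewrite eq_le x1.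
  have {}xv : 0 < dot x v by case: xv => //; rewrite x1 ltxx.
  by rewrite (solution_initial_outgoing sg)// (solution_initial_outgoing sf).
have foot1 : dot (x + (- t) *: v) (x + (- t) *: v) < 1.
  have d0 := disc_gt0 v0 x1 xv.
  have [y1 yv] := foot_on_sphere (ltW d0) v0.
  have e0 := exit_time_gt0 v0 x1 xv.
  have ed : exit_time x v * dot v v = dot x v + Num.sqrt (disc x v) by rewrite divfK// dot_eq0.
  have xv' : dot x v <= Num.sqrt (disc x v).
    by rewrite (le_trans (ler_norm _))// -sqrtr_sqr ler_wsqrtr// disc_ge.
  move: y1; rewrite !dot_foot; have := dot_gt0 v; rewrite v0 => dv.
  move: e0 tt ed xv'; set e := exit_time x v; set s := Num.sqrt _; set d := dot v v in dv *.
  move=> e0 tt ed xv' y1.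
  (* This product is 1 - |x - t v|^2 factored over its two roots in t: e, which exceeds t, and a
     root that is at most 0. *)
  have : 0 < (e - t) * ((s - dot x v) + t * d).
    by rewrite mulr_gt0 ?subr_gt0// ltr_wpDl ?subr_ge0// mulr_gt0.
  have -> : (e - t) * ((s - dot x v) + t * d) =
      (dot x x - 2 * e * dot x v + e ^+ 2 * d) - (dot x x - 2 * t * dot x v + t ^+ 2 * d).
    by rewrite (_ : s = e * d - dot x v); [ring|rewrite ed; ring].
  by rewrite y1 subr_gt0.
by rewrite (solution_before_exit sg)// ?(solution_before_exit sf)//; left.
Qed.

End uniqueness.

(** * Divergence of the boundary integral *)

Section divergence.
Context {R : realType}.
Local Notation V3 := (measurableTypeR R * measurableTypeR R * measurableTypeR R)%type.
Implicit Types (t : R) (x v : R3 R).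

Let lower_half : set V3 := [set w | w.2 < 0].

Let inverse_height (w : V3) : \bar R := (maxwellian (w : R3 R) / `|w.2|)%:E.

Let open_lower_half : open (lower_half : set (R3 R)).
Proof.
apply: (@open_comp _ _ (fun u : R3 R => u.2) [set r | r < 0]); last exact: open_lt.
by move=> u _; exact: cvg_snd.
Qed.

Let slab (a b : R) : set V3 := (`[0, 1] `*` `[0, 1]) `*` `[a, b[.

Let measurable_slab a b : measurable (slab a b).
Proof. by apply: measurableX; [apply: measurableX|]; exact: measurable_itv. Qed.

Let measurable_inverse_height : measurable_fun lower_half inverse_height.
Proof.
apply/measurable_EFinP; apply: continuous_measurable_R3; first exact: open_lower_half.
move=> w w0; apply: cvgM; first exact: continuous_maxwellian.
apply: cvgV; first by rewrite normr_eq0 lt_eqF.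
by apply: cvg_norm; exact: cvg_snd.
Qed.

Let slab_lower a b : b <= 0 -> slab a b `<=` lower_half.
Proof.
by move=> b0 [[x y] z] [_ /=]; rewrite ?in_itv/= => /andP[_ zb]; rewrite /lower_half/= (lt_le_trans zb).
Qed.

Let inverse_height_ge0 w : (0 <= inverse_height w)%E.
Proof. by rewrite lee_fin divr_ge0// ltW// maxwellian_gt0. Qed.

Let half n : R := 2^-1 ^+ n.

Let half_gt0 n : 0 < half n.
Proof. by rewrite exprn_gt0. Qed.

Let halfS n : half n = half n.+1 + half n.+1.
Proof. by rewrite /half exprS; field. Qed.

Let half_le1 n : half n <= 1.
Proof. by rewrite exprn_ile1// invr_le1// ?ler1n// unitfE. Qed.

(** On the slab 1 / |w.2| >= 2^n, the volume is 2^(-n-1), and |w|^2 <= 3. The bound does not depend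
    on n, which is the logarithmic divergence. *)
Let integral_dyadic_slab n :
  ((expR (- 3 / 2) / 2)%:E <= \int[leb3]_(w in slab (- half n) (- half n.+1)) inverse_height w)%E.
Proof.
have h0 := half_gt0 n; have h1 := half_gt0 n.+1; have hS := halfS n; have hle := half_le1 n.
have m : leb3 (slab (- half n) (- half n.+1)) = (half n.+1)%:E.
  rewrite /slab /leb3 product_measure1E; [|exact: measurableX|exact: measurable_itv].
  rewrite /= /leb2 product_measure1E; [|exact: measurable_itv|exact: measurable_itv].
  rewrite /= !lebesgue_measure_itv/= !lte_fin ltr01 ltrN2 ifT; last by lra.
  by rewrite -!EFinD -!EFinM; congr (_%:E); lra.
have -> : ((expR (- 3 / 2) / 2)%:E = (expR (- 3 / 2) / half n)%:E * leb3 (slab (- half n) (- half n.+1)))%E.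
  by rewrite m -EFinM; congr (_%:E); rewrite hS; field; lra.
rewrite -integral_cst//.
apply: ge0_subset_le_integral => //.
  by move=> w _; rewrite lee_fin divr_ge0 ?expR_ge0// ltW.
move=> w sw; split=> //; rewrite lee_fin.
case: w sw => [[x y] z]; rewrite /slab/= !in_itv/= => -[[/andP[? ?] /andP[? ?]] /andP[z1 z2]].
have z0 : z < 0 by lra.
rewrite ler_pM ?expR_ge0 ?invr_ge0 ?(ltW h0)//.
  by rewrite maxwellianE ler_expR dotE/=; nra.
by rewrite lef_pV2 ?posrE ?normr_gt0 ?lt_eqF// ltr0_norm//; lra.
Qed.

Let integral_slab n :
  ((n%:R * (expR (- 3 / 2) / 2))%:E <= \int[leb3]_(w in slab (- 1) (- half n)) inverse_height w)%E.
Proof.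
elim: n => [|n IH]; first by rewrite mul0r integral_ge0// => w _.
have h0 := half_gt0 n; have h1 := half_gt0 n.+1; have hS := halfS n; have hle := half_le1 n.
have U : slab (- 1) (- half n.+1) = slab (- 1) (- half n) `|` slab (- half n) (- half n.+1).
  apply/seteqP; split=> [[[x y] z]|[[x y] z]]; rewrite /slab/= !in_itv/=.
    move=> [? /andP[z1 z2]]; have [zn|zn] := ltP z (- half n); [left|right]; split=> //.
      by rewrite z1.
  by move=> [|] [? /andP[z1 z2]]; split=> //; apply/andP; split; lra.
rewrite U ge0_integral_setU//.
- by rewrite -natr1 mulrDl mul1r EFinD leeD.
- apply: measurable_funS measurable_inverse_height.
    exact: measurable_open_R3.
  by rewrite -U; apply: slab_lower; lra.
- apply/disj_setPS => -[[x y] z] []; rewrite /slab/= !in_itv/=.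
  by move=> [_ /andP[_ h]] [_ /andP[h' _]]; move: (lt_le_trans h h'); rewrite ltxx.
Qed.

Lemma integral_inverse_height :
  (\int[leb3]_(w in lower_half) inverse_height w = +oo)%E.
Proof.
apply/eqyP => r r0.
pose c : R := expR (- 3 / 2) / 2; have c0 : 0 < c by rewrite divr_gt0 ?expR_gt0.
have [n rn] : exists n : nat, r / c < n%:R.
  by exists (Num.Def.truncn (r / c)).+1; exact: truncnS_gt.
apply: (@le_trans _ _ (n%:R * c)%:E).
  by rewrite lee_fin -ler_pdivrMr// ltW.
apply: (le_trans (integral_slab n)); apply: ge0_subset_le_integral => //.
by move=> w sw; split=> //; apply: slab_lower sw; have := half_gt0 n; lra.
Qed.

Lemma integral_inverse_incoming (a : R) x : 0 < a -> dot x x = 1 ->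
  (\int[leb3]_(v in [set v : V3 | (dot x v < 0)%R])
     (a * (maxwellian (v : R3 R) / `|dot x v|))%:E = +oo)%E.
Proof.
move=> a0 x1; have [T rT Tx] := exists_rotation x1.
have oD : open [set v : R3 R | dot x v < 0].
  apply: (@open_comp _ _ (fun u : R3 R => dot x u) [set r | r < 0]); last exact: open_lt.
  by move=> u _; apply: continuous_dot => y; [exact: cvg_cst|exact: cvg_id].
have mD : measurable ([set v | dot x v < 0] : set V3) by exact: measurable_open_R3.
have mf : measurable_fun ([set v | dot x v < 0] : set V3)
    (fun v : V3 => (a * (maxwellian (v : R3 R) / `|dot x v|))%:E).
  apply/measurable_EFinP; apply: continuous_measurable_R3 => // v /= v0.
  apply: cvgM; first exact: cvg_cst.
  apply: cvgM; first exact: continuous_maxwellian.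
  apply: cvgV; first by rewrite normr_eq0 lt_eqF.
  by apply: cvg_norm; apply: continuous_dot => y; [exact: cvg_cst|exact: cvg_id].
rewrite (integral_rotation rT mD mf).
have -> : T @^-1` [set v : R3 R | dot x v < 0] = lower_half.
  by apply/seteqP; split=> u; rewrite /preimage/= (rotation_dot_north u rT Tx).
under eq_integral => u _
  do rewrite (rotation_dot_north u rT Tx) !maxwellianE (rotation_dot rT) -maxwellianE EFinM.
rewrite ge0_integralZl//.
- by rewrite integral_inverse_height gt0_muley ?lte_fin.
- exact: measurable_open_R3.
- by move=> w _; exact: inverse_height_ge0.
- by rewrite lee_fin ltW.
Qed.

Lemma sphere_point_unit (a : R * R) : dot (sphere_point a) (sphere_point a) = 1.
Proof.
rewrite dotE /sphere_point/= -!expr2 !exprMn -mulrDr cos2Dsin2 mulr1.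
by rewrite addrC cos2Dsin2.
Qed.

Lemma sphere_integral_infinite (h : R3 R -> \bar R) :
  (forall x, dot x x = 1 -> h x = +oo%E) -> sphere_integral h = +oo%E.
Proof.
move=> hoo; rewrite /sphere_integral; apply/eqP; rewrite -leye_eq.
have p0 := @pi_gt0 R.
(* At the poles the area element is 0 and annihilates the infinite value, so the integral is bounded
   below on a box of positive measure where the sine is positive. *)
pose B : set (measurableTypeR R * measurableTypeR R) := `[pi / 4, pi / 2] `*` `[0, pi].
have mB : measurable B by apply: measurableX; exact: measurable_itv.
have sinp (a : R * R) : B a -> 0 < sin a.1.
  move=> [] /=; rewrite !in_itv/= => /andP[h1 h2] _; apply: sin_gt0_pi.
  by apply/andP; split; lra.
have BI (a : R * R) : B a -> (`[0%R, pi%R] `*` `[0%R, (2 * pi)%R]) a.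
  by move=> [] /=; rewrite !in_itv/= => /andP[h1 h2] /andP[h3 h4]; split; apply/andP; split; lra.
have -> : (+oo = \int[leb2]_(a in B) cst +oo a)%E.
  have B0 : (0 < leb2 B)%E.
    rewrite /leb2 product_measure1E; [|exact: measurable_itv|exact: measurable_itv].
    rewrite /= !lebesgue_measure_itv/= !lte_fin p0 ifT; last by lra.
    by rewrite -!EFinD -EFinM lte_fin mulr_gt0//; lra.
  by rewrite integral_cst// gt0_mulye.
apply: ge0_subset_le_integral.
- by move=> a _; exact: leey.
- move=> a [] /=; rewrite !in_itv/= => ha _; rewrite hoo ?sphere_point_unit//.
  by rewrite mule_ge0// lee_fin sin_ge0_pi.
- move=> a Ba; split; first exact: BI.
  by rewrite /= hoo ?sphere_point_unit// gt0_mulye// lte_fin sinp.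
Qed.

End divergence.

Lemma derive_line (R : realType) (E : normedModType R) (F : E -> R) (x e : E) :
  'D_e F x = 'D_(1 : R) (fun h : R => F (h *: e + x)) (0 : R).
Proof.
rewrite /derive.
have -> // : (fun h : R => h^-1 *: ((F \o shift x) (h *: e) - F x)) =
  (fun h : R => h^-1 *: (((fun h : R => F (h *: e + x)) \o shift (0 : R)) (h *: (1 : R)) - F (0 *: e + x))).
by apply/funext => h /=; rewrite [h%:A]mulr1 addr0 scale0r add0r.
Qed.

(** * The space gradient at incoming boundary points *)

Section boundary_gradient.
Context {R : realType}.
Local Notation V3 := (measurableTypeR R * measurableTypeR R * measurableTypeR R)%type.
Local Notation Z := (R * (R3 R * R3 R))%type.
Variables (phi psi : R -> R).
Hypotheses (cphi : causal phi) (cpsi : causal psi).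
Hypothesis (dphi : forall t : R, is_derive t (1 : R) phi (psi t)).
Implicit Types (t : R) (x v : R3 R).
Local Notation sol := (sol phi).

(** Makes the filter of interior neighbourhoods proper, so that the limit defining [trace] is
    unique. *)
Lemma closure_unit_ball x : dot x x = 1 -> closure unit_ball x.
Proof.
move=> x1 B Bx.
have : nbhs (1 : R) (fun r : R => B (r *: x)).
  by apply: (@scalel_continuous R (R3 R) x (1 : R)); rewrite scale1r.
move=> /nbhs_ballP[e /= e0 he].
pose r : R := 1 - Num.min (e / 2) 2^-1.
have m0 : 0 < Num.min (e / 2) 2^-1 by rewrite lt_min divr_gt0//= invr_gt0.
have m1 : Num.min (e / 2) 2^-1 <= 2^-1 by rewrite ge_min lexx orbT.
have me : Num.min (e / 2) 2^-1 <= e / 2 by rewrite ge_min lexx.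
exists (r *: x); split.
  apply/unit_ballE; have -> : dot (r *: x) (r *: x) = r ^+ 2 * dot x x.
    by rewrite -[r *: x]add0r R3_linE !dotE/=; ring.
  by rewrite x1 mulr1 /r; move: m0 m1; set m := Num.min _ _; nra.
apply: he; rewrite /ball/= /r opprB addrC subrK gtr0_norm//.
by move: me e0; set m := Num.min _ _; lra.
Qed.

Lemma trace_continuous (g : R3 R -> R) x : dot x x = 1 -> {for x, continuous g} ->
  lim (g y @[y --> within unit_ball (nbhs x)]) = g x.
Proof.
move=> x1 cg; have := within_nbhs_proper (closure_unit_ball x1) => PF.
apply: cvg_lim; first exact: Rhausdorff.
exact: cvg_within_filter.
Qed.

(** The formula for [sol] makes sense beyond the sphere and is C^1 around every incoming point, so
    the trace is the value of the gradient there. *)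
Lemma bdry_grad_x_sol t x v : 0 <= t -> dot x x = 1 -> dot x v < 0 ->
  bdry_grad_x sol t x v = grad_x sol t x v.
Proof.
move=> t0 x1 xv.
have zC : C1_region (t, (x, v)).
  by apply: closed_dom_C1_region; apply: sphere_closed_dom => //; rewrite lt_eqF.
have [_ C1] := C1on_sol cphi cpsi dphi zC.
have slice (G : Z -> R) : {for (t, (x, v)), continuous G} ->
    {for x, continuous (fun y => G (t, (y, v)))}.
  move=> cG; apply: (@continuous_comp _ _ _ (fun y : R3 R => (t, (y, v)) : Z) G); last exact: cG.
  apply: (continuous_pair (p := fun=> t) (q := fun y => (y, v))).
    by move=> y; exact: cvg_cst.
  by apply: continuous_pair => y; [exact: cvg_id|exact: cvg_cst].
have cg (e : R3 R) : {for x, continuous (fun y => 'D_e (fun y => sol t y v) y)}.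
  have h1 := C1 ((0, (e, 0)) : Z); have h2 := slice _ h1.
  have E : (fun y : R3 R => derive (fun y => sol t y v) y e) =
      (fun y : R3 R => derive (uncurry3 sol) (t, (y, v)) ((0, (e, 0)) : Z)).
    by apply/funext => y; rewrite derive_uncurry3_x.
  by rewrite E; exact: h2.
rewrite /bdry_grad_x /trace /grad_x /grad/=.
have T (e : R3 R) := trace_continuous x1 (cg e).
by congr (_, _, _); exact: T.
Qed.

Lemma derive_radial_sol t x v : 0 <= t -> dot x x = 1 -> dot x v < 0 ->
  'D_x (fun y => sol t y v) x = - (expR (- dot v v / 4) * psi t / dot x v).
Proof.
move=> t0 x1 xv.
have v0 : v != 0 by apply/eqP => v0; move: xv; rewrite v0 dotE/= !mulr0 !addr0 ltxx.
have d0 : 0 < dot v v by rewrite dot_gt0.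
set d := dot v v in d0 *; set p := dot x v in xv *; set E := expR _.
(* Along h |-> (1 + h) x these are the discriminant and the exit time as functions of h; the term
   with coefficient 0 only matches the shape of [is_derive_quadratic]. Differentiating at 0 gives T'
   = 1 / (x . v). *)
pose disc_h (h : R) := p ^+ 2 + (2 * p ^+ 2 - 2 * d) * h - (d - p ^+ 2) * h ^+ 2.
pose T (h : R) := (p + p * h - 0 * h ^+ 2 + Num.sqrt (disc_h h)) / d.
have solE : {near (0 : R), (fun h => E * phi (t - T h)) =1 (fun h => sol t (h *: x + x) v)}.
  have : \forall h \near (0 : R), - 10^-1 < h by apply: lt_nbhsr; lra.
  apply: filterS => h h1; rewrite /sol (negbTE v0).
  have -> : h *: x + x = x + h *: x by rewrite addrC.
  have xh : dot (x + h *: x) (x + h *: x) = (1 + h) ^+ 2.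
    by rewrite dot_linl !dot_linr x1; ring.
  have xhv : dot (x + h *: x) v = p + p * h by rewrite dot_linl -/p; ring.
  rewrite datum_eq0 ?add0r; last first.
    rewrite /= dot_foot xh xhv -/d /radius2.
    have : 0 <= t * (- p) * (1 + h) by rewrite !mulr_ge0//; lra.
    have : 0 <= t ^+ 2 * d by rewrite mulr_ge0 ?sqr_ge0// ltW.
    nra.
  congr (_ * phi (_ - _)); rewrite /exit_time xhv -/d /T mul0r subr0; congr ((_ + Num.sqrt _) / _).
  by rewrite /disc xh xhv -/d /disc_h; ring.
have disc0 : disc_h 0 = p ^+ 2 by rewrite /disc_h; ring.
have sqrt0 : Num.sqrt (disc_h 0) = - p by rewrite disc0 sqrtr_sqr ltr0_norm.
have T0 : T 0 = 0 by rewrite /T sqrt0; field; rewrite gt_eqF.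
have pn0 : p != 0 by rewrite lt_eqF.
have ddisc : is_derive (0 : R) (1 : R) disc_h (2 * p ^+ 2 - 2 * d).
  by have := is_derive_quadratic (p ^+ 2) (2 * p ^+ 2 - 2 * d) (d - p ^+ 2) 0; rewrite mulr0 subr0.
have dsqrt : is_derive (0 : R) (1 : R) (Num.sqrt \o disc_h) ((2 * - p)^-1 * (2 * p ^+ 2 - 2 * d)).
  apply: is_derive1_comp => //; rewrite -sqrt0; apply: is_derive1_sqrt.
  by rewrite disc0 exprn_even_gt0.
have dlin : is_derive (0 : R) (1 : R) (fun h => p + p * h - 0 * h ^+ 2) p.
  by have := is_derive_quadratic p p 0 0; rewrite mulr0 subr0.
have dT : is_derive (0 : R) (1 : R) T (p^-1).
  have h := is_deriveZ d^-1 (is_deriveD dlin dsqrt).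
  rewrite (_ : T = d^-1 *: ((fun h => p + p * h - 0 * h ^+ 2) + (Num.sqrt \o disc_h))); last first.
    by apply/funext => r; rewrite /T mulrC.
  apply: (is_derive_eq h); rewrite /GRing.scale/=; field.
  by rewrite pn0 gt_eqF.
have dshift : is_derive (0 : R) (1 : R) (fun h => t - T h) (- p^-1).
  have h := is_deriveB (is_derive_cst t (0 : R) (1 : R)) dT; rewrite sub0r in h; exact: h.
have dcomp : is_derive (0 : R) (1 : R) (fun h => E * phi (t - T h)) (E * (psi t * - p^-1)).
  have dphi0 : is_derive (t - T 0) (1 : R) phi (psi t) by rewrite T0 subr0.
  have h := @is_derive1_comp _ phi (fun h => t - T h) 0 _ _ dphi0 dshift.
  exact: (is_deriveZ E h).
have dsol : is_derive (0 : R) (1 : R) (fun h => sol t (h *: x + x) v) (E * (psi t * - p^-1)).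
  exact: near_eq_is_derive solE dcomp.
rewrite derive_line.
by case: dsol => _ ->; ring.
Qed.

(** Cauchy-Schwarz against the unit vector x discards the tangential part of the gradient and keeps
    the singular radial one. *)
Lemma bdry_grad_x_sol_ge t x v : 0 <= t -> dot x x = 1 -> dot x v < 0 ->
  psi t ^+ 2 * (maxwellian v / `|dot x v|) <=
    enorm (bdry_grad_x sol t x v) ^+ 2 * `|dot x v|.
Proof.
move=> t0 x1 xv.
have nxv : 0 < `|dot x v| by rewrite normr_gt0 lt_eqF.
rewrite mulrA ler_pdivrMr// -[leRHS]mulrA -expr2 sqr_enorm real_normK ?num_real//.
rewrite bdry_grad_x_sol//.
set G := grad_x _ _ _ _.
have zC : C1_region (t, (x, v)).
  by apply: closed_dom_C1_region; apply: sphere_closed_dom => //; rewrite lt_eqF.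
have [ds _] := C1on_sol cphi cpsi dphi zC.
have GE : dot x G = - (expR (- dot v v / 4) * psi t / dot x v).
  by rewrite /G -derive_dot_grad_x// derive_uncurry3_x derive_radial_sol.
have : dot x G ^+ 2 <= dot G G by have := CauchySchwarz_dot x G; rewrite x1 mul1r.
move=> /(ler_wpM2r (sqr_ge0 (dot x v))); apply: le_trans.
rewrite GE sqrrN expr_div_n divfK ?expf_neq0 ?lt_eqF// exprMn.
have EM : expR (- dot v v / 4) ^+ 2 = maxwellian v.
  by rewrite -sqrt_maxwellian sqr_sqrtr// ltW// maxwellian_gt0.
by rewrite EM mulrC.
Qed.

Lemma gamma_integral_ge0 (A : set (R3 R * R3 R)) (h : R3 R -> R3 R -> \bar R) :
  (forall x v, 0 <= h x v)%E -> (0 <= gamma_integral A h)%E.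
Proof.
move=> h0; apply: integral_ge0 => a [] /=; rewrite !in_itv/= => ha _.
rewrite mule_ge0//; last by rewrite lee_fin sin_ge0_pi.
by apply: integral_ge0 => v _; rewrite mule_ge0.
Qed.

Lemma le_gamma_integral (A B : set (R3 R * R3 R)) (h k : R3 R -> R3 R -> \bar R) :
  (forall x v, 0 <= h x v)%E -> (forall x v, 0 <= k x v)%E ->
  (forall x v, A (x, v) -> B (x, v) /\ (h x v <= k x v)%E) ->
  (gamma_integral A h <= gamma_integral B k)%E.
Proof.
move=> h0 k0 hk; apply: ge0_subset_le_integral.
- move=> a [] /=; rewrite !in_itv/= => ha _.
  rewrite mule_ge0//; last by rewrite lee_fin sin_ge0_pi.
  by apply: integral_ge0 => v _; rewrite mule_ge0.
- move=> a [] /=; rewrite !in_itv/= => ha _.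
  rewrite mule_ge0//; last by rewrite lee_fin sin_ge0_pi.
  by apply: integral_ge0 => v _; rewrite mule_ge0.
- move=> a aI; split=> //; move: aI => [] /=; rewrite !in_itv/= => ha _.
  rewrite lee_wpmul2r ?lee_fin ?sin_ge0_pi//.
  apply: ge0_subset_le_integral => v.
  + by move=> _; rewrite mule_ge0.
  + by move=> _; rewrite mule_ge0.
  + by move=> Av; have [Bv hkv] := hk _ _ Av; split=> //; rewrite lee_wpmul2r.
Qed.

Lemma gamma_integral_bdry_grad_x t : 0 <= t -> psi t != 0 ->
  (gamma_integral gamma_minus
    (fun x v => (enorm (bdry_grad_x sol t x v) ^+ 2)%:E) = +oo)%E.
Proof.
move=> t0 pt; apply: sphere_integral_infinite => x x1.
have a0 : 0 < psi t ^+ 2 by rewrite exprn_even_gt0.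
apply/eqP; rewrite -leye_eq -(integral_inverse_incoming a0 x1).
apply: ge0_subset_le_integral.
- move=> v _; rewrite lee_fin mulr_ge0 ?(ltW a0)// divr_ge0//.
  by rewrite ltW// maxwellian_gt0.
- by move=> v _; rewrite -EFinM lee_fin mulr_ge0// sqr_ge0.
- move=> v /= xv; split; last first.
    by rewrite normal_sphere// -EFinM lee_fin bdry_grad_x_sol_ge.
  by split; [exact/unit_sphereE|rewrite /= normal_sphere].
Qed.

Lemma time_integral_bdry_grad_x (a b : R) : 0 <= a -> a < b -> b <= 1 ->
  (forall s, a < s < b -> psi s != 0) ->
  (\int[lebesgue_measure]_(s in `[0%R, 1%R])
     gamma_integral gamma_minus
       (fun x v => (enorm (bdry_grad_x sol s x v) ^+ 2)%:E) = +oo)%E.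
Proof.
move=> a0 ab b1 pn0.
have h0 s x v : (0 <= (enorm (bdry_grad_x sol s x v) ^+ 2)%:E)%E.
  by rewrite lee_fin sqr_ge0.
apply/eqP; rewrite -leye_eq.
have -> : (+oo = \int[@lebesgue_measure R]_(s in `]a, b[) cst +oo s)%E.
  rewrite integral_cst//= gt0_mulye// lebesgue_measure_itv/= lte_fin ab.
  by rewrite -EFinD lte_fin subr_gt0.
apply: ge0_subset_le_integral.
- by move=> s _; exact: leey.
- by move=> s _; exact: gamma_integral_ge0.
- move=> s; rewrite /= !in_itv/= => /[dup] sab /andP[as_ sb]; split.
    by apply/andP; split; lra.
  by rewrite gamma_integral_bdry_grad_x//; [lra|exact: pn0].
Qed.

End boundary_gradient.

(** * Failure of the estimate *)

Section datum_gradient.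
Context {R : realType}.
Local Notation V3 := (measurableTypeR R * measurableTypeR R * measurableTypeR R)%type.
Implicit Types (x v e : R3 R).

(** Since the datum depends on |x|^2 + |v|^2 alone, its gradients are this common factor times x and
    times v; [flat_bump 2] is the derivative of [flat_bump 0]. *)
Let slope x v : R := - 2 * flat_bump 2 (radius2 - dot x x - dot v v).

Let derive_datum_line (a b c : R) (F : R -> R) :
  (forall h, F h = flat_bump 0 (a + b * h - c * h ^+ 2)) ->
  'D_(1 : R) F (0 : R) = flat_bump 2 a * b.
Proof.
move=> FE.
have dq := is_derive_quadratic a b c 0; rewrite mulr0 subr0 in dq.
have db := is_derive_flat_bump 0 (a + b * 0 - c * 0 ^+ 2).
have := @is_derive1_comp _ (flat_bump 0) (fun t => a + b * t - c * t ^+ 2) 0 _ _ db dq.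
rewrite mul0r subr0 (_ : a + b * 0 - c * 0 ^+ 2 = a); last by ring.
have -> : flat_bump 0 \o (fun t => a + b * t - c * t ^+ 2) = F.
  by apply/funext => h; rewrite FE.
by case.
Qed.

Let derive_datum_x x v e : 'D_e (fun y => datum (y, v)) x = slope x v * dot x e.
Proof.
rewrite derive_line (@derive_datum_line (radius2 - dot x x - dot v v) (- 2 * dot x e) (dot e e)).
  by rewrite /slope; ring.
move=> h; rewrite /datum/= [h *: e + x]addrC dot_linl !dot_linr (dotC e x).
by congr (flat_bump 0 _); ring.
Qed.

Let derive_datum_v x v e : 'D_e (fun w => datum (x, w)) v = slope x v * dot v e.
Proof.
rewrite derive_line (@derive_datum_line (radius2 - dot x x - dot v v) (- 2 * dot v e) (dot e e)).
  by rewrite /slope; ring.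
move=> h; rewrite /datum/= [h *: e + v]addrC dot_linl !dot_linr (dotC e v).
by congr (flat_bump 0 _); ring.
Qed.

Let box3 : set V3 := (`[-1, 1] `*` `[-1, 1]) `*` `[-1, 1].

(** The triple is the form that [grad] takes once unfolded, with y the variable of differentiation.
    The constant is 64 = (2 * 4)^2, with 4 the bound on [flat_bump 2]. *)
Let slope_bound x v y : (y = x \/ y = v) ->
  0 < dot ((slope x v * y.1.1, slope x v * y.1.2, slope x v * y.2) : R3 R)
      (slope x v * y.1.1, slope x v * y.1.2, slope x v * y.2) ->
  box3 x /\ box3 v /\
  dot ((slope x v * y.1.1, slope x v * y.1.2, slope x v * y.2) : R3 R)
      (slope x v * y.1.1, slope x v * y.1.2, slope x v * y.2) <= 64.
Proof.
have -> : dot ((slope x v * y.1.1, slope x v * y.1.2, slope x v * y.2) : R3 R)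
      (slope x v * y.1.1, slope x v * y.1.2, slope x v * y.2) = slope x v ^+ 2 * dot y y.
  by rewrite !dotE/=; ring.
move=> yE s0.
have q0 : 0 < radius2 - dot x x - dot v v.
  rewrite ltNge; apply/negP => q0; move: s0.
  by rewrite /slope flat_bump0// mulr0 expr0n mul0r ltxx.
have xx : dot x x <= 1 by have := dot_ge0 v; move: q0; rewrite /radius2; lra.
have vv : dot v v <= 1 by have := dot_ge0 x; move: q0; rewrite /radius2; lra.
have box w : dot w w <= 1 -> box3 w.
  rewrite dotE -!expr2 => w1.
  have itv (r : R) : r ^+ 2 <= 1 -> `[-1, 1]%classic r.
    by move=> r1; rewrite /= in_itv/=; apply/andP; split; nra.
  have [[s1 s2] s3] := (sqr_ge0 w.1.1, sqr_ge0 w.1.2, sqr_ge0 w.2).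
  by split; [split|]; apply: itv; lra.
split; [exact: box|split; [exact: box|]].
have yy : dot y y <= 1 by case: yE => ->.
have s4 : slope x v ^+ 2 <= 64.
  have b0 := flat_bump_ge0 2 (radius2 - dot x x - dot v v).
  have b4 := flat_bump_le 2 (radius2 - dot x x - dot v v).
  rewrite -natrX in b4; rewrite /slope; move: b0 b4; set b := flat_bump _ _ => b0 b4.
  have -> : (- 2 * b) ^+ 2 = 4 * (b * b) by ring.
  have : b * b <= 4 * 4 by rewrite ler_pM.
  lra.
have := dot_ge0 y; have := sqr_ge0 (slope x v); nra.
Qed.

Let leb33_box_fin : (leb33 (box3 `*` box3) < +oo)%E.
Proof.
have mB : measurable box3 by apply: measurableX; [apply: measurableX|]; exact: measurable_itv.
have -> : (leb33 (box3 `*` box3) = leb3 box3 * leb3 box3)%E by exact: product_measure1E.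
have le11 : -1 < 1 :> R by lra.
by rewrite /box3 (leb3_box le11 le11 le11) -EFinM ltry.
Qed.

(** The integrand vanishes off a box of computable measure, where it is at most 64; the hypothesis
    packs support and bound together. *)
Lemma Lp_pow_finite (G : R3 R -> R3 R -> R3 R) :
  (forall x v, 0 < dot (G x v) (G x v) -> box3 x /\ box3 v /\ dot (G x v) (G x v) <= 64) ->
  (Lp_pow 2 G < +oo)%E.
Proof.
move=> hG; rewrite /Lp_pow.
have mB : measurable box3 by apply: measurableX; [apply: measurableX|]; exact: measurable_itv.
have mBB : measurable (box3 `*` box3) by exact: measurableX.
have GE x v : enorm (G x v) `^ 2 = dot (G x v) (G x v).
  by rewrite powR_mulrn ?enorm_ge0// sqr_enorm.
have -> : (\int[leb33]_(z in unit_ball `*` setT) (enorm (G z.1 z.2) `^ 2)%:E =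
    \int[leb33]_(z in (unit_ball `*` setT) `&` (box3 `*` box3)) (enorm (G z.1 z.2) `^ 2)%:E)%E.
  rewrite [RHS]integral_mkcondr; apply: eq_integral => z _; rewrite patchE.
  case: ifPn => // /negP zB; rewrite GE; congr (_%:E).
  apply/eqP; rewrite eq_le dot_ge0 andbT leNgt; apply/negP => /hG[h1 [h2 _]].
  by apply: zB; apply/mem_set.
apply: (@le_lt_trans _ _ (\int[leb33]_(z in box3 `*` box3) cst 64%:E z)%E).
  apply: ge0_subset_le_integral.
  - by move=> z _; rewrite lee_fin powR_ge0.
  - by move=> z _; rewrite lee_fin.
  - move=> z [_ zB]; split=> //; rewrite lee_fin GE.
    by have [g0|/hG[_ []//]] := leP (dot (G z.1 z.2) (G z.1 z.2)) 0; rewrite (le_trans g0).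
by rewrite integral_cst// lte_mul_pinfty ?lee_fin.
Qed.

Lemma Lp_pow_grad_datum_x : (Lp_pow 2 (fun x v => grad (fun y => datum (y, v)) x) < +oo :> \bar R)%E.
Proof.
apply: Lp_pow_finite => x v; rewrite /grad !derive_datum_x.
rewrite !(dotE x)/= !mulr0 !mulr1 !addr0 !add0r.
by apply: slope_bound; left.
Qed.

Lemma Lp_pow_grad_datum_v : (Lp_pow 2 (fun x v => grad (fun w => datum (x, w)) v) < +oo :> \bar R)%E.
Proof.
apply: Lp_pow_finite => x v; rewrite /grad !derive_datum_v.
rewrite !(dotE v)/= !mulr0 !mulr1 !addr0 !add0r.
by apply: slope_bound; right.
Qed.

End datum_gradient.

Section estimate_fails.
Context {R : realType}.

(** The polynomial term is a real number, so the right-hand side is finite as soon as the two data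
    norms are. *)
Lemma infinite_estimate_absurd (a b i a' b' : \bar R) (c p : R) :
  (0 <= a)%E -> (0 <= b)%E -> i = +oo%E ->
  (0 <= a')%E -> (a' < +oo)%E -> (0 <= b')%E -> (b' < +oo)%E ->
  ~ (a + b + i <= c%:E * (a' + b' + p%:E))%E.
Proof.
move=> a0 b0 -> a'0 a'y b'0 b'y.
have -> : (a + b + +oo = +oo)%E.
  by rewrite addey// -ltNye (@lt_le_trans _ _ 0%E)// adde_ge0.
have -> : a' = (fine a')%:E by rewrite fineK// ge0_fin_numE.
have -> : b' = (fine b')%:E by rewrite fineK// ge0_fin_numE.
by rewrite -!EFinD -EFinM leye_eq.
Qed.

Lemma W1p_estimate_fails (c theta t : R) (P : {poly R}) (f : R -> R3 R -> R3 R -> R) :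
  1 <= t -> diffuse_solution c datum f ->
  (\int[lebesgue_measure]_(s in `[0%R, 1%R])
     gamma_integral gamma_minus
       (fun x v => (enorm (bdry_grad_x f s x v) ^+ 2)%:E) = +oo)%E ->
  ~ W1p_estimate c 2 theta P t.
Proof.
move=> t1 sf foo [C] /(_ datum f (@test_datum_datum R) sf).
have Lp0 (G : R3 R -> R3 R -> R3 R) : (0 <= Lp_pow 2 G)%E.
  by apply: integral_ge0 => z _; rewrite lee_fin powR_ge0.
have bdry0 (G : R3 R -> R3 R -> R3 R) : (0 <= bdry_Lp_pow 2 G)%E.
  by apply: gamma_integral_ge0 => x v; rewrite lee_fin powR_ge0.
have oo : (\int[lebesgue_measure]_(s in `[0%R, t])
   (bdry_Lp_pow 2 (bdry_grad_x f s) + bdry_Lp_pow 2 (bdry_grad_v f s)) = +oo)%E.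
  (* Restricting to times in [0, 1], to [gamma_minus] and to the space gradient already leaves an
     infinite integral. *)
  apply/eqP; rewrite -leye_eq -foo; apply: ge0_subset_le_integral.
  - by move=> s _; apply: gamma_integral_ge0 => x v; rewrite lee_fin sqr_ge0.
  - by move=> s _; rewrite adde_ge0.
  - move=> s; rewrite /= !in_itv/= => /andP[s0 s1]; split.
      by rewrite s0 (le_trans s1).
    apply: le_trans (leeDl _ (bdry0 _)); apply: le_gamma_integral.
    + by move=> x v; rewrite lee_fin sqr_ge0.
    + by move=> x v; rewrite lee_fin powR_ge0.
    + by move=> x v [/= xs _]; split=> //; rewrite powR_mulrn ?enorm_ge0.
apply: infinite_estimate_absurd; [exact: Lp0|exact: Lp0|exact: oo| | | |].
- exact: Lp0.
- exact: Lp_pow_grad_datum_x.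
- exact: Lp0.
- exact: Lp_pow_grad_datum_v.
Qed.

End estimate_fails.

Unset Implicit Arguments.

Theorem lemma10 (R : realType) (cmu : R)
    (cmuE : forall x : R3 R, unit_sphere x ->
      cmu * (\int[leb3]_(u in [set u : R3 R | (0 < dot (normal x) u)%R])
               (maxwellian u * dot (normal x) u))%R = 1) :
  (exists (f0 : R3 R * R3 R -> R) (f : R -> R3 R -> R3 R -> R),
    [/\ test_datum f0,
        diffuse_solution cmu f0 f,
        (forall g, diffuse_solution cmu f0 g ->
           forall t x v, closed_dom (t, (x, v)) -> g t x v = f t x v) &
        (\int[lebesgue_measure]_(s in `[0%R, 1%R])
           gamma_integral gamma_minus
             (fun x v => (enorm (bdry_grad_x f s x v) ^+ 2)%:E) = +oo)%E])
  /\
  (forall (theta : R) (P : {poly R}) (t : R), 0 < theta < 4^-1 -> 1 <= t ->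
     ~ W1p_estimate cmu 2 theta P t).
Proof.
have e3e3 : dot north_pole north_pole = 1 :> R by rewrite dotE/= !mul0r !add0r mul1r.
have cE : cmu * (\int[leb3]_(u in half_space) flux_density u)%R = 1.
  have de3 u : dot north_pole u = u.2 :> R by rewrite dotE/= !mul0r !add0r mul1r.
  have := cmuE north_pole ((unit_sphereE _).2 e3e3); rewrite normal_sphere//.
  rewrite (_ : [set u : R3 R | 0 < dot north_pole u] = half_space); last first.
    by apply/seteqP; split=> u; rewrite /half_space/= de3.
  by rewrite (_ : (fun u => _) = flux_density)//; apply/funext => u; rewrite de3.
have [S' [cS' dS]] := exists_source_derivative cE.
have [phi [psi [cphi cpsi dphi phiE]]] :=
  exists_renewal_solution_C1 cE (causal_source cE) cS' dS.
have sf : diffuse_solution cmu datum (sol phi) := diffuse_solution_sol cE cphi cpsi dphi phiE.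
have [a [b [a0 ab b1 pn0]]] := renewal_density_neq0 cE cphi cpsi dphi phiE.
have foo := time_integral_bdry_grad_x cphi cpsi dphi a0 ab b1 pn0.
split; last by move=> theta P t _ t1; exact: W1p_estimate_fails t1 sf foo.
exists datum, (sol phi); split=> //; first exact: test_datum_datum.
by move=> g sg; have := diffuse_solution_unique cE sg sf; exact.
Qed.
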